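(* Let $1\le p<\infty$ and $\mathbf{T}=(T_1,\dots,T_d)\in\mathfrak{C}_p^d(\mathcal{H})$. Then $\widehat{\mathbf{T}}(t)\in\mathfrak{C}_p^d(\mathcal{H})$ for each $0\le t\le1$, and $$\|\widehat{\mathbf{T}}(t)\|_{s,p}\le 2r_0\|\widetilde{\mathbf{T}}\|_{s,p}+(1-2r_0)\|\widehat{\mathbf{T}}\|_{s,p}\le\|\widehat{\mathbf{T}}\|_{s,p}\le\frac{1+\sqrt[p]{d}}{2}\|\mathbf{T}\|_{s,p},$$ where $r_0=\min\{t,1-t\}$. In particular, $\|\widetilde{\mathbf{T}}\|_{s,p}\le\|\widehat{\mathbf{T}}\|_{s,p}\le\frac{1+\sqrt[p]{d}}{2}\|\mathbf{T}\|_{s,p}$.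
   Context: $\mathcal{H}$ is a separable complex Hilbert space, $\mathfrak{B}(\mathcal{H})$ the bounded linear operators on $\mathcal{H}$, and $d\in\mathbb{N}$. For $\mathbf{T}=(T_1,\dots,T_d)\in\mathfrak{B}(\mathcal{H})^d$ put $P=\sqrt{T_1^*T_1+\cdots+T_d^*T_d}$. For $1\le p<\infty$, $\mathbf{T}\in\mathfrak{C}_p^d(\mathcal{H})$ means $\mathrm{tr}(P^p)<\infty$ (equivalently, the column operator $\mathcal{H}\to\mathcal{H}^d$ with entries $T_1,\dots,T_d$ is in the Schatten $p$-class), and the spherical Schatten $p$-norm is $\|\mathbf{T}\|_{s,p}=[\mathrm{tr}(P^p)]^{1/p}$. Canonical spherical polar decomposition: $\mathbf{T}=\mathbf{V}P=(V_1P,\dots,V_dP)$, where $\mathbf{V}=(V_1,\dots,V_d)$, viewed as a column operator $\mathcal{H}\to\mathcal{H}^d$, is the partial isometry with initial space $\mathcal{N}(P)^\perp$; that is, $T_i=V_iP$ for all $i$ and $\sum_{i=1}^dV_i^*V_i$ is the orthogonal projection onto $\mathcal{N}(P)^\perp$. The convention $P^0=I$ is used. For $t\in[0,1]$: the generalized spherical Aluthge transform is $\widetilde{\mathbf{T}}(t)=(P^tV_1P^{1-t},\dots,P^tV_dP^{1-t})$; the spherical Aluthge transform is $\widetilde{\mathbf{T}}=\widetilde{\mathbf{T}}(1/2)$; the spherical Duggal transform is $\mathbf{T}^D=(PV_1,\dots,PV_d)$; the spherical mean transform is $\widehat{\mathbf{T}}=\frac12(\mathbf{T}+\mathbf{T}^D)$;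 the spherical Heinz transform is $\widehat{\mathbf{T}}(t)=\frac12(\widetilde{\mathbf{T}}(t)+\widetilde{\mathbf{T}}(1-t))$ (coordinatewise operations). *)

(* Defs.v *)
From HB Require Import structures.
From mathcomp Require Import all_boot all_order all_algebra.
From mathcomp Require Import complex.
From mathcomp Require Import all_classical all_reals all_analysis.
Import Order.TTheory GRing.Theory Num.Theory.
Import numFieldNormedType.Exports.

Set Implicit Arguments.
Unset Strict Implicit.
Unset Printing Implicit Defensive.

Local Open Scope classical_set_scope.
Local Open Scope ring_scope.

(* Inner products are linear in the first argument and conjugate-linear in the
   second one. *)
HB.mixin Record CompleteNormedModule_isHilbert (R : realType) H
    of CompleteNormedModule R[i] H := {
  dotH : {dot H for (@Num.conj R[i])} ;
  dotHxx : forall x : H, dotH x x = `|x| ^+ 2 }.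

#[short(type="hilbertType")]
HB.structure Definition Hilbert (R : realType) :=
  {H of CompleteNormedModule R[i] H & CompleteNormedModule_isHilbert R H}.

Definition separable_space (T : topologicalType) : Prop :=
  exists2 D : set T, countable D & dense D.

Section Operators.
Context {R : realType} {H : hilbertType R}.
Implicit Types (A B E : H -> H) (S : set H).

(* The elements of B(H) are represented by their underlying functions, so that
   sums and scalar multiples of operators are those of the function space. *)
Definition bounded_op A : Prop := linear A /\ continuous A.

Definition adj A : H -> H :=
  xget 0 [set B | bounded_op B /\ forall x y, dotH (A x) y = dotH x (B y)].

(* On R[i], [0 <= z] means that z is real and nonnegative. *)
Definition positive_op A : Prop :=
  bounded_op A /\ forall x, 0 <= dotH (A x) x.

Definition op_sqrt A : H -> H :=
  xget 0 [set B | positive_op B /\ B \o B = A].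

Definition op_norm A : R :=
  sup [set complex.Re `|A x| | x in [set x : H | `|x| <= 1]].

Definition op_poly (q : {poly R}) A : H -> H :=
  fun x => \sum_(k < size q) (q`_k)%:C%C *: iter k A x.

(* Continuous functional calculus for a positive operator A, whose spectrum
   lies in [0, ||A||]: f(A) is the norm limit of q_n(A) for polynomials q_n
   converging to f uniformly on [0, ||A||]. *)
Definition op_calc (f : R -> R) A : H -> H :=
  xget 0 [set B | bounded_op B /\
    exists q : nat -> {poly R},
      {uniform `[0, op_norm A], (fun n s => (q n).[s]) @ \oo --> f} /\
      op_norm (op_poly (q n) A - B) @[n --> \oo] --> (0 : R)].

(* Since [s `^ 0 = 1] also at s = 0, this gives A^0 = I. *)
Definition op_pow A (t : R) : H -> H := op_calc (fun s => s `^ t) A.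

Definition orthonormal_basis S : Prop :=
  (forall x y, S x -> S y -> dotH x y = (x == y)%:R) /\
  (forall x, (forall e, S e -> dotH x e = 0) -> x = 0).

Definition some_onb : set H := xget set0 orthonormal_basis.

(* Only used for positive A, where the sum has nonnegative terms and does not
   depend on the orthonormal basis. *)
Definition op_trace A : \bar R :=
  (\esum_(e in some_onb) (complex.Re (dotH (A e) e))%:E)%E.

Definition op_ker A : set H := [set x | A x = 0].

Definition orthocompl S : set H := [set x | forall y, S y -> dotH x y = 0].

Definition orthogonal_proj S E : Prop :=
  forall x, S (E x) /\ orthocompl S (x - E x).

End Operators.

Section Tuples.
Context {R : realType} {H : hilbertType R} {d : nat}.
Implicit Types (T V : 'I_d -> H -> H) (p t : R).

Definition sph_mod T : H -> H := op_sqrt (\sum_(i < d) (adj (T i) \o T i)).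

Definition in_schatten p T : Prop :=
  (forall i, bounded_op (T i)) /\ (op_trace (op_pow (sph_mod T) p) < +oo)%E.

Definition sph_norm p T : \bar R :=
  (op_trace (op_pow (sph_mod T) p) `^ p^-1)%E.

Definition sph_polar T V : Prop :=
  [/\ forall i, bounded_op (V i),
      forall i, T i = V i \o sph_mod T
    & orthogonal_proj (orthocompl (op_ker (sph_mod T)))
        (\sum_(i < d) (adj (V i) \o V i))].

(* In the transforms, V is the isometric part of the polar decomposition
   of T. *)
Definition gen_aluthge t T V : 'I_d -> H -> H :=
  fun i => op_pow (sph_mod T) t \o V i \o op_pow (sph_mod T) (1 - t).

Definition aluthge T V : 'I_d -> H -> H := gen_aluthge 2^-1 T V.

Definition duggal T V : 'I_d -> H -> H := fun i => sph_mod T \o V i.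

Definition sph_mean T V : 'I_d -> H -> H :=
  fun i => (2^-1 : R[i]) *: (T i + duggal T V i).

Definition heinz t T V : 'I_d -> H -> H :=
  fun i => (2^-1 : R[i]) *: (gen_aluthge t T V i + gen_aluthge (1 - t) T V i).

End Tuples.

(* Main.v *)
Require Import Defs.
From HB Require Import structures.
From mathcomp Require Import all_boot all_order all_algebra.
From mathcomp Require Import sesquilinear spectral.
From mathcomp Require Import complex.
From mathcomp Require Import all_classical all_reals all_analysis.
From mathcomp Require Import ring lra.

(** View a d-tuple T as the column operator X from H to the Hilbert sum of d
    copies of H. The Schatten p-norm of X is then a supremum over finite data:
    for finite families e_ji in H and f_ji in the sum, both of which satisfy
    Bessel's inequality jointly and have sum_i |e_ji|^2, sum_i |f_ji|^2 <= 1 for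
    every j, consider

      (sum_(j < n) |sum_i <X e_ji, f_ji>|^p)^(1/p).

    The supremum N_n(X) of these numbers for fixed n is a seminorm which is
    finite on all bounded operators. A bound N_n(X) <= c for all n is equivalent
    to tr P^p <= c^p, with P the modulus of T ([op_trace_le_test] and
    [test_norm_le_trace]); in particular it implies membership in the Schatten
    class. Both directions work without compactness: a positive operator is
    compressed to the Krylov space of finitely many vectors and diagonalized
    there, which computes polynomials of the operator on these vectors exactly
    ([krylov_spectral]). The same device shows that |q(A)| is at most the
    supremum of |q| on [0, |A|], hence gives the continuous functional calculus.

    The main inequality is N_n(QXQ) <= N_n((Q^2 X + X Q^2) / 2) for bounded
    selfadjoint Q ([test_norm_agm]). Let C = (1 - Q^2) (1 + Q^2)^-1 and
    G_m = 2 Q (1 + Q^2)^-1 C^m, and write Y for the operator on the right. An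
    algebraic identity telescopes to

      <QXQ e, f> = sum_(m < M) <Y G_m e, G_m f> + <QXQ C^M e, C^M f>,

    the last term tends to 0, and since sum_m G_m^2 <= 1 the families G_m e_ji
    and G_m f_ji are again test data.

    Let g(t) be the test norm of (P^t V P^(1-t) + P^(1-t) V P^t) / 2, the column
    of the Heinz transform. With Q = P^s the main inequality becomes
    g(t) <= (g(t - s) + g(t + s)) / 2. As g is bounded and g(t) = g(1 - t), it
    lies below its chord on [0, 1/2] ([midpoint_convex_chord]), whose ends are
    the mean transform, at t = 0, and the Aluthge transform, at t = 1/2; also
    g(1/2) <= (g(0) + g(1)) / 2 = g(0). These are the inequalities between
    the transforms.

    The last bound is the triangle inequality for the mean of T and of its
    Duggal transform. The latter is V followed by P acting on each coordinate of
    the column; V is a contraction, and the diagonal operator repeats each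
    singular value of P d times, so that N_n of the Duggal transform is at most
    d^(1/p) times the p-norm of T ([duggal_test_sum]). *)

Import Order.TTheory GRing.Theory Num.Theory.
Import numFieldNormedType.Exports.
Set Implicit Arguments.
Unset Strict Implicit.
Unset Printing Implicit Defensive.
Local Open Scope classical_set_scope.
Local Open Scope ring_scope.

(** * Complex moduli and inner products *)

Section Modulus.
Context {R : realType}.
Implicit Types (z w : R[i]) (a : R).

Definition cmod z : R := complex.Re `|z|.

Lemma cmodE z : `|z| = (cmod z)%:C%C.
Proof. by []. Qed.

Lemma cmod_ge0 z : 0 <= cmod z.
Proof. by have := normr_ge0 z; rewrite cmodE lecR. Qed.

Lemma cmodM z w : cmod (z * w) = cmod z * cmod w.
Proof. by apply: complexI; rewrite rmorphM /= -!cmodE normrM. Qed.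

Lemma cmodD z w : cmod (z + w) <= cmod z + cmod w.
Proof. by rewrite -lecR rmorphD /= -!cmodE ler_normD. Qed.

Lemma cmodN z : cmod (- z) = cmod z.
Proof. by rewrite /cmod normrN. Qed.

Lemma cmodJ z : cmod (Num.conj z) = cmod z.
Proof. by apply: complexI; rewrite -!cmodE norm_conjC. Qed.

Lemma cmod0 : cmod 0 = 0.
Proof. by rewrite /cmod normr0. Qed.

Lemma cmod_real a : cmod a%:C%C = `|a|.
Proof.
by rewrite /cmod normc_def /= expr0n /= addr0 sqrtr_sqr.
Qed.

Lemma cmod_nat n : cmod n%:R = n%:R.
Proof. by rewrite -(rmorph_nat (real_complex R)) cmod_real ger0_norm. Qed.

Lemma half_real : (2^-1 : R[i]) = (2^-1)%:C%C.
Proof. by rewrite fmorphV rmorph_nat. Qed.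

Lemma cmod_half : cmod 2^-1 = 2^-1.
Proof. by rewrite half_real cmod_real ger0_norm ?invr_ge0. Qed.

Lemma cmod_sqr z : ((cmod z) ^+ 2)%:C%C = z * Num.conj z.
Proof. by rewrite rmorphXn /= -cmodE normCK. Qed.

Lemma cmod_sum (I : finType) (F : I -> R[i]) : cmod (\sum_i F i) <= \sum_i cmod (F i).
Proof.
elim/big_ind2: _ => [|x1 x2 y1 y2 h1 h2|i _]; rewrite ?cmod0 //.
by rewrite (le_trans (cmodD _ _))// lerD.
Qed.

Lemma Re_le_cmod z : complex.Re z <= cmod z.
Proof.
have := normc_ge_Re z; rewrite cmodE lecR; apply: le_trans; exact: ler_norm.
Qed.

Lemma ReD z w : complex.Re (z + w) = complex.Re z + complex.Re w.
Proof. by case: z w => [? ?] []. Qed.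

Lemma ReN z : complex.Re (- z) = - complex.Re z.
Proof. by case: z. Qed.

Lemma Re_sum (I : Type) (r : seq I) (F : I -> R[i]) :
  complex.Re (\sum_(i <- r) F i) = \sum_(i <- r) complex.Re (F i).
Proof. by elim/big_rec2: _ => //= i x y _ <-; rewrite ReD. Qed.

Lemma Re_real_mul a z : complex.Re (a%:C%C * z) = a * complex.Re z.
Proof. by case: z => x y /=; rewrite mul0r subr0. Qed.

Lemma Re_conj z : complex.Re (Num.conj z) = complex.Re z.
Proof. by case: z. Qed.

Lemma conj_real a : Num.conj a%:C%C = a%:C%C :> R[i].
Proof. exact: conjc_real. Qed.

Lemma cmod_eq0 z : cmod z = 0 -> z = 0.
Proof. by move=> h; apply/eqP; rewrite -normr_eq0 cmodE h. Qed.

Lemma RRe_ge0 z : 0 <= z -> (complex.Re z)%:C%C = z.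
Proof. by move=> /ger0_real /RRe_real. Qed.

End Modulus.

Section LinearMaps.
Context {R : realType} {U V : lmodType R[i]} (A : U -> V) (lA : linear A).

Lemma lin0 : A 0 = 0.
Proof. by have := lA (-1) 0 0; rewrite scaler0 addr0 scaleN1r addNr. Qed.

Lemma linZ a x : A (a *: x) = a *: A x.
Proof. by have := lA a x 0; rewrite !addr0 lin0 addr0. Qed.

Lemma linD x y : A (x + y) = A x + A y.
Proof. by have := lA 1 x y; rewrite !scale1r. Qed.

Lemma linN x : A (- x) = - A x.
Proof. by rewrite -scaleN1r linZ scaleN1r. Qed.

Lemma linB x y : A (x - y) = A x - A y.
Proof. by rewrite linD linN. Qed.

Lemma lin_sum (I : Type) (r : seq I) (F : I -> U) :
  A (\sum_(i <- r) F i) = \sum_(i <- r) A (F i).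
Proof. by elim/big_rec2: _ => [|i x y _ <-]; rewrite ?lin0 ?linD. Qed.

End LinearMaps.

Section PreHilbert.
Context {R : realType} {U : lmodType R[i]} (dot : {dot U for @Num.conj R[i]}).
Implicit Types (x y z : U) (a : R[i]).

Lemma dotC x y : dot x y = Num.conj (dot y x).
Proof. by rewrite hermC expr0 mul1r. Qed.
Lemma dotDl x y z : dot (x + y) z = dot x z + dot y z.
Proof. exact: linearDl. Qed.
Lemma dotDr x y z : dot x (y + z) = dot x y + dot x z.
Proof. exact: linearDr. Qed.
Lemma dotZl a x y : dot (a *: x) y = a * dot x y.
Proof. exact: linearZl_LR. Qed.
Lemma dotZr a x y : dot x (a *: y) = Num.conj a * dot x y.
Proof. exact: linearZr_LR. Qed.
Lemma dot0l x : dot 0 x = 0.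
Proof. exact: linear0l. Qed.
Lemma dot0r x : dot x 0 = 0.
Proof. exact: linear0r. Qed.
Lemma dotNl x y : dot (- x) y = - dot x y.
Proof. exact: linearNl. Qed.
Lemma dotNr x y : dot x (- y) = - dot x y.
Proof. exact: linearNr. Qed.
Lemma dotBl x y z : dot (x - y) z = dot x z - dot y z.
Proof. by rewrite dotDl dotNl. Qed.
Lemma dotBr x y z : dot x (y - z) = dot x y - dot x z.
Proof. by rewrite dotDr dotNr. Qed.
Lemma dot_suml (I : Type) (r : seq I) (F : I -> U) y :
  dot (\sum_(i <- r) F i) y = \sum_(i <- r) dot (F i) y.
Proof. by elim/big_rec2: _ => [|i p q _ <-]; rewrite ?dot0l ?dotDl. Qed.
Lemma dot_sumr (I : Type) (r : seq I) (F : I -> U) y :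
  dot y (\sum_(i <- r) F i) = \sum_(i <- r) dot y (F i).
Proof. by elim/big_rec2: _ => [|i p q _ <-]; rewrite ?dot0r ?dotDr. Qed.

Definition sqn x : R := complex.Re (dot x x).

Lemma sqnE x : dot x x = (sqn x)%:C%C.
Proof. by rewrite /sqn RRe_ge0. Qed.

Lemma sqn_ge0 x : 0 <= sqn x.
Proof. by have := dnorm_ge0 dot x; rewrite sqnE lecR. Qed.

Lemma sqn_eq0 x : sqn x = 0 -> x = 0.
Proof. by move=> h; apply/eqP; rewrite -(dnorm_eq0 dot) sqnE h. Qed.

Lemma sqn0 : sqn 0 = 0.
Proof. by rewrite /sqn dot0l. Qed.

Lemma sqnZ a x : sqn (a *: x) = (cmod a) ^+ 2 * sqn x.
Proof.
apply: complexI; rewrite [RHS]rmorphM /= -sqnE dotZl dotZr sqnE mulrA -cmod_sqr//.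
Qed.

Lemma sqnN x : sqn (- x) = sqn x.
Proof. by rewrite /sqn dotNl dotNr opprK. Qed.

Lemma sqnD x y : sqn (x + y) = sqn x + sqn y + 2 * complex.Re (dot x y).
Proof.
rewrite /sqn dotDl !dotDr !ReD (dotC y x) Re_conj; ring.
Qed.

Lemma sqnB x y : sqn (x - y) = sqn x + sqn y - 2 * complex.Re (dot x y).
Proof. by rewrite sqnD sqnN dotNr ReN mulrN. Qed.

Definition orthonormal_fam (I : finType) (u : I -> U) :=
  forall k l, dot (u k) (u l) = (k == l)%:R.

Lemma dot_fam_sum (I : finType) (u : I -> U) (c : I -> R[i]) k :
  orthonormal_fam u -> dot (\sum_l c l *: u l) (u k) = c k.
Proof.
move=> ou; rewrite dot_suml (bigD1 k)//= dotZl ou eqxx mulr1 big1 ?addr0//.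
by move=> l /negbTE lk; rewrite dotZl ou lk mulr0.
Qed.

Lemma sqn_fam_sum (I : finType) (u : I -> U) (c : I -> R[i]) :
  orthonormal_fam u -> sqn (\sum_l c l *: u l) = \sum_l (cmod (c l)) ^+ 2.
Proof.
move=> ou; apply: complexI; rewrite -sqnE rmorph_sum /= dot_sumr.
apply: eq_bigr => l _; rewrite dotZr dot_fam_sum// cmod_sqr; exact: mulrC.
Qed.

Lemma sqn_residual (I : finType) (u : I -> U) x : orthonormal_fam u ->
  sqn (x - \sum_l dot x (u l) *: u l) =
  sqn x - \sum_l (cmod (dot x (u l))) ^+ 2.
Proof.
move=> ou; rewrite sqnB sqn_fam_sum// dot_sumr Re_sum.
have -> : \sum_i complex.Re (dot x (dot x (u i) *: u i)) =
   \sum_l (cmod (dot x (u l))) ^+ 2.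
  apply: eq_bigr => i _; rewrite dotZr mulrC.
  by have := cmod_sqr (dot x (u i)) => <-.
ring.
Qed.

(** Vectors of norm at most 1 are allowed so that a normalized family may
    contain zero vectors: [normalized] sends 0 to 0. *)
Definition suborthonormal_fam (I : finType) (u : I -> U) :=
  (forall k l, k != l -> dot (u k) (u l) = 0) /\ (forall k, sqn (u k) <= 1).

Lemma orthonormal_famW (I : finType) (u : I -> U) :
  orthonormal_fam u -> suborthonormal_fam u.
Proof.
by move=> ou; split=> [k l /negbTE kl|k]; rewrite /sqn ou ?kl// eqxx.
Qed.

Lemma cmod_dotC x y : cmod (dot x y) = cmod (dot y x).
Proof. by rewrite dotC cmodJ. Qed.

(** Expand the squared distance of x to the sum of the <x, u_k> u_k: the cross
    terms contribute -2 |<x, u_k>|^2 and, as |u_k| <= 1, the squared norm of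
    the sum gives back at most |<x, u_k>|^2. *)
Lemma bessel (I : finType) (u : I -> U) x : suborthonormal_fam u ->
  \sum_k (cmod (dot x (u k))) ^+ 2 <= sqn x.
Proof.
move=> [ou u1]; pose c k := dot x (u k).
have cu k : dot (\sum_l c l *: u l) (u k) = c k * (sqn (u k))%:C%C.
  rewrite dot_suml (bigD1 k)//= dotZl sqnE big1 ?addr0//.
  by move=> l lk; rewrite dotZl ou// mulr0.
have := sqn_ge0 (x - \sum_l c l *: u l); rewrite sqnB.
have -> : sqn (\sum_l c l *: u l) = \sum_k (cmod (c k)) ^+ 2 * sqn (u k).
  apply: complexI; rewrite -sqnE rmorph_sum /= dot_sumr.
  apply: eq_bigr => k _; rewrite dotZr cu [RHS]rmorphM /= cmod_sqr; ring.
have -> : complex.Re (dot x (\sum_l c l *: u l)) = \sum_k (cmod (c k)) ^+ 2.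
  rewrite dot_sumr Re_sum; apply: eq_bigr => k _.
  by rewrite dotZr mulrC; have := cmod_sqr (c k) => <-.
have : \sum_k cmod (c k) ^+ 2 * sqn (u k) <= \sum_k cmod (c k) ^+ 2.
  by apply: ler_sum => k _; rewrite ler_piMr ?sqr_ge0.
rewrite -/c; lra.
Qed.

Lemma cauchy_schwarz x y : (cmod (dot x y)) ^+ 2 <= sqn x * sqn y.
Proof.
have [y0|yn0] := eqVneq (sqn y) 0.
  by rewrite (sqn_eq0 y0) dot0r cmod0 sqn0 mulr0 expr0n.
have y0 : 0 < sqn y by rewrite lt_def yn0 sqn_ge0.
(* The vector subtracted from x is its projection onto the line of y. *)
have := sqn_ge0 (x - (dot x y * (sqn y)^-1%:C%C) *: y).
rewrite sqnB sqnZ dotZr.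
have -> : Num.conj (dot x y * (sqn y)^-1%:C%C) * dot x y =
    (cmod (dot x y) ^+ 2 / sqn y)%:C%C.
  rewrite rmorphM /= conj_real [RHS]rmorphM /= cmod_sqr; ring.
rewrite [complex.Re _%:C%C]/=.
rewrite cmodM cmod_real ger0_norm ?invr_ge0 ?sqn_ge0//.
have -> : sqn x + (cmod (dot x y) * (sqn y)^-1) ^+ 2 * sqn y -
  2 * (cmod (dot x y) ^+ 2 / sqn y) = sqn x - cmod (dot x y) ^+ 2 / sqn y by field.
by rewrite subr_ge0 ler_pdivrMr.
Qed.

Definition hnorm x : R := Num.sqrt (sqn x).

Lemma hnorm_ge0 x : 0 <= hnorm x.
Proof. exact: sqrtr_ge0. Qed.

Lemma hnorm_sqr x : hnorm x ^+ 2 = sqn x.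
Proof. by rewrite sqr_sqrtr// sqn_ge0. Qed.

Lemma hnorm0 : hnorm 0 = 0.
Proof. by rewrite /hnorm sqn0 sqrtr0. Qed.

Lemma hnorm_eq0 x : hnorm x = 0 -> x = 0.
Proof. by move=> h; apply: sqn_eq0; rewrite -hnorm_sqr h expr0n. Qed.

Lemma hnormN x : hnorm (- x) = hnorm x.
Proof. by rewrite /hnorm sqnN. Qed.

Lemma hnormZ a x : hnorm (a *: x) = cmod a * hnorm x.
Proof.
by rewrite /hnorm sqnZ sqrtrM ?sqr_ge0// sqrtr_sqr ger0_norm// cmod_ge0.
Qed.

Lemma cauchy_schwarz_hnorm x y : cmod (dot x y) <= hnorm x * hnorm y.
Proof.
rewrite -(@ler_pXn2r _ 2)// ?nnegrE ?cmod_ge0 ?mulr_ge0 ?hnorm_ge0//.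
by rewrite exprMn !hnorm_sqr cauchy_schwarz.
Qed.

Lemma hnormD x y : hnorm (x + y) <= hnorm x + hnorm y.
Proof.
rewrite -(@ler_pXn2r _ 2)// ?nnegrE ?addr_ge0 ?hnorm_ge0//.
rewrite hnorm_sqr sqnD sqrrD !hnorm_sqr.
have := le_trans (Re_le_cmod _) (cauchy_schwarz_hnorm x y); lra.
Qed.

Lemma sqn_le_hnorm x y : (sqn x <= sqn y) = (hnorm x <= hnorm y).
Proof. by rewrite -!hnorm_sqr ler_pXn2r// nnegrE hnorm_ge0. Qed.

(** Equal to 0 at 0, since inversion in R sends 0 to 0. *)
Definition normalized x : U := (hnorm x)^-1%:C%C *: x.

Lemma hnorm_normalized x : x != 0 -> hnorm (normalized x) = 1.
Proof.
move=> x0; have h0 : hnorm x != 0 by apply: contra_neq x0 => /hnorm_eq0.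
by rewrite hnormZ cmod_real ger0_norm ?invr_ge0 ?hnorm_ge0// mulVf.
Qed.

Lemma normalizedK x : (hnorm x)%:C%C *: normalized x = x.
Proof.
rewrite scalerA -rmorphM /=; have [x0|xn0] := eqVneq (hnorm x) 0.
  by rewrite x0 mul0r scale0r (hnorm_eq0 x0).
by rewrite mulfV// scale1r.
Qed.

Lemma dot_normalized x : dot x (normalized x) = (hnorm x)%:C%C.
Proof.
rewrite dotZr conj_real sqnE -rmorphM /= -hnorm_sqr.
have [->|xn0] := eqVneq (hnorm x) 0; first by rewrite expr0n mulr0.
by rewrite expr2 mulKf.
Qed.

Lemma normalized_suborthonormal (I : finType) (w : I -> U) :
  (forall k l, k != l -> dot (w k) (w l) = 0) ->
  suborthonormal_fam (fun k => normalized (w k)).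
Proof.
move=> ow; split=> [k l kl|k]; first by rewrite dotZl dotZr ow// !mulr0.
have [->|wn0] := eqVneq (w k) 0; first by rewrite /normalized scaler0 sqn0.
by rewrite -hnorm_sqr hnorm_normalized// expr1n.
Qed.

End PreHilbert.

(** * Finite spectral decompositions *)

Section FiniteSpectral.
Context {R : realType} {U : lmodType R[i]} (dot : {dot U for @Num.conj R[i]}).
Implicit Types (x y z : U) (a : R[i]).

Definition fam_spans (I : finType) (u : I -> U) x :=
  x = \sum_k dot x (u k) *: u k.

Lemma fam_spansP (I : finType) (u : I -> U) (c : I -> R[i]) :
  orthonormal_fam dot u -> fam_spans u (\sum_k c k *: u k).
Proof.
by move=> ou; apply: eq_bigr => k _; rewrite dot_fam_sum.
Qed.

Lemma fam_spans_sum (I : finType) (u : I -> U) (J : Type) (r : seq J)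
    (F : J -> U) : (forall j, fam_spans u (F j)) -> fam_spans u (\sum_(j <- r) F j).
Proof.
move=> uF; elim/big_ind: _ => [|x y ux uy|j _]; last exact: uF.
- by rewrite /fam_spans big1// => k _; rewrite dot0l scale0r.
- rewrite /fam_spans {1}ux {1}uy -big_split /=; apply: eq_bigr => k _.
  by rewrite dotDl scalerDl.
Qed.

(** The residual r of the new vector is orthogonal to the family found so far;
    it is normalized and added when it is nonzero. *)
Lemma gram_schmidt (s : seq U) : exists (N : nat) (u : 'I_N -> U),
  orthonormal_fam dot u /\ forall x, x \in s -> fam_spans u x.
Proof.
elim: s => [|x s [N [u [ou us]]]].
  by exists 0, (fun=> 0); split=> [[]|].
pose r := x - \sum_k dot x (u k) *: u k.
have ru k : dot r (u k) = 0 by rewrite dotBl dot_fam_sum// subrr.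
have [r0|r0] := eqVneq r 0.
  exists N, u; split=> // y; rewrite inE => /orP[/eqP ->|/us//].
  by apply/eqP; rewrite -subr_eq0; apply/eqP.
pose v := normalized dot r.
have vv : dot v v = 1 by rewrite sqnE -hnorm_sqr hnorm_normalized// expr1n.
have uv k : dot v (u k) = 0 by rewrite dotZl ru mulr0.
pose w (k : 'I_N.+1) := if unlift ord0 k is Some j then u j else v.
have sumw z : \sum_k dot z (w k) *: w k =
    dot z v *: v + \sum_k dot z (u k) *: u k.
  rewrite big_ord_recl /w unlift_none; congr (_ + _).
  by apply: eq_bigr => k _; rewrite liftK.
exists N.+1, w; split=> [k l|y].
  rewrite /w; case: unliftP => [k'|] ->; case: unliftP => [l'|] ->.
  - by rewrite ou (inj_eq lift_inj).
  - by rewrite dotC uv rmorph0 eq_sym -val_eqE.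
  - by rewrite uv -val_eqE.
  - by rewrite vv eqxx.
rewrite inE /fam_spans sumw => /orP[/eqP ->|ys].
  have -> : dot x v *: v = r.
    rewrite {1}(_ : x = r + \sum_k dot x (u k) *: u k); last by rewrite subrK.
    rewrite dotDl dot_suml big1 ?addr0; last first.
      by move=> k _; rewrite dotZl (dotC dot (u k)) uv rmorph0 mulr0.
    by rewrite dot_normalized normalizedK.
  by rewrite subrK.
have yE := us _ ys; rewrite {1}yE -[LHS]add0r; congr (_ + _).
rewrite yE dot_suml big1 ?scale0r// => k _.
by rewrite dotZl (dotC dot (u k)) uv rmorph0 mulr0.
Qed.

Local Open Scope sesquilinear_scope.

(** Diagonalize the Hermitian matrix of A in an orthonormal basis of the span of
    s. The span need not be stable under A: only the compression of A to it
    becomes diagonal. *)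
Lemma compression_spectral (A : U -> U) (s : seq U) :
  linear A -> (forall x y, dot (A x) y = dot x (A y)) ->
  exists (N : nat) (u : 'I_N -> U) (l : 'I_N -> R),
  [/\ orthonormal_fam dot u, forall x, x \in s -> fam_spans u x
    & forall j k, dot (A (u j)) (u k) = (l j *+ (j == k))%:C%C].
Proof.
move=> lA sA; have [N [b [ob bs]]] := gram_schmidt s.
pose G := \matrix_(i < N, j < N) dot (A (b i)) (b j).
have GH : G \is hermsymmx.
  apply/is_hermitianmxP; rewrite expr0 scale1r; apply/matrixP => i j.
  by rewrite !mxE sA dotC.
have := orthomx_spectralP (hermitian_normalmx GH).
have := spectral_unitarymx G; have := hermitian_spectral_diag_real GH.
set P := spectralmx G; set D := spectral_diag G => Dr Pu GE.
have PPt : P *m P ^t* = 1%:M by apply/unitarymxP.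
have PtP : P ^t* *m P = 1%:M by apply: mulmx1C.
have GD : P *m G *m P ^t* = diag_mx D.
  rewrite GE invmx_unitary// !mulmxA PPt mul1mx -mulmxA PPt mulmx1//.
pose u (k : 'I_N) := \sum_i P k i *: b i.
have uu : orthonormal_fam dot u.
  move=> k l; have /matrixP/(_ k l) := PPt; rewrite !mxE => <-.
  rewrite /u dot_sumr; apply: eq_bigr => i _.
  by rewrite dotZr dot_fam_sum// !mxE mulrC.
have ub i : fam_spans u (b i).
  suff -> : b i = \sum_k (P k i)^* *: u k by exact: fam_spansP.
  under eq_bigr => k _ do rewrite /u scaler_sumr.
  rewrite exchange_big /=.
  have E j : \sum_k (P k i)^* *: (P k j *: b j) = (i == j)%:R *: b j.
    under eq_bigr => k _ do rewrite scalerA.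
    rewrite -scaler_suml; congr (_ *: _).
    have /matrixP/(_ i j) := PtP; rewrite !mxE => <-.
    by apply: eq_bigr => k _; rewrite !mxE.
  under eq_bigr => j _ do rewrite E.
  rewrite (bigD1 i)//= eqxx scale1r big1 ?addr0// => j /negbTE ji.
  by rewrite eq_sym ji scale0r.
exists N, u, (fun k => complex.Re (D ord0 k)); split=> //.
  move=> x /bs ->; apply: fam_spans_sum => k.
  rewrite (ub k) scaler_sumr; under eq_bigr do rewrite scalerA.
  exact: fam_spansP.
move=> j k; have /matrixP/(_ j k) := GD; rewrite !mxE => e.
have -> : (complex.Re (D ord0 j) *+ (j == k))%:C%C = D ord0 j *+ (j == k).
  rewrite rmorphMn /= RRe_real//; exact: (mxOverP Dr).
rewrite -e /u (lin_sum lA) dot_suml.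
under [RHS]eq_bigr => i _ do rewrite !mxE mulr_suml.
rewrite exchange_big /=; apply: eq_bigr => i _.
rewrite (linZ lA) dotZl dot_sumr mulr_sumr; apply: eq_bigr => i' _.
by rewrite dotZr !mxE mulrA mulrAC.
Qed.

(** This is the substitute for the spectral theorem. On the Krylov space spanned
    by the A^i x, with x in s and i <= n, the compression of A agrees with A on
    the vectors A^i x with i < n, so that diagonalizing the compression computes
    q(A) x exactly for all polynomials q of degree at most n. *)
Lemma krylov_spectral (A : U -> U) (s : seq U) (n : nat) :
  linear A -> (forall x y, dot (A x) y = dot x (A y)) ->
  exists (N : nat) (u : 'I_N -> U) (l : 'I_N -> R),
  [/\ orthonormal_fam dot u,
      forall x i, x \in s -> (i <= n)%N ->
        iter i A x = \sum_k ((l k) ^+ i)%:C%C *: (dot x (u k) *: u k)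
    & forall j k, dot (A (u j)) (u k) = (l j *+ (j == k))%:C%C].
Proof.
move=> lA sA.
have [N [u [l [ou us ul]]]] :=
  compression_spectral [seq iter i A x | x <- s, i <- iota 0 n.+1] lA sA.
have us' x i : x \in s -> (i <= n)%N -> fam_spans u (iter i A x).
  move=> xs i_n; apply: us; apply/allpairsP; exists (x, i); split=> //.
  by rewrite (mem_iota 0 n.+1) add0n ltnS.
exists N, u, l; split=> // x i xs; elim: i => [_|i IH i_n].
  rewrite [LHS](us' x 0%N xs (leq0n _)); apply: eq_bigr => k _.
  by rewrite expr0 scale1r.
rewrite {1}(us' x _ xs i_n); apply: eq_bigr => k _.
rewrite scalerA; congr (_ *: _).
rewrite iterS IH ?(ltnW i_n)// (lin_sum lA) dot_suml (bigD1 k)//= big1.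
  by rewrite addr0 !(linZ lA) !dotZl ul eqxx mulr1n exprSr rmorphM /=; ring.
move=> j /negbTE jk; rewrite !(linZ lA) !dotZl ul jk mulr0n.
by rewrite rmorph0 !mulr0.
Qed.

End FiniteSpectral.

(** * Convexity of powers *)

Section PowerInequalities.
Context {R : realType} (p : R) (p1 : 1 <= p).
Let p0 : 0 < p. Proof. exact: lt_le_trans p1. Qed.

Lemma powR_div (x y q : R) : 0 <= x -> 0 < y -> (x / y) `^ q = x `^ q / y `^ q.
Proof.
move=> x0 y0; have -> : x `^ q = (x / y) `^ q * y `^ q.
  by rewrite -powRM ?divr_ge0 ?(ltW y0)// divfK// gt_eqF.
by rewrite mulfK// gt_eqF// powR_gt0.
Qed.

(** The graph of the p-th power lies above its tangent at y. This is the
    inequality x y^(p-1) <= x^p / p + y^p / q of Young, with q conjugate to p. *)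
Lemma powR_tangent (x y : R) : 0 <= x -> 0 <= y ->
  p * y `^ (p - 1) * x - (p - 1) * y `^ p <= x `^ p.
Proof.
move=> x0 y0; have [->|pn1] := eqVneq p 1.
  by rewrite subrr powRr0 mul0r subr0 !mul1r powRr1.
have p1' : 0 < p - 1 by rewrite subr_gt0 lt_neqAle eq_sym pn1.
have pn0 : p != 0 by rewrite gt_eqF.
have pm0 : p - 1 != 0 by rewrite gt_eqF.
have := @conjugate_powR R x (y `^ (p - 1)) p (p / (p - 1)) x0 (powR_ge0 _ _) p0
  (divr_gt0 p0 p1').
rewrite -powRrM (_ : (p - 1) * (p / (p - 1)) = p); last by field.
have -> : p^-1 + (p / (p - 1))^-1 = 1 by field; rewrite pn0 pm0.
move=> /(_ erefl) h.
have -> : p * y `^ (p - 1) * x = p * (x * y `^ (p - 1)) by ring.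
rewrite lerBlDr; apply: (le_trans (ler_wpM2l (ltW p0) h)).
rewrite le_eqVlt; apply/orP; left; apply/eqP; field; exact/andP.
Qed.

(** Sum up the tangent inequalities at the point c. The weights may add up to
    less than 1 because the p-th power vanishes at 0. *)
Lemma jensen_powR (I : finType) (a s : I -> R) (c : R) :
  (forall k, 0 <= a k) -> (forall k, 0 <= s k) -> \sum_k a k <= 1 ->
  0 <= c -> c <= \sum_k a k * s k ->
  c `^ p <= \sum_k a k * s k `^ p.
Proof.
move=> a0 s0 a1 c0 cs.
apply: (@le_trans _ _ (\sum_k a k * (p * c `^ (p - 1) * s k - (p - 1) * c `^ p))).
  have -> : \sum_k a k * (p * c `^ (p - 1) * s k - (p - 1) * c `^ p) =
    p * c `^ (p - 1) * (\sum_k a k * s k) - (p - 1) * c `^ p * \sum_k a k.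
    by rewrite !mulr_sumr -sumrB; apply: eq_bigr => k _; ring.
  have h1 : p * c `^ (p - 1) * c <= p * c `^ (p - 1) * (\sum_k a k * s k).
    by rewrite ler_wpM2l// mulr_ge0 ?powR_ge0// ltW.
  have h2 : (p - 1) * c `^ p * \sum_k a k <= (p - 1) * c `^ p.
    by rewrite ler_piMr// mulr_ge0 ?powR_ge0// subr_ge0.
  have h3 : c * c `^ (p - 1) = c `^ p by rewrite mulr_powRB1.
  have h4 : p * c `^ (p - 1) * c = p * c `^ p by rewrite -h3; ring.
  lra.
by apply: ler_sum => k _; rewrite ler_wpM2l// powR_tangent.
Qed.

(** Jensen's inequality in each row, then the column sums. *)
Lemma substochastic_powR (I J : finType) (a : J -> I -> R) (s : I -> R)
    (c : J -> R) :
  (forall j k, 0 <= a j k) -> (forall k, 0 <= s k) -> (forall j, 0 <= c j) ->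
  (forall j, \sum_k a j k <= 1) -> (forall k, \sum_j a j k <= 1) ->
  (forall j, c j <= \sum_k a j k * s k) ->
  \sum_j c j `^ p <= \sum_k s k `^ p.
Proof.
move=> a0 s0 c0 row col cs.
apply: (@le_trans _ _ (\sum_j \sum_k a j k * s k `^ p)).
  by apply: ler_sum => j _; apply: jensen_powR.
rewrite exchange_big /=; apply: ler_sum => k _.
by rewrite -mulr_suml ler_piMl// powR_ge0.
Qed.

(** Convexity of the p-th power at (a_k + b_k) / (x + y), which is the mean of
    a_k / x and b_k / y with weights x / (x + y) and y / (x + y). *)
Lemma minkowski_powR (I : finType) (a b : I -> R) (x y : R) :
  (forall k, 0 <= a k) -> (forall k, 0 <= b k) -> 0 <= x -> 0 <= y ->
  \sum_k a k `^ p <= x `^ p -> \sum_k b k `^ p <= y `^ p ->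
  \sum_k (a k + b k) `^ p <= (x + y) `^ p.
Proof.
move=> a0 b0 x0 y0 ax by_.
have z (c : I -> R) : (forall k, 0 <= c k) -> \sum_k c k `^ p <= 0 `^ p ->
    forall k, c k = 0.
  move=> c0; rewrite powR0 ?gt_eqF// => h k.
  apply: (@powR_eq0_eq0 _ _ p); apply/eqP; rewrite eq_le powR_ge0 andbT.
  apply: le_trans h; rewrite (bigD1 k)//= lerDl sumr_ge0// => i _.
  exact: powR_ge0.
have [xe|xn] := eqVneq x 0.
  move: ax; rewrite xe add0r => ax; apply: le_trans by_; apply: ler_sum => k _.
  by rewrite (z a)// add0r.
have [ye|yn] := eqVneq y 0.
  move: by_; rewrite ye addr0 => by_; apply: le_trans ax; apply: ler_sum => k _.
  by rewrite (z b)// addr0.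
have xp : 0 < x by rewrite lt_def xn.
have yp : 0 < y by rewrite lt_def yn.
pose l := x / (x + y); have sp : 0 < x + y by rewrite addr_gt0.
have conv k : (a k + b k) `^ p <= (x + y) `^ p *
    (l * (a k `^ p / x `^ p) + (1 - l) * (b k `^ p / y `^ p)).
  pose s (i : bool) := if i then a k / x else b k / y.
  pose w (i : bool) := if i then l else 1 - l.
  have l0 : 0 <= l by rewrite divr_ge0 ?ltW.
  have l1 : 0 <= 1 - l.
    by rewrite subr_ge0 ler_pdivrMr// mul1r lerDl ltW.
  have := @jensen_powR _ w s ((a k + b k) / (x + y)).
  rewrite !big_bool /= => /(_ _ _ _ _ _)/wrap[].
  - by case.
  - by case; rewrite /s divr_ge0// ltW.
  - by rewrite /w addrC subrK.
  - by rewrite divr_ge0 ?addr_ge0// ltW.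
  - rewrite /s /w /l le_eqVlt; apply/orP; left; apply/eqP; field.
    by rewrite ?gt_eqF.
  by rewrite /s !powR_div ?addr_ge0// ler_pdivrMr ?powR_gt0// mulrC.
apply: (le_trans (ler_sum _ (fun k _ => conv k))).
rewrite -mulr_sumr big_split /= -!mulr_sumr -!mulr_suml.
rewrite ler_piMr ?powR_ge0//.
have l0 : 0 <= l by rewrite divr_ge0 ?ltW.
have l1 : 0 <= 1 - l by rewrite subr_ge0 ler_pdivrMr// mul1r lerDl ltW.
rewrite -[leRHS](subrK l) addrC; apply: lerD.
  by rewrite ler_piMr// ler_pdivrMr ?powR_gt0// mul1r.
by rewrite ler_piMr// ler_pdivrMr ?powR_gt0// mul1r.
Qed.

End PowerInequalities.

(** * Test norms *)

(** Test data for the Schatten norm. For an orthonormal sequence e_j the family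
    with one index i satisfies both conditions; the second index is there so
    that e_j may be replaced by the family of all G_m e_j, for selfadjoint G_m
    whose squares add up to at most 1, as the arithmetic-geometric mean
    inequality requires. *)
Definition bessel_data {R : realType} {V : lmodType R[i]}
    (dV : {dot V for @Num.conj R[i]}) (n : nat) (I : finType)
    (e : 'I_n -> I -> V) : Prop :=
  (forall x, \sum_j \sum_i (cmod (dV x (e j i))) ^+ 2 <= sqn dV x) /\
  (forall j, \sum_i sqn dV (e j i) <= 1).

Section TestNorm.
Context {R : realType} {U W : lmodType R[i]}
  (dU : {dot U for @Num.conj R[i]}) (dW : {dot W for @Num.conj R[i]})
  (p : R) (p1 : 1 <= p).
Let p0 : 0 < p. Proof. exact: lt_le_trans p1. Qed.
Implicit Types (X Y : U -> W).

Definition test_sum X (n : nat) (I : finType) (e : 'I_n -> I -> U)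
    (f : 'I_n -> I -> W) : R :=
  \sum_j (cmod (\sum_i dW (X (e j i)) (f j i))) `^ p.

Definition test_values n X : set R :=
  [set r | exists (I : finType) (e : 'I_n -> I -> U) (f : 'I_n -> I -> W),
    [/\ bessel_data dU e, bessel_data dW f & r = (test_sum X e f) `^ p^-1]].

(** The supremum of these norms over n is the Schatten p-norm of X, finite or
    not. For fixed n the value is finite on all bounded operators, which makes
    it possible to compare operators before their Schatten norms are known to be
    finite. *)
Definition test_norm n X : R := sup (test_values n X).

Definition bounded_by (M : R) X := forall x, hnorm dW (X x) <= M * hnorm dU x.

Lemma test_sum_ge0 X n I e f : 0 <= @test_sum X n I e f.
Proof. by apply: sumr_ge0 => j _; exact: powR_ge0. Qed.

Lemma test_values_neq0 n X : (test_values n X !=set0)%classic.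
Proof.
exists ((test_sum X (fun (_ : 'I_n) (_ : 'I_0) => 0) (fun _ _ => 0)) `^ p^-1).
exists 'I_0, (fun=> fun=> 0), (fun=> fun=> 0); split=> //.
- by split=> [x|j]; rewrite ?big_ord0// big1 ?sqn_ge0// => j _; rewrite big_ord0.
- by split=> [x|j]; rewrite ?big_ord0// big1 ?sqn_ge0// => j _; rewrite big_ord0.
Qed.

(** Each of the n terms is at most M^p, because |<Xe, f>| is at most
    M (|e|^2 + |f|^2) / 2 and the squared norms add up to at most 1. *)
Lemma test_sum_bound X M n I e f : 0 <= M -> bounded_by M X ->
  bessel_data dU e -> bessel_data dW f -> @test_sum X n I e f <= n%:R * M `^ p.
Proof.
move=> M0 XM [_ e1] [_ f1].
have -> : n%:R * M `^ p = \sum_(j < n) M `^ p by rewrite sumr_const card_ord mulr_natl.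
apply: ler_sum => j _; apply: ge0_ler_powR; rewrite ?nnegrE ?cmod_ge0 ?(ltW p0)//.
apply: (le_trans (cmod_sum _)).
apply: (@le_trans _ _ (\sum_i M / 2 * (sqn dU (e j i) + sqn dW (f j i)))).
  apply: ler_sum => i _; apply: (le_trans (cauchy_schwarz_hnorm _ _ _)).
  apply: (le_trans (ler_wpM2r (hnorm_ge0 _ _) (XM _))).
  rewrite -!hnorm_sqr -!mulrA ler_wpM2l//.
  have := sqr_ge0 (hnorm dU (e j i) - hnorm dW (f j i)); lra.
rewrite -mulr_sumr big_split /=; have := e1 j; have := f1 j => h1 h2.
have : M / 2 * (\sum_i sqn dU (e j i) + \sum_i sqn dW (f j i)) <= M / 2 * 2.
  by rewrite ler_wpM2l ?divr_ge0//; lra.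
lra.
Qed.

Lemma test_values_ub X M n : 0 <= M -> bounded_by M X ->
  has_ubound (test_values n X).
Proof.
move=> M0 XM; exists ((n%:R * M `^ p) `^ p^-1) => _ [I [e [f [he hf ->]]]].
apply: ge0_ler_powR; rewrite ?nnegrE ?invr_ge0 ?(ltW p0) ?test_sum_ge0//.
  by rewrite mulr_ge0// powR_ge0.
exact: test_sum_bound.
Qed.

Lemma powR_inv_le (a c : R) : 0 <= a -> 0 <= c -> (a `^ p^-1 <= c) = (a <= c `^ p).
Proof.
move=> a0 c0; apply/idP/idP => h.
  rewrite -[a]powRr1// -(mulVf (lt0r_neq0 p0)) powRrM.
  by apply: ge0_ler_powR; rewrite ?nnegrE ?powR_ge0 ?(ltW p0).
rewrite -[c]powRr1// -(mulfV (lt0r_neq0 p0)) powRrM.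
by apply: ge0_ler_powR; rewrite ?nnegrE ?powR_ge0 ?invr_ge0 ?(ltW p0).
Qed.

Lemma test_norm_ub X M n I e f : 0 <= M -> bounded_by M X ->
  bessel_data dU e -> bessel_data dW f ->
  @test_sum X n I e f <= (test_norm n X) `^ p.
Proof.
move=> M0 XM he hf.
have h : (test_sum X e f) `^ p^-1 <= test_norm n X.
  apply: ub_le_sup; first exact: test_values_ub M0 XM.
  by exists I, e, f.
rewrite -powR_inv_le ?test_sum_ge0//; exact: le_trans (powR_ge0 _ _) h.
Qed.

Lemma test_norm_le X n c : 0 <= c ->
  (forall I e f, bessel_data dU e -> bessel_data dW f ->
    @test_sum X n I e f <= c `^ p) -> test_norm n X <= c.
Proof.
move=> c0 h; apply: ge_sup; first exact: test_values_neq0.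
by move=> _ [I [e [f [he hf ->]]]]; rewrite powR_inv_le ?test_sum_ge0// h.
Qed.

Lemma test_norm_ge0 X M n : 0 <= M -> bounded_by M X -> 0 <= test_norm n X.
Proof.
move=> M0 XM; have [r rX] := test_values_neq0 n X.
apply: (@le_trans _ _ r); first by case: rX => [I [e [f [_ _ ->]]]]; exact: powR_ge0.
by apply: ub_le_sup => //; exact: test_values_ub M0 XM.
Qed.

Lemma test_norm_half X Y Z M n : 0 <= M -> bounded_by M X -> bounded_by M Y ->
  (forall x, Z x = (2^-1 : R[i]) *: (X x + Y x)) ->
  test_norm n Z <= (test_norm n X + test_norm n Y) / 2.
Proof.
move=> M0 XM YM ZE.
have X0 := test_norm_ge0 n M0 XM; have Y0 := test_norm_ge0 n M0 YM.
have hX I e f he hf := @test_norm_ub X M n I e f M0 XM he hf.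
have hY I e f he hf := @test_norm_ub Y M n I e f M0 YM he hf.
move: (test_norm n X) (test_norm n Y) X0 Y0 hX hY => NX NY X0 Y0 hX hY.
have c0 : 0 <= (NX + NY) / 2 by rewrite divr_ge0 ?addr_ge0.
apply: (test_norm_le c0) => I e f he hf.
have E j : cmod (\sum_i dW (Z (e j i)) (f j i)) <=
  2^-1 * (cmod (\sum_i dW (X (e j i)) (f j i)) + cmod (\sum_i dW (Y (e j i)) (f j i))).
  under eq_bigr => i _ do rewrite ZE dotZl dotDl.
  rewrite -mulr_sumr big_split /= cmodM.
  by rewrite cmod_half ler_wpM2l ?invr_ge0// cmodD.
apply: (@le_trans _ _ (\sum_j (2^-1 * (cmod (\sum_i dW (X (e j i)) (f j i)) +
    cmod (\sum_i dW (Y (e j i)) (f j i)))) `^ p)).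
  by apply: ler_sum => j _; apply: ge0_ler_powR; rewrite ?nnegrE ?cmod_ge0
    ?mulr_ge0 ?addr_ge0 ?invr_ge0 ?cmod_ge0 ?(ltW p0).
under eq_bigr => j _ do rewrite powRM ?invr_ge0 ?addr_ge0 ?cmod_ge0//.
rewrite -mulr_sumr mulrC powRM ?addr_ge0 ?invr_ge0// mulrC.
rewrite [leRHS]mulrC ler_wpM2l ?powR_ge0//.
apply: (minkowski_powR p1) => //; try by move=> j; exact: cmod_ge0.
- exact: hX.
- exact: hY.
Qed.

(** The coefficients b_jk = sum_i |<e_ji, u_k>| |<v_k, f_ji>| form a doubly
    substochastic matrix: |ab| <= (|a|^2 + |b|^2) / 2 reduces both row and
    column sums to Bessel inequalities, for u and v in the rows and for the test
    data in the columns. *)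
Lemma test_sum_schmidt (K : finType) (u : K -> U) (v : K -> W) (s : K -> R)
    X n (I : finType) (e : 'I_n -> I -> U) (f : 'I_n -> I -> W) :
  suborthonormal_fam dU u -> suborthonormal_fam dW v -> (forall k, 0 <= s k) ->
  bessel_data dU e -> bessel_data dW f ->
  (forall j i, dW (X (e j i)) (f j i) =
     \sum_k (s k)%:C%C * (dU (e j i) (u k) * dW (v k) (f j i))) ->
  test_sum X e f <= \sum_k s k `^ p.
Proof.
move=> ou ov s0 [eB e1] [fB f1] XE.
pose b j i k := cmod (dU (e j i) (u k)) * cmod (dW (v k) (f j i)).
have bh j i k : b j i k <=
    2^-1 * (cmod (dU (e j i) (u k)) ^+ 2 + cmod (dW (f j i) (v k)) ^+ 2).
  rewrite /b (cmod_dotC dW (v k)).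
  have := sqr_ge0 (cmod (dU (e j i) (u k)) - cmod (dW (f j i) (v k))); lra.
have b0 j i k : 0 <= b j i k by rewrite mulr_ge0 ?cmod_ge0.
apply: (@substochastic_powR _ _ p1 _ _ (fun j k => \sum_i b j i k)) => //.
- by move=> j k; rewrite sumr_ge0.
- by move=> j; exact: cmod_ge0.
- move=> j; rewrite exchange_big /=.
  apply: (@le_trans _ _ (\sum_i 2^-1 * (sqn dU (e j i) + sqn dW (f j i)))).
    apply: ler_sum => i _; apply: (le_trans (ler_sum _ (fun k _ => bh j i k))).
    rewrite -mulr_sumr ler_wpM2l ?invr_ge0// big_split /=.
    by apply: lerD; exact: bessel.
  rewrite -mulr_sumr big_split /=; have := e1 j; have := f1 j; lra.
- move=> k.
  apply: (@le_trans _ _ (2^-1 * (sqn dU (u k) + sqn dW (v k)))); last first.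
    have := ou.2 k; have := ov.2 k; lra.
  apply: (@le_trans _ _ (2^-1 * (\sum_j \sum_i cmod (dU (u k) (e j i)) ^+ 2 +
      \sum_j \sum_i cmod (dW (v k) (f j i)) ^+ 2))).
    rewrite -big_split /= mulr_sumr; apply: ler_sum => j _.
    rewrite -big_split /= mulr_sumr; apply: ler_sum => i _.
    by rewrite cmod_dotC (cmod_dotC dW) bh.
  by rewrite ler_wpM2l ?invr_ge0// lerD ?eB ?fB.
- move=> j; under eq_bigr => i _ do rewrite XE.
  apply: (le_trans (cmod_sum _)); under [leRHS]eq_bigr => k _ do rewrite mulr_suml.
  rewrite exchange_big /=; apply: ler_sum => i _.
  apply: (le_trans (cmod_sum _)); apply: ler_sum => k _.
  by rewrite !cmodM cmod_real ger0_norm// mulrC.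
Qed.

(** The Krylov decomposition of B = X^* X on the test vectors makes the images
    X u_k orthogonal to each other; then X acts on the test vectors as the sum
    of the |X u_k| <., u_k> v_k, where v_k is the normalized X u_k. *)
Lemma test_sum_svd X (B : U -> U) n (I : finType) (e : 'I_n -> I -> U) (f : 'I_n -> I -> W) :
  linear X -> linear B -> (forall x y, dU (B x) y = dW (X x) (X y)) ->
  bessel_data dU e -> bessel_data dW f ->
  exists (N : nat) (u : 'I_N -> U), [/\ orthonormal_fam dU u,
    forall k l, k != l -> dW (X (u k)) (X (u l)) = 0
  & test_sum X e f <= \sum_k (hnorm dW (X (u k))) `^ p].
Proof.
move=> lX lB BX he hf.
have sB x y : dU (B x) y = dU x (B y) by rewrite BX dotC -BX -dotC.
have [N [u [l [ou us ul]]]] := krylov_spectral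
  [seq e ij.1 ij.2 | ij <- enum {: 'I_n * I}] 0 lB sB.
have oX k k' : k != k' -> dW (X (u k)) (X (u k')) = 0.
  by move=> /negbTE kk; rewrite -BX ul kk mulr0n.
exists N, u; split=> //.
apply: (@test_sum_schmidt _ u (fun k => normalized dW (X (u k)))
  (fun k => hnorm dW (X (u k)))) => //.
- exact: orthonormal_famW.
- exact: normalized_suborthonormal.
- by move=> k; exact: hnorm_ge0.
- move=> j i; have eE := us (e j i) 0%N _ (leqnn _).
  rewrite {1}[e j i]eE; last by apply/mapP; exists (j, i) => //; rewrite mem_enum.
  rewrite (lin_sum lX) dot_suml; apply: eq_bigr => k _.
  by rewrite expr0 scale1r (linZ lX) -{1}[X (u k)](normalizedK dW) !dotZl; ring.
Qed.

End TestNorm.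

(** * The arithmetic-geometric mean inequality *)

Definition selfadjoint {R : realType} {V : lmodType R[i]}
    (dV : {dot V for @Num.conj R[i]}) (A : V -> V) : Prop :=
  forall x y, dV (A x) y = dV x (A y).

(** S is the inverse of 1 + Q^2, which commutes with Q. *)
Definition resolvent_pair {R : realType} {V : lmodType R[i]}
    (dV : {dot V for @Num.conj R[i]}) (c : R) (Q S : V -> V) : Prop :=
  [/\ linear Q, linear S, selfadjoint dV Q, selfadjoint dV S &
   [/\ bounded_by dV dV c Q, forall x, Q (S x) = S (Q x) &
       forall x, S x + Q (Q (S x)) = x]].

Section Cayley.
Context {R : realType} {V : lmodType R[i]} (dV : {dot V for @Num.conj R[i]}).
Context (c : R) (c0 : 0 <= c) (Q S : V -> V) (QS : resolvent_pair dV c Q S).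

(** With C = (1 - Q^2) (1 + Q^2)^-1 the identity
    (2 Q (1 + Q^2)^-1)^2 + C^2 = 1 holds, so that the weights
    G_m = 2 Q (1 + Q^2)^-1 C^m satisfy G_0^2 + ... + G_(M-1)^2 = 1 - C^(2M). *)
Definition cayley x := S x - Q (Q (S x)).
Definition cayley_weight m x := (2 : R[i]) *: Q (S (iter m cayley x)).

Let lQ : linear Q. Proof. by case: QS. Qed.
Let lS : linear S. Proof. by case: QS. Qed.
Let sQ : selfadjoint dV Q. Proof. by case: QS. Qed.
Let sS : selfadjoint dV S. Proof. by case: QS. Qed.
Let bQ : bounded_by dV dV c Q. Proof. by case: QS => _ _ _ _ []. Qed.
Let cQS x : Q (S x) = S (Q x). Proof. by case: QS => _ _ _ _ [] _ ->. Qed.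
Let SE x : S x + Q (Q (S x)) = x. Proof. by case: QS => _ _ _ _ []. Qed.

Lemma cayley_selfadjoint : selfadjoint dV cayley.
Proof. by move=> x y; rewrite /cayley dotBl dotBr sQ sQ sS sS !cQS. Qed.

Lemma cayley_comm x : Q (S (cayley x)) = cayley (Q (S x)).
Proof. by rewrite /cayley (linB lS) (linB lQ) !cQS. Qed.

Lemma iter_cayley_comm m x : Q (S (iter m cayley x)) = iter m cayley (Q (S x)).
Proof. by elim: m => //= m IH; rewrite cayley_comm IH. Qed.

Lemma iter_cayley_selfadjoint m : selfadjoint dV (iter m cayley).
Proof.
elim: m => // m IH x y; rewrite iterS cayley_selfadjoint IH.
by rewrite -iterSr.
Qed.

Lemma cayley_weight_selfadjoint m : selfadjoint dV (cayley_weight m).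
Proof.
move=> x y; rewrite /cayley_weight dotZl dotZr sQ sS -cQS iter_cayley_selfadjoint.
by rewrite -iter_cayley_comm rmorph_nat.
Qed.

Lemma sqn_cayley_step x :
  sqn dV ((2 : R[i]) *: Q (S x)) = sqn dV x - sqn dV (cayley x).
Proof.
rewrite -{2}(SE x) /cayley sqnD sqnB sqnZ cmod_nat.
rewrite -sQ /sqn; ring.
Qed.

Lemma sum_sqn_cayley_weight M x :
  \sum_(m < M) sqn dV (cayley_weight m x) = sqn dV x - sqn dV (iter M cayley x).
Proof.
elim: M => [|M IH]; first by rewrite big_ord0 subrr.
rewrite big_ord_recr /= IH /cayley_weight sqn_cayley_step; ring.
Qed.

Lemma sum_sqn_cayley_weight_le M x :
  \sum_(m < M) sqn dV (cayley_weight m x) <= sqn dV x.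
Proof. by rewrite sum_sqn_cayley_weight gerBl sqn_ge0. Qed.

Lemma sqn_iter_cayley M x : sqn dV (iter M cayley x) <= sqn dV x.
Proof.
rewrite -subr_ge0 -sum_sqn_cayley_weight sumr_ge0// => m _; exact: sqn_ge0.
Qed.

(** The weights are selfadjoint and their squares add up to at most 1, hence
    spreading a family over them preserves both conditions on test data. *)
Lemma cayley_weight_bessel n (I : finType) (e : 'I_n -> I -> V) M :
  bessel_data dV e ->
  bessel_data dV (fun j (im : I * 'I_M) => cayley_weight im.2 (e j im.1)).
Proof.
move=> [eB e1]; split=> [x|j].
  apply: le_trans (sum_sqn_cayley_weight_le M x).
  apply: (@le_trans _ _ (\sum_(m < M) \sum_j \sum_i
      cmod (dV (cayley_weight m x) (e j i)) ^+ 2)); last exact: ler_sum.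
  rewrite [leRHS]exchange_big /=; apply: ler_sum => j _.
  rewrite [leRHS]exchange_big /= pair_big /=.
  by apply: ler_sum => -[i m] _ /=; rewrite -cayley_weight_selfadjoint.
apply: le_trans (e1 j).
rewrite -(pair_big xpredT xpredT (fun i (m : 'I_M) => sqn dV (cayley_weight m (e j i)))) /=.
by apply: ler_sum => i _; exact: sum_sqn_cayley_weight_le.
Qed.

(** The squared norms |C^M x|^2 decrease in M with decrements
    |2 Q (1 + Q^2)^-1 C^M x|^2, so some decrement is small; the factor 1 + Q^2
    is then removed at the cost of its norm. Summing the |C^M x_k|^2 over k
    yields one M for all k. *)
Lemma sqn_cayley_tail (K : finType) (x : K -> V) (eps : R) : 0 < eps ->
  exists M, forall k, hnorm dV (Q (iter M cayley (x k))) <= eps.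
Proof.
move=> e0; pose s M := \sum_k sqn dV (iter M cayley (x k)).
pose b := eps ^+ 2 / (1 + c ^+ 2) ^+ 2.
have d0 : 0 < 1 + c ^+ 2 by have := sqr_ge0 c; lra.
have b0 : 0 < b by rewrite divr_gt0 ?exprn_gt0.
have [M hM] : exists M, s M - s M.+1 <= 4 * b.
  apply: contrapT => /forallNP h.
  have {}h M : 4 * b < s M - s M.+1 by rewrite ltNge; apply/negP.
  have sM M : s M <= s 0%N - M%:R * (4 * b).
    elim: M => [|M IH]; first by rewrite mul0r subr0.
    have := h M; rewrite -natr1; lra.
  have [M HM] : exists M : nat, s 0%N < M%:R * (4 * b).
    exists (Num.bound (s 0%N / (4 * b))).
    have b40 : 0 < 4 * b by rewrite mulr_gt0.
    rewrite -(ltr_pdivrMr _ _ b40). rewrite archi_boundP// divr_ge0//; last first.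
      by rewrite mulr_ge0// ltW.
    by apply: sumr_ge0 => k _; exact: sqn_ge0.
  have : 0 <= s M by apply: sumr_ge0 => k _; exact: sqn_ge0.
  have := sM M; lra.
exists M => k.
have hk : sqn dV (Q (S (iter M cayley (x k)))) <= b.
  have : sqn dV (iter M cayley (x k)) - sqn dV (iter M.+1 cayley (x k)) <= 4 * b.
    apply: le_trans hM; rewrite /s -sumrB (bigD1 k)//= lerDl sumr_ge0// => i _.
    by rewrite -sqn_cayley_step sqn_ge0.
  rewrite -sqn_cayley_step sqnZ cmod_nat; lra.
set y := iter M cayley (x k) in hk *.
rewrite -{1}(SE y) (linD lQ); apply: (le_trans (hnormD _ _ _)).
set z := Q (S y) in hk *.
have hz : hnorm dV (Q (Q z)) <= c ^+ 2 * hnorm dV z.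
  apply: (le_trans (bQ _)); rewrite expr2 -mulrA ler_wpM2l//; exact: bQ.
apply: (@le_trans _ _ ((1 + c ^+ 2) * hnorm dV z)); first lra.
rewrite mulrC -ler_pdivlMr//.
rewrite -(@ler_pXn2r _ 2)// ?nnegrE ?hnorm_ge0 ?divr_ge0 ?(ltW e0) ?(ltW d0)// hnorm_sqr.
by rewrite expr_div_n.
Qed.

End Cayley.

Section ArithmeticGeometricMean.
Context {R : realType} {U W : lmodType R[i]}
  (dU : {dot U for @Num.conj R[i]}) (dW : {dot W for @Num.conj R[i]})
  (p : R) (p1 : 1 <= p).
Let p0 : 0 < p. Proof. exact: lt_le_trans p1. Qed.
Context (c : R) (c0 : 0 <= c) (Q S : U -> U) (Q' S' : W -> W).
Context (QS : resolvent_pair dU c Q S) (QS' : resolvent_pair dW c Q' S').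
Context (M : R) (M0 : 0 <= M) (X : U -> W) (lX : linear X)
  (bX : bounded_by dU dW M X).

(* Y is the arithmetic mean and Z the geometric one; Q acts on the right of X
   and Q' on the left. *)
Let Y (x : U) : W := (2^-1 : R[i]) *: (Q' (Q' (X x)) + X (Q (Q x))).
Let Z (x : U) : W := Q' (X (Q x)).
Let T := cayley Q S.
Let T' := cayley Q' S'.

(** Put a = (1 + Q^2)^-1 x and b = (1 + Q'^2)^-1 y, so that x = (1 + Q^2) a,
    C x = (1 - Q^2) a, and likewise for y and b. The difference keeps the terms
    of <Q'XQ x, y> that contain exactly one of Q^2 a and Q'^2 b, twice. *)
Lemma cayley_step x y :
  dW (Z x) y - dW (Z (T x)) (T' y) =
  dW (Y ((2 : R[i]) *: Q (S x))) ((2 : R[i]) *: Q' (S' y)).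
Proof.
have [lQ lS sQ sS [_ _ SE]] := QS; have [lQ' lS' sQ' sS' [_ _ SE']] := QS'.
rewrite /Z /Y /T /T' /cayley -{1}(SE x) -{1}(SE' y).
set a := S x; set b := S' y.
rewrite !(linZ lQ, linZ lX, linZ lQ') -scalerDr !(dotZl, dotZr) !dotDl rmorph_nat.
rewrite !(linD lQ, linN lQ, linD lX, linN lX, linD lQ', linN lQ').
rewrite !(dotDl, dotNl) !(dotDr, dotNr) !sQ'.
by field.
Qed.

Lemma cayley_telescope N x y :
  dW (Z x) y =
  \sum_(m < N) dW (Y (cayley_weight Q S m x)) (cayley_weight Q' S' m y) +
  dW (Z (iter N T x)) (iter N T' y).
Proof.
elim: N => [|N IH]; first by rewrite big_ord0 add0r.
by rewrite big_ord_recr /= {1}IH -addrA -cayley_step subrK.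
Qed.

Lemma bounded_agm_mean : bounded_by dU dW (c ^+ 2 * M) Y.
Proof.
have [_ _ _ _ [bQ _ _]] := QS; have [_ _ _ _ [bQ' _ _]] := QS'.
move=> x; rewrite /Y hnormZ cmod_half.
have h1 : hnorm dW (Q' (Q' (X x))) <= c ^+ 2 * M * hnorm dU x.
  apply: (le_trans (bQ' _)); rewrite expr2 -!mulrA ler_wpM2l//.
  by apply: (le_trans (bQ' _)); rewrite ler_wpM2l.
have h2 : hnorm dW (X (Q (Q x))) <= c ^+ 2 * M * hnorm dU x.
  apply: (le_trans (bX _)); rewrite (mulrC (c ^+ 2)) -(mulrA M) ler_wpM2l//.
  by apply: (le_trans (bQ _)); rewrite expr2 -mulrA ler_wpM2l.
have := hnormD dW (Q' (Q' (X x))) (X (Q (Q x))); lra.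
Qed.

(** By the telescoped identity, the sums defining the test norm of Q'XQ are, up
    to a small tail, sums for the arithmetic mean with the test data G_m e_ji
    and G'_m f_ji. *)
Lemma test_norm_agm n : test_norm dU dW p n Z <= test_norm dU dW p n Y.
Proof.
have [_ _ _ _ [bQ _ _]] := QS; have [_ _ sQ' _ [bQ' _ _]] := QS'.
have cM0 : 0 <= c ^+ 2 * M by rewrite mulr_ge0 ?sqr_ge0.
have NY0 := test_norm_ge0 p1 n cM0 bounded_agm_mean.
have hNY I e f he hf := @test_norm_ub _ _ _ dU dW p p1 Y _ n I e f cM0
  bounded_agm_mean he hf.
move: (test_norm _ _ _ _ Y) NY0 hNY => NY NY0 hNY.
apply/ler_addgt0Pr => eps e0.
apply: test_norm_le => // [|I e f he hf]; first by rewrite addr_ge0// ltW.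
pose K := (\sum_j \sum_i hnorm dW (f j i)) : R.
have K0 : 0 <= K by apply: sumr_ge0 => j _; apply: sumr_ge0 => i _; exact: hnorm_ge0.
(* D makes the l^p norm of the tails, n^(1/p) M c K eps / D, less than eps. *)
pose D := 1 + M * c * K * (n%:R `^ p^-1).
have D0 : 0 < D by rewrite ltr_pwDl// !mulr_ge0// powR_ge0.
have [N hN] := sqn_cayley_tail c0 QS (fun ji : 'I_n * I => e ji.1 ji.2)
  (divr_gt0 e0 D0).
pose a j := cmod (\sum_(im : I * 'I_N) dW (Y (cayley_weight Q S im.2 (e j im.1)))
  (cayley_weight Q' S' im.2 (f j im.1))).
pose b (j : 'I_n) := M * c * K * (eps / D).
have ab j : cmod (\sum_i dW (Z (e j i)) (f j i)) <= a j + b j.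
  under eq_bigr => i _ do rewrite (cayley_telescope N).
  rewrite big_split /=; apply: (le_trans (cmodD _ _)); apply: lerD.
    rewrite /a -(pair_big xpredT xpredT (fun i (m : 'I_N) =>
      dW (Y (cayley_weight Q S m (e j i))) (cayley_weight Q' S' m (f j i)))) /=.
    exact: lexx.
  apply: (le_trans (cmod_sum _)).
  apply: (@le_trans _ _ (\sum_i M * c * (eps / D) * hnorm dW (f j i))).
    apply: ler_sum => i _; apply: (le_trans (cauchy_schwarz_hnorm _ _ _)).
    apply: ler_pM; rewrite ?hnorm_ge0//.
      apply: (le_trans (bQ' _)); rewrite (mulrC M) -!mulrA ler_wpM2l//.
      by apply: (le_trans (bX _)); rewrite ler_wpM2l//; exact: (hN (j, i)).
    by rewrite -sqn_le_hnorm; exact: (sqn_iter_cayley QS').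
  rewrite -mulr_sumr /b (mulrAC _ K) ler_wpM2l//.
    by rewrite !mulr_ge0// ?invr_ge0 ltW.
  rewrite /K (bigD1 j)//= lerDl sumr_ge0// => j' _.
  by apply: sumr_ge0 => i _; exact: hnorm_ge0.
have a0 j : 0 <= a j by exact: cmod_ge0.
have b0 j : 0 <= b j by rewrite /b !mulr_ge0// ?(ltW e0) ?invr_ge0 ?(ltW D0)//.
apply: (@le_trans _ _ (\sum_j (a j + b j) `^ p)).
  apply: ler_sum => j _; apply: ge0_ler_powR; rewrite ?nnegrE ?cmod_ge0 ?(ltW p0)//.
  by rewrite addr_ge0.
apply: (minkowski_powR p1) => //; first exact: ltW.
  exact: (hNY _ _ _ (cayley_weight_bessel QS N he) (cayley_weight_bessel QS' N hf)).
rewrite /b; set g := M * c * K * (eps / D).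
have g0 : 0 <= g by rewrite /g !mulr_ge0// ?(ltW e0)// invr_ge0 ltW.
rewrite sumr_const card_ord -mulr_natr.
have -> : n%:R = ((n%:R : R) `^ p^-1) `^ p :> R.
  by rewrite -powRrM mulVf ?gt_eqF// powRr1.
rewrite -powRM ?powR_ge0//.
apply: ge0_ler_powR; rewrite ?nnegrE ?(ltW p0) ?(ltW e0)//.
  by rewrite mulr_ge0 ?powR_ge0.
rewrite /g (_ : M * c * K * (eps / D) * n%:R `^ p^-1 = eps * ((D - 1) / D)).
  by rewrite ler_piMr ?(ltW e0)// ler_pdivrMr// mul1r gerBl.
rewrite /D; field; exact: lt0r_neq0.
Qed.

End ArithmeticGeometricMean.

(** * Polynomial approximation of powers *)

Section Bernstein.
Context {R : realType}.
Implicit Types (phi psi : nat -> R) (x : R).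

(** The Bernstein polynomial of phi composed with l, by recursion on the first of
    n Bernoulli trials of parameter l; phi k is the value after k successes. *)
Fixpoint bernstein (l : {poly R}) n phi : {poly R} :=
  if n is n'.+1 then
    l * bernstein l n' (fun k => phi k.+1) + (1 - l) * bernstein l n' phi
  else (phi 0%N)%:P.

(** The expectation of phi for the binomial law with parameters n and x. *)
Fixpoint binomial_mean x n phi : R :=
  if n is n'.+1 then
    x * binomial_mean x n' (fun k => phi k.+1) + (1 - x) * binomial_mean x n' phi
  else phi 0%N.

Lemma horner_bernstein l n phi s :
  (bernstein l n phi).[s] = binomial_mean l.[s] n phi.
Proof.
elim: n phi => [|n IH] phi /=; first by rewrite hornerC.
by rewrite hornerD !hornerM !IH hornerD hornerN hornerC.
Qed.

Lemma ler_binomial_mean x n phi psi : 0 <= x <= 1 ->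
  (forall k, (k <= n)%N -> phi k <= psi k) ->
  binomial_mean x n phi <= binomial_mean x n psi.
Proof.
move=> /andP[x0 x1]; elim: n phi psi => [|n IH] phi psi h /=; first exact: h.
apply: lerD; rewrite ler_wpM2l ?subr_ge0//; apply: IH => k kn; apply: h => //.
exact: leqW.
Qed.

Lemma binomial_meanD x n phi psi :
  binomial_mean x n (fun k => phi k + psi k) =
  binomial_mean x n phi + binomial_mean x n psi.
Proof. elim: n phi psi => //= n IH phi psi; rewrite !IH; ring. Qed.

Lemma binomial_meanZ x n c phi :
  binomial_mean x n (fun k => c * phi k) = c * binomial_mean x n phi.
Proof. elim: n phi => //= n IH phi; rewrite !IH; ring. Qed.

Lemma binomial_mean_cst x n c : binomial_mean x n (fun=> c) = c.
Proof. elim: n => //= n ->; ring. Qed.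

Lemma binomial_mean1 x n : binomial_mean x n (fun k => k%:R) = n%:R * x.
Proof.
elim: n => [|n IH] /=; first by rewrite mul0r.
under [X in binomial_mean _ _ X]eq_fun do rewrite -natr1.
rewrite binomial_meanD binomial_mean_cst IH -natr1; ring.
Qed.

Lemma binomial_mean2 x n :
  binomial_mean x n (fun k => k%:R ^+ 2) = (n%:R * x) ^+ 2 + n%:R * x * (1 - x).
Proof.
elim: n => [|n IH] /=; first by rewrite !mul0r expr0n addr0.
rewrite (_ : (fun k => k.+1%:R ^+ 2) =
  (fun k => (k%:R ^+ 2 + (2 * k%:R + 1)) : R)); last first.
  by apply/funext => k; rewrite -natr1; ring.
rewrite !binomial_meanD binomial_meanZ binomial_mean_cst binomial_mean1 IH -natr1.
ring.
Qed.

Lemma binomial_mean_sub x n c phi :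
  binomial_mean x n (fun k => phi k - c) = binomial_mean x n phi - c.
Proof. by rewrite binomial_meanD binomial_mean_cst. Qed.

(** Chebyshev's argument: if k/n is within d / M of x = s / M then f(Mk/n) and
    f(s) differ by at most e/2, and otherwise by at most 2C, which is at most
    2C (M/d)^2 (k/n - x)^2; the variance of k/n is at most 1/n. *)
Lemma bernstein_approx (f : R -> R) (M : R) : 0 < M ->
  (forall e, 0 < e -> exists2 d, 0 < d & forall x y, 0 <= x <= M -> 0 <= y <= M ->
     `|x - y| < d -> `|f x - f y| <= e) ->
  (exists C, forall x, 0 <= x <= M -> `|f x| <= C) ->
  forall e, 0 < e -> exists q : {poly R}, forall s, 0 <= s <= M ->
    `|q.[s] - f s| <= e.
Proof.
move=> M0 uf [C fC] e e0.
have C0 : 0 <= C by apply: le_trans (fC 0 _); rewrite ?normr_ge0 ?lexx ?(ltW M0).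
have [d d0 fd] := uf _ (divr_gt0 e0 (ltr0Sn R 1)).
pose K := 2 * C * (M / d) ^+ 2.
have K0 : 0 <= K by rewrite !mulr_ge0 ?exprn_ge0// ?invr_ge0 ltW.
pose n := (Num.bound (K / (e / 2))).+1.
have n0 : (0 : R) < n%:R by rewrite ltr0n.
have nK : K / n%:R <= e / 2.
  rewrite ler_pdivrMr// mulrC -ler_pdivrMr ?divr_gt0//.
  have h : 0 <= K / (e / 2) by rewrite !divr_ge0// ltW.
  by rewrite (le_trans (ltW (archi_boundP h)))// ler_nat leqnSn.
exists (bernstein (M^-1 *: 'X) n (fun k => f (M * k%:R / n%:R))) => s sM.
rewrite horner_bernstein hornerZ hornerX.
pose x := M^-1 * s; rewrite -/x.
have sE : s = M * x by rewrite /x mulrA divff ?mul1r// gt_eqF.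
have x01 : 0 <= x <= 1.
  move/andP: sM => [s0 s1]; rewrite mulr_ge0 ?invr_ge0 ?(ltW M0)//=.
  by rewrite /x mulrC ler_pdivrMr// mul1r.
rewrite -binomial_mean_sub.
have bnd k : (k <= n)%N -> `|f (M * k%:R / n%:R) - f s| <=
    e / 2 + K / n%:R ^+ 2 * (k%:R - n%:R * x) ^+ 2.
  move=> kn; set y := M * k%:R / n%:R.
  have yM : 0 <= y <= M.
    rewrite divr_ge0 ?mulr_ge0 ?(ltW M0)//= ler_pdivrMr// ler_pM2l//.
    by rewrite ler_nat.
  have e2 : 0 <= e / 2 by rewrite divr_ge0// ltW.
  have [ysd|dys] := ltP `|y - s| d.
    apply: (le_trans (fd _ _ yM sM ysd)); rewrite lerDl.
    by rewrite mulr_ge0 ?sqr_ge0// divr_ge0// exprn_ge0// ltW.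
  apply: (@le_trans _ _ (2 * C)).
    apply: (le_trans (ler_normB _ _)); have := fC _ yM; have := fC _ sM; lra.
  suff : 2 * C <= K / n%:R ^+ 2 * (k%:R - n%:R * x) ^+ 2 by lra.
  have -> : K / n%:R ^+ 2 * (k%:R - n%:R * x) ^+ 2 = 2 * C * (`|y - s| / d) ^+ 2.
    rewrite expr_div_n real_normK ?num_real// /K sE /y; field.
    by rewrite !gt_eqF.
  rewrite ler_peMr ?mulr_ge0// expr_ge1 ?divr_ge0 ?(ltW d0)//.
  by rewrite ler_pdivlMr// mul1r.
have tot : binomial_mean x n (fun k => e / 2 + K / n%:R ^+ 2 *
   (k%:R - n%:R * x) ^+ 2) <= e.
  rewrite binomial_meanD binomial_mean_cst binomial_meanZ.
  rewrite (_ : (fun k => (k%:R - n%:R * x) ^+ 2) = (fun k => k%:R ^+ 2 +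
     ((- 2 * (n%:R * x)) * k%:R + (n%:R * x) ^+ 2))); last first.
    by apply/funext => k; ring.
  rewrite !binomial_meanD binomial_meanZ binomial_mean_cst binomial_mean1 binomial_mean2.
  have -> : K / n%:R ^+ 2 * ((n%:R * x) ^+ 2 + n%:R * x * (1 - x) +
     (-2 * (n%:R * x) * (n%:R * x) + (n%:R * x) ^+ 2)) = K / n%:R * (x * (1 - x)).
    by field; rewrite gt_eqF.
  have : K / n%:R * (x * (1 - x)) <= K / n%:R.
    rewrite ler_piMr ?divr_ge0 ?(ltW n0)//; move/andP: x01 => [x0 x1]; nra.
  lra.
rewrite ler_norml; apply/andP; split.
  rewrite lerNl -mulN1r -binomial_meanZ.
  apply: le_trans tot; apply: ler_binomial_mean => // k kn.
  rewrite mulN1r; apply: le_trans (bnd _ kn).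
  by rewrite -normrN ler_norm.
apply: le_trans tot; apply: ler_binomial_mean => // k kn.
by apply: le_trans (bnd _ kn); exact: ler_norm.
Qed.

Lemma powR_lipschitz (t M : R) : 1 <= t -> 0 < M -> forall x y,
  0 <= x <= M -> 0 <= y <= M -> `|x `^ t - y `^ t| <= t * M `^ (t - 1) * `|x - y|.
Proof.
move=> t1 M0.
suff H x y : 0 <= x -> y <= M -> x <= y ->
    `|x `^ t - y `^ t| <= t * M `^ (t - 1) * `|x - y|.
  move=> x y /andP[x0 xM] /andP[y0 yM]; have [xy|/ltW yx] := leP x y; first exact: H.
  by rewrite distrC (distrC x); apply: H.
move=> x0 yM xy; have y0 := le_trans x0 xy; have t0 := lt_le_trans ltr01 t1.
rewrite distrC ger0_norm; last first.
  by rewrite subr_ge0 ge0_ler_powR ?nnegrE// ltW.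
rewrite distrC ger0_norm ?subr_ge0//.
have h := powR_tangent t1 x0 y0.
have h2 : y * y `^ (t - 1) = y `^ t by rewrite mulr_powRB1.
have h3 : y `^ (t - 1) <= M `^ (t - 1).
  by apply: ge0_ler_powR; rewrite ?nnegrE ?subr_ge0 ?(ltW M0).
have h4 : t * y `^ (t - 1) * (y - x) <= t * M `^ (t - 1) * (y - x).
  by rewrite ler_wpM2r ?subr_ge0// ler_wpM2l// ltW.
rewrite -h2 in h *; lra.
Qed.

Lemma powR_superadditive (p a b : R) : 1 <= p -> 0 <= a -> 0 <= b ->
  a `^ p + b `^ p <= (a + b) `^ p.
Proof.
move=> p1 a0 b0; have p0 := lt_le_trans ltr01 p1.
rewrite -(mulr_powRB1 a0 p0) -(mulr_powRB1 b0 p0) -(mulr_powRB1 (addr_ge0 a0 b0) p0).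
rewrite mulrDl; apply: lerD; rewrite ler_wpM2l// ge0_ler_powR ?nnegrE ?subr_ge0 ?addr_ge0//.
  by rewrite lerDl.
by rewrite lerDr.
Qed.

(** Apply superadditivity of the power 1/t to a^t and b^t. *)
Lemma powR_subadditive (t a b : R) : 0 < t <= 1 -> 0 <= a -> 0 <= b ->
  (a + b) `^ t <= a `^ t + b `^ t.
Proof.
move=> /andP[t0 t1] a0 b0.
have tK c : 0 <= c -> (c `^ t) `^ t^-1 = c.
  by move=> c0; rewrite -powRrM mulfV ?gt_eqF// powRr1.
rewrite -{1}(tK a a0) -{1}(tK b b0).
have h : 1 <= t^-1 by rewrite invf_ge1.
have := powR_superadditive h (powR_ge0 a t) (powR_ge0 b t).
move=> /(@ge0_ler_powR _ t (ltW t0)).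
rewrite !nnegrE addr_ge0 ?powR_ge0// => /(_ isT isT) k.
by apply: (le_trans k); rewrite -powRrM mulVf ?gt_eqF// powRr1// addr_ge0// powR_ge0.
Qed.

(** For t >= 1 the power is Lipschitz on bounded intervals; for 0 < t < 1 it is
    subadditive, so |x^t - y^t| <= |x - y|^t. *)
Lemma powR_unif_continuous (t M : R) : 0 <= t -> 0 < M ->
  forall e, 0 < e -> exists2 d, 0 < d & forall x y, 0 <= x <= M -> 0 <= y <= M ->
     `|x - y| < d -> `|x `^ t - y `^ t| <= e.
Proof.
move=> t0 M0 e e0; have [->|tn0] := eqVneq t 0.
  by exists 1 => // x y _ _ _; rewrite !powRr0 subrr normr0 ltW.
have tp : 0 < t by rewrite lt_def tn0.
have [t1|/ltW t1] := leP 1 t.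
  have c0 : 0 < t * M `^ (t - 1) by rewrite mulr_gt0// powR_gt0.
  exists (e / (t * M `^ (t - 1))); first exact: divr_gt0.
  move=> x y hx hy; rewrite ltr_pdivlMr// mulrC => /ltW; apply: le_trans.
  exact: powR_lipschitz.
exists (e `^ t^-1); first exact: powR_gt0.
suff H x y : 0 <= x -> x <= y -> `|x - y| < e `^ t^-1 -> `|x `^ t - y `^ t| <= e.
  move=> x y /andP[x0 _] /andP[y0 _]; have [xy|/ltW yx] := leP x y; first exact: H.
  by rewrite distrC (distrC (_ `^ _)); apply: H.
move=> x0 xy; have y0 := le_trans x0 xy.
rewrite distrC ger0_norm ?subr_ge0// => h.
rewrite distrC ger0_norm; last first.
  by rewrite subr_ge0 ge0_ler_powR ?nnegrE// ltW.
have yx0 : 0 <= y - x by rewrite subr_ge0.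
have := powR_subadditive (introT andP (conj tp t1)) x0 yx0.
rewrite subrKC => k.
have : (y - x) `^ t <= (e `^ t^-1) `^ t.
  by apply: ge0_ler_powR; rewrite ?nnegrE ?powR_ge0// ltW.
rewrite -powRrM mulVf// powRr1 ?(ltW e0)// => k2; lra.
Qed.

Lemma powR_bounded (t M : R) : 0 <= t -> forall x, 0 <= x <= M -> `|x `^ t| <= M `^ t.
Proof.
move=> t0 x /andP[x0 xM]; rewrite ger0_norm ?powR_ge0//.
by apply: ge0_ler_powR; rewrite ?nnegrE//; exact: le_trans xM.
Qed.

End Bernstein.

(** * Polynomials in a positive operator *)

Section HilbertBasics.
Context {R : realType} {H : hilbertType R}.
Local Notation dot := (@dotH R H).
Implicit Types (x y z : H) (A B C : H -> H).

Lemma normH x : `|x| = (hnorm dot x)%:C%C.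
Proof.
apply/eqP; rewrite -(@eqrXn2 _ 2)//; last by rewrite lecR hnorm_ge0.
by rewrite -dotHxx sqnE -hnorm_sqr rmorphXn.
Qed.

Lemma bounded_opP A : bounded_op A <->
  linear A /\ exists2 M, 0 <= M & bounded_by dot dot M A.
Proof.
split=> [[lA cA]|[lA [M M0 AM]]]; split=> //.
  pose f := GRing.isLinear.Build _ _ _ _ A lA.
  pose A' : {linear H -> H} := HB.pack A f.
  have /linear_bounded_continuous/linear_boundedP : continuous A' by [].
  move=> /pinfty_ex_gt0[r r0 hr]; exists (complex.Re r).
    by rewrite -lecR RRe_ge0 ?ltW.
  move=> x; have := hr x; rewrite !normH -{1}(RRe_ge0 (ltW r0)) -rmorphM /=.
  by rewrite lecR.
pose f := GRing.isLinear.Build _ _ _ _ A lA.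
pose A' : {linear H -> H} := HB.pack A f.
suff : continuous A' by [].
apply/linear_bounded_continuous/linear_boundedP.
near=> r => x; rewrite !normH; have := AM x; rewrite -lecR rmorphM /= => /le_trans; apply.
rewrite ler_wpM2r ?lecR ?hnorm_ge0//.
by near: r; apply: nbhs_pinfty_ge; apply/complex_realP; exists M.
Unshelve. all: by end_near. Qed.

Lemma hilbert_complete (u : nat -> H) :
  (forall e : R, 0 < e -> exists N, forall m n, (N <= m)%N -> (N <= n)%N ->
     hnorm dot (u m - u n) <= e) ->
  exists l, forall e : R, 0 < e -> exists N, forall n, (N <= n)%N ->
     hnorm dot (u n - l) <= e.
Proof.
move=> cu.
have cvu : cvg (u @ \oo).
  apply: cauchy_cvg; apply: cauchy_exP => e e0.
  have e0' : 0 < complex.Re e / 2.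
    by rewrite divr_gt0// -ltcR RRe_ge0 ?ltW.
  have [N hN] := cu _ e0'; exists (u N).
  exists N => // n /= Nn; rewrite -ball_normE /ball_ /= normH.
  rewrite -(RRe_ge0 (ltW e0)) ltcR.
  apply: (le_lt_trans (hN _ _ (leqnn _) Nn)).
  move: e0'; lra.
exists (lim (u @ \oo)) => e e0.
have e0C : 0 < e%:C%C :> R[i] by rewrite ltcR.
move/cvgrPdist_le : cvu => /(_ _ e0C) [N _ hN].
exists N => n Nn; have := hN n Nn; rewrite /= normH lecR.
by rewrite -hnormN opprB.
Qed.

Lemma bounded_by_op_norm A M : 0 <= M -> bounded_by dot dot M A -> linear A ->
  bounded_by dot dot (op_norm A) A /\ 0 <= op_norm A <= M.
Proof.
move=> M0 AM lA.
set S := [set complex.Re `|A x| | x in [set x : H | `|x| <= 1]]%classic.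
have Sub : ubound S M.
  move=> _ [x /= x1 <-]; rewrite normH /=; apply: (le_trans (AM _)).
  by move: x1; rewrite normH lecR => x1; rewrite ler_piMr.
have S0 : S 0.
  by exists 0; rewrite /= ?normr0 ?ler01// (lin0 lA) normr0.
have hS : has_sup S by split; [exists 0 | exists M].
have n0 : 0 <= op_norm A by apply: ub_le_sup => //; exists M.
have nM : op_norm A <= M by apply: ge_sup => //; exists 0.
split; last by rewrite n0.
move=> x; have [->|x0] := eqVneq x 0.
  by rewrite (lin0 lA) !hnorm0 mulr0.
have h0 : 0 < hnorm dot x.
  by rewrite lt_def hnorm_ge0 andbT; apply: contra_neq x0 => /hnorm_eq0.
rewrite -ler_pdivrMr// mulrC.
have -> : (hnorm dot x)^-1 * hnorm dot (A x) =
    complex.Re `|A (normalized dot x)|.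
  by rewrite normH (linZ lA) hnormZ cmod_real ger0_norm// invr_ge0 ltW.
apply: ub_le_sup; first by exists M.
exists (normalized dot x) => //=.
by rewrite normH hnorm_normalized.
Qed.

Lemma op_norm_bounded A : bounded_op A ->
  bounded_by dot dot (op_norm A) A /\ 0 <= op_norm A.
Proof.
move=> /bounded_opP[lA [M M0 AM]].
by have [h /andP[]] := bounded_by_op_norm M0 AM lA.
Qed.

End HilbertBasics.

Section OpPoly.
Context {R : realType} {H : hilbertType R}.
Local Notation dot := (@dotH R H).
Context (A : H -> H) (lA : linear A).
Implicit Types (q r : {poly R}).

Lemma op_poly_widen q n x : (size q <= n)%N ->
  op_poly q A x = \sum_(k < n) (q`_k)%:C%C *: iter k A x.
Proof.
move=> qn; rewrite /op_poly (big_ord_widen n (fun k => (q`_k)%:C%C *: iter k A x) qn).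
rewrite big_mkcond; apply: eq_bigr => k _; case: ltnP => // h.
by rewrite nth_default// scale0r.
Qed.

Lemma op_polyD q r x : op_poly (q + r) A x = op_poly q A x + op_poly r A x.
Proof.
pose n := maxn (size q) (size r).
rewrite !(@op_poly_widen _ n) ?leq_maxl ?leq_maxr ?size_polyD//.
rewrite -big_split /=; apply: eq_bigr => k _.
by rewrite coefD rmorphD scalerDl.
Qed.

Lemma op_polyZ c q x : op_poly (c *: q) A x = c%:C%C *: op_poly q A x.
Proof.
rewrite !(@op_poly_widen _ (size q)) ?size_scale_leq// scaler_sumr.
by apply: eq_bigr => k _; rewrite coefZ rmorphM scalerA.
Qed.

Lemma op_polyC c x : op_poly c%:P A x = c%:C%C *: x.
Proof.
by rewrite (@op_poly_widen _ 1) ?size_polyC_leq1// big_ord1 coefC eqxx.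
Qed.

Lemma op_polyMX q x : op_poly (q * 'X) A x = A (op_poly q A x).
Proof.
rewrite (@op_poly_widen _ (size q).+1) ?size_mulX_leq//; last first.
  by rewrite (leq_trans (size_polyMleq _ _))// size_polyX addn2.
rewrite big_ord_recl coefMX eqxx scale0r add0r /op_poly (lin_sum lA).
by apply: eq_bigr => k _; rewrite coefMX /= (linZ lA).
Qed.

Lemma op_polyM q r x : op_poly (q * r) A x = op_poly q A (op_poly r A x).
Proof.
elim/poly_ind: q => [|q c IH].
  by rewrite mul0r -(polyC0) !op_polyC !scale0r.
rewrite mulrDl !op_polyD mul_polyC op_polyZ op_polyC; congr (_ + _).
by rewrite mulrAC !op_polyMX IH.
Qed.

Lemma op_polyX x : op_poly 'X A x = A x.
Proof. by rewrite -['X]mul1r op_polyMX -polyC1 op_polyC scale1r. Qed.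

Lemma op_poly_linear q : linear (op_poly q A).
Proof.
move=> a x y; elim/poly_ind: q => [|q c IH].
  by rewrite -polyC0 !op_polyC !scale0r scaler0 addr0.
rewrite !op_polyD !op_polyMX IH (linD lA) (linZ lA) !op_polyC !scalerDr.
by rewrite !scalerA (mulrC _ a) addrACA.
Qed.

Context (sA : selfadjoint dot A).

Lemma op_poly_selfadjoint q : selfadjoint dot (op_poly q A).
Proof.
elim/poly_ind: q => [|q c IH] x y.
  by rewrite -polyC0 !op_polyC !scale0r dot0l dot0r.
rewrite !op_polyD !op_polyMX !op_polyC dotDl dotDr dotZl dotZr conj_real.
rewrite sA IH; congr (_ + _).
by rewrite -op_polyMX op_polyM op_polyX.
Qed.

Context (M : R) (M0 : 0 <= M) (AM : bounded_by dot dot M A)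
  (A0 : forall x, 0 <= complex.Re (dot (A x) x)).

(** The eigenvalues l_k = <A u_k, u_k> of a compression of A lie in the numerical
    range of A, which is contained in [0, M]. *)
Lemma op_poly_spectral (s : seq H) n : exists (N : nat) (u : 'I_N -> H) (l : 'I_N -> R),
  [/\ orthonormal_fam dot u, forall k, 0 <= l k <= M,
      forall k, complex.Re (dot (A (u k)) (u k)) = l k,
      forall j k, j != k -> dot (A (u j)) (u k) = 0
    & forall x q, x \in s -> (size q <= n.+1)%N ->
      op_poly q A x = \sum_k (q.[l k])%:C%C *: (dot x (u k) *: u k)].
Proof.
have [N [u [l [ou us ul]]]] := krylov_spectral s n lA sA.
have lE k : complex.Re (dot (A (u k)) (u k)) = l k by rewrite ul eqxx.
exists N, u, l; split=> //.
- move=> k; apply/andP; split; first by rewrite -lE.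
  rewrite -lE; apply: (le_trans (Re_le_cmod _)).
  apply: (le_trans (cauchy_schwarz_hnorm _ _ _)).
  have -> : hnorm dot (u k) = 1 by rewrite /hnorm /sqn ou eqxx sqrtr1.
  rewrite mulr1; apply: (le_trans (AM _)).
  by rewrite /hnorm /sqn ou eqxx sqrtr1 mulr1.
- by move=> j k /negbTE jk; rewrite ul jk mulr0n.
- move=> x q xs qn; rewrite (op_poly_widen _ (leqnn _)).
  transitivity (\sum_(i < size q) \sum_k ((q`_i)%:C%C * ((l k) ^+ i)%:C%C) *:
      (dot x (u k) *: u k)).
    apply: eq_bigr => i _; rewrite us// ?scaler_sumr; last first.
      by rewrite -ltnS (leq_trans _ qn).
    by apply: eq_bigr => k _; rewrite !scalerA.
  rewrite exchange_big /=; apply: eq_bigr => k _.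
  rewrite -scaler_suml; congr (_ *: _).
  by rewrite horner_coef rmorph_sum; apply: eq_bigr => i _; rewrite rmorphM.
Qed.

Lemma op_poly_spectral1 x q : exists (N : nat) (u : 'I_N -> H) (l : 'I_N -> R),
  [/\ orthonormal_fam dot u, forall k, 0 <= l k <= M
    & op_poly q A x = \sum_k (q.[l k])%:C%C *: (dot x (u k) *: u k)].
Proof.
have [N [u [l [ou lM _ _ us]]]] := op_poly_spectral [:: x] (size q).
by exists N, u, l; split=> //; apply: us => //; rewrite inE.
Qed.

(** The norm of q(A) is at most the supremum of q on [0, M], tested on one vector
    x at a time by the Krylov decomposition of x. *)
Lemma op_poly_bound q c : 0 <= c -> (forall s, 0 <= s <= M -> `|q.[s]| <= c) ->
  bounded_by dot dot c (op_poly q A).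
Proof.
move=> c0 qc x; have [N [u [l [ou lM ->]]]] := op_poly_spectral1 x q.
rewrite -(@ler_pXn2r _ 2)// ?nnegrE ?mulr_ge0 ?hnorm_ge0// exprMn !hnorm_sqr.
under eq_bigr do rewrite scalerA.
rewrite sqn_fam_sum//.
apply: (@le_trans _ _ (\sum_k c ^+ 2 * cmod (dot x (u k)) ^+ 2)).
  apply: ler_sum => k _; rewrite cmodM exprMn cmod_real ler_wpM2r ?sqr_ge0//.
  by rewrite ler_pXn2r ?nnegrE ?normr_ge0// qc.
rewrite -mulr_sumr ler_wpM2l ?sqr_ge0//; apply: bessel; exact: orthonormal_famW.
Qed.

(** For c <= 0, Bessel's inequality for the eigenvectors suffices where one would
    otherwise use Parseval's identity. *)
Lemma op_poly_lower q c x : c <= 0 -> (forall s, 0 <= s <= M -> c <= q.[s]) ->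
  c * sqn dot x <= complex.Re (dot (op_poly q A x) x).
Proof.
move=> c0 qc; have [N [u [l [ou lM ->]]]] := op_poly_spectral1 x q.
rewrite dot_suml Re_sum.
apply: (@le_trans _ _ (\sum_k c * cmod (dot x (u k)) ^+ 2)).
  rewrite -mulr_sumr -lerN2 -!mulNr ler_wpM2l ?oppr_ge0//.
  by apply: bessel; exact: orthonormal_famW.
apply: ler_sum => k _; rewrite !dotZl Re_real_mul (dotC _ (u k)).
by rewrite -cmod_sqr /= ler_wpM2r ?sqr_ge0// qc.
Qed.

End OpPoly.

(** * Continuous functional calculus *)

Lemma uniform_cvgP (R : realType) (m : R) (F : nat -> R -> R) (f : R -> R) :
  {uniform `[0, m], F @ \oo --> f} <->
  forall e, 0 < e -> exists N, forall n, (N <= n)%N -> forall s, 0 <= s <= m ->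
    `|F n s - f s| <= e.
Proof.
split=> [Ff e e0|h P].
  have : nbhs (f : {uniform` `[0, m] -> R})
      [set g : R -> R | forall y, `[0, m]%classic y -> `|f y - g y| < e].
    apply/uniform_nbhs; exists [set xy | ball xy.1 e xy.2]; split => //.
    by rewrite -entourage_ballE; exists e.
  move=> /Ff[N _ hN]; exists N => n Nn s sm.
  rewrite distrC ltW//; apply: (hN n Nn) => /=; by rewrite in_itv.
move=> /uniform_nbhs[E [entE EP]].
move: entE; rewrite -entourage_ballE => -[e /= e0 eE].
have [N hN] := h _ (divr_gt0 e0 (ltr0Sn R 1)).
exists N => // n /= Nn; apply: EP => s; rewrite /= in_itv /= => sm.
apply: eE; rewrite /= /ball /= distrC; apply: (le_lt_trans (hN n Nn s sm)).
by rewrite ltr_pdivrMr// ltr_pMr// ltr1n.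
Qed.

Lemma small_inv (R : realType) (e : R) : 0 < e -> exists N, forall n, (N <= n)%N ->
  n.+1%:R^-1 <= e.
Proof.
move=> e0; exists (Num.bound e^-1) => n Nn.
rewrite invf_ple ?posrE// (le_trans (ltW (archi_boundP _))) ?invr_ge0 ?(ltW e0)//.
by rewrite ler_nat (leq_trans Nn).
Qed.

Section PositiveOperator.
Context {R : realType} {H : hilbertType R}.
Local Notation dot := (@dotH R H).

(** Polarization: <Az, z> is real for z = x, y, x + y and x + iy. *)
Lemma positive_selfadjoint (A : H -> H) : positive_op A -> selfadjoint dot A.
Proof.
move=> [[lA _] A0] x y.
have im z : complex.Im (dot (A z) z) = 0.
  by have := A0 z; rewrite lecE /= => /andP[/eqP].
have h1 := im (x + y); have h2 := im (x + 'i%C *: y).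
rewrite (dotC _ x); move: h1 h2.
rewrite !(linD lA) (linZ lA) !dotDl !dotDr !dotZl !dotZr.
have := im x; have := im y.
case: (dot (A x) x) => ? ? /=; case: (dot (A y) y) => ? ? /=.
case: (dot (A x) y) => a1 a2 /=; case: (dot (A y) x) => b1 b2 /= -> ->.
move=> h1 h2; apply/eqP; rewrite eq_complex /=; apply/andP; split; apply/eqP; lra.
Qed.

Lemma positive_Re_ge0 (A : H -> H) x : positive_op A ->
  0 <= complex.Re (dot (A x) x).
Proof. by case=> _ /(_ x); rewrite lecE => /andP[]. Qed.

Context (A : H -> H) (PA : positive_op A).
Let lA : linear A. Proof. by case: PA => [[]]. Qed.
Let sA : selfadjoint dot A. Proof. exact: positive_selfadjoint. Qed.
Let A0 x : 0 <= complex.Re (dot (A x) x).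
Proof. exact: positive_Re_ge0. Qed.
Let m := op_norm A.
Let Am : bounded_by dot dot m A. Proof. exact: (op_norm_bounded PA.1).1. Qed.
Let m0 : 0 <= m. Proof. exact: (op_norm_bounded PA.1).2. Qed.

(** B = f(A), in a form that refers to a single polynomial at a time and to the
    bound of an operator instead of its norm. It is compatible with sums,
    products and order, and determines B. *)
Definition op_approx (f : R -> R) (B : H -> H) : Prop :=
  linear B /\ forall e, 0 < e -> exists q : {poly R},
    (forall s, 0 <= s <= m -> `|q.[s] - f s| <= e) /\
    bounded_by dot dot e (fun x => op_poly q A x - B x).

Lemma op_approx_norm f B c : 0 <= c -> op_approx f B ->
  (forall s, 0 <= s <= m -> `|f s| <= c) -> bounded_by dot dot c B.
Proof.
move=> c0 [lB fB] fc x; apply/ler_addgt0Pr => e e0.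
pose e' := e / (2 * (hnorm dot x + 1)).
have h0 : 0 < 2 * (hnorm dot x + 1) by rewrite mulr_gt0// ltr_wpDl ?hnorm_ge0.
have e'0 : 0 < e' by rewrite divr_gt0.
have [q [qf qB]] := fB _ e'0.
rewrite -[B x](subKr (op_poly q A x)); apply: (le_trans (hnormD _ _ _)).
rewrite hnormN.
have qc : forall s, 0 <= s <= m -> `|q.[s]| <= c + e'.
  move=> s sm; rewrite -(subrK (f s) q.[s]) addrC.
  by rewrite (le_trans (ler_normD _ _))// lerD// ?fc ?qf.
have := op_poly_bound lA sA Am A0 (addr_ge0 c0 (ltW e'0)) qc x; have := qB x.
have : 2 * e' * hnorm dot x <= e.
  rewrite /e'; have -> : 2 * (e / (2 * (hnorm dot x + 1))) * hnorm dot x =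
     e * (hnorm dot x / (hnorm dot x + 1)).
    by field; rewrite gt_eqF// ltr_wpDl ?hnorm_ge0.
  by rewrite ler_piMr ?(ltW e0)// ler_pdivrMr ?mul1r ?lerDl// ltr_wpDl ?hnorm_ge0.
lra.
Qed.

Lemma op_approx_poly q : op_approx (fun s => q.[s]) (op_poly q A).
Proof.
split; first exact: op_poly_linear.
move=> e e0; exists q; split=> [s _|x]; first by rewrite subrr normr0 ltW.
by rewrite subrr hnorm0 mulr_ge0 ?hnorm_ge0 ?(ltW e0).
Qed.

Lemma op_approx_comb f g B C (a : R) : op_approx f B -> op_approx g C ->
  op_approx (fun s => f s + a * g s) (fun x => B x + a%:C%C *: C x).
Proof.
move=> [lB fB] [lC gC]; split.
  move=> c x y; rewrite lB lC !scalerDr !scalerA (mulrC a%:C%C) addrACA.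
  by rewrite -!addrA.
move=> e e0.
have e2 : 0 < e / 2 by rewrite divr_gt0.
have a1 : 0 < `|a| + 1 by rewrite ltr_wpDl.
have ea : 0 < e / 2 / (`|a| + 1) by rewrite divr_gt0.
have [q [qf qB]] := fB _ e2; have [r [rg rC]] := gC _ ea.
have ale : `|a| * (e / 2 / (`|a| + 1)) <= e / 2.
  rewrite mulrCA ler_piMr ?(ltW e2)// ler_pdivrMr// mul1r lerDl//.
exists (q + a *: r); split=> [s sm|x].
  rewrite hornerD hornerZ.
  have -> : q.[s] + a * r.[s] - (f s + a * g s) = (q.[s] - f s) + a * (r.[s] - g s) by ring.
  apply: (le_trans (ler_normD _ _)); rewrite normrM.
  have := qf s sm; have := ler_wpM2l (normr_ge0 a) (rg s sm); lra.
rewrite op_polyD op_polyZ.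
have -> : op_poly q A x + a%:C%C *: op_poly r A x - (B x + a%:C%C *: C x) =
  (op_poly q A x - B x) + a%:C%C *: (op_poly r A x - C x).
  by rewrite scalerBr opprD addrACA.
apply: (le_trans (hnormD _ _ _)); rewrite hnormZ cmod_real.
have := qB x; have := ler_wpM2l (normr_ge0 a) (rC x).
have := ler_wpM2r (hnorm_ge0 dot x) ale; rewrite mulrA; lra.
Qed.

Lemma op_approx_bounded f B : op_approx f B ->
  exists2 c, 0 <= c & (forall s, 0 <= s <= m -> `|f s| <= c) /\ bounded_by dot dot c B.
Proof.
move=> fB; have [q [qf _]] := fB.2 _ ltr01.
have [c c0 qc] : exists2 c, 0 <= c & forall s, 0 <= s <= m -> `|q.[s]| <= c.
  elim/poly_ind: (q) => [|r b [c c0 IH]].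
    by exists 0 => // s _; rewrite horner0 normr0.
  exists (c * m + `|b|); first by rewrite addr_ge0 ?mulr_ge0.
  move=> s sm; rewrite hornerMXaddC (le_trans (ler_normD _ _))// lerD// normrM.
  apply: ler_pM => //; first exact: IH.
  by move/andP: sm => [s0 s1]; rewrite ger0_norm.
have fc s : 0 <= s <= m -> `|f s| <= c + 1.
  move=> sm; rewrite -[f s](subKr q.[s]) (le_trans (ler_normB _ _))// lerD//.
    exact: qc.
  exact: qf.
exists (c + 1); first by rewrite addr_ge0.
split=> //; apply: op_approx_norm fB fc; by rewrite addr_ge0.
Qed.

Lemma op_approx_uniq f g B C : op_approx f B -> op_approx g C ->
  (forall s, 0 <= s <= m -> f s = g s) -> B = C.
Proof.
move=> fB gC fg; apply/funext => x.
have := op_approx_norm (lexx 0) (op_approx_comb (-1) fB gC) _ x.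
rewrite mul0r => h; apply/eqP; rewrite -subr_eq0; apply/eqP/(@hnorm_eq0 _ _ dot).
apply/eqP; rewrite eq_le hnorm_ge0 andbT.
rewrite (_ : B x - C x = B x + (-1)%:C%C *: C x); last by rewrite rmorphN1 scaleN1r.
apply: h.
by move=> s sm; rewrite fg// mulN1r subrr normr0.
Qed.

Lemma op_approx_mul f g B C : op_approx f B -> op_approx g C ->
  op_approx (fun s => f s * g s) (B \o C).
Proof.
move=> fB gC; have [lB fB'] := fB; have [lC gC'] := gC.
split; first by move=> a x y /=; rewrite lC lB.
have [cf cf0 [fcf Bcf]] := op_approx_bounded fB.
have [cg cg0 [gcg Ccg]] := op_approx_bounded gC.
move=> e e0; pose K := cf + cg + 1.
have K0 : 0 < K by rewrite /K; lra.
pose e' := Num.min 1 (e / K).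
have e'0 : 0 < e' by rewrite /e' lt_min ltr01 divr_gt0.
have e'1 : e' <= 1 by rewrite /e' ge_min lexx.
have e'K : K * e' <= e by rewrite mulrC -ler_pdivlMr// /e' ge_min lexx orbT.
have [q [qf qB]] := fB' _ e'0; have [r [rg rC]] := gC' _ e'0.
have rb s : 0 <= s <= m -> `|r.[s]| <= cg + 1.
  move=> sm; rewrite -(subrK (g s) r.[s]) addrC (le_trans (ler_normD _ _))// lerD//.
    exact: gcg.
  by apply: le_trans e'1; exact: rg.
exists (q * r); split=> [s sm|x].
  rewrite hornerM.
  have -> : q.[s] * r.[s] - f s * g s = (q.[s] - f s) * r.[s] + f s * (r.[s] - g s) by ring.
  apply: (le_trans (ler_normD _ _)); rewrite !normrM.
  have h1 := ler_pM (normr_ge0 _) (normr_ge0 _) (qf s sm) (rb s sm).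
  have h2 := ler_pM (normr_ge0 _) (normr_ge0 _) (fcf s sm) (rg s sm).
  apply: le_trans e'K; rewrite /K; lra.
rewrite op_polyM//= -(subrK (B (op_poly r A x)) (op_poly q A _)) -addrA -(linB lB).
apply: (le_trans (hnormD _ _ _)).
have h1 := qB (op_poly r A x).
have h2 := op_poly_bound lA sA Am A0 (addr_ge0 cg0 ler01) rb x.
have h3 := Bcf (op_poly r A x - C x).
have h4 := rC x.
have h5 := ler_wpM2l (ltW e'0) h2.
have h6 := ler_wpM2l cf0 h4.
have h7 := ler_wpM2r (hnorm_ge0 dot x) e'K.
rewrite /K in h7; lra.
Qed.

Lemma op_approx_selfadjoint f B : op_approx f B -> selfadjoint dot B.
Proof.
move=> [lB fB] x y; apply/eqP; rewrite -subr_eq0; apply/eqP/cmod_eq0.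
apply/eqP; rewrite eq_le cmod_ge0 andbT; apply/ler_addgt0Pr => e e0; rewrite add0r.
pose K := 2 * hnorm dot x * hnorm dot y + 1.
have xy0 : 0 <= 2 * hnorm dot x * hnorm dot y by rewrite !mulr_ge0 ?hnorm_ge0.
have K0 : 0 < K by rewrite ltr_wpDl.
have [q [_ qB]] := fB _ (divr_gt0 e0 K0).
have -> : dot (B x) y - dot x (B y) =
  - dot (op_poly q A x - B x) y + dot x (op_poly q A y - B y).
  by rewrite dotBl dotBr (op_poly_selfadjoint lA sA); ring.
apply: (le_trans (cmodD _ _)); rewrite cmodN.
have h1 := le_trans (cauchy_schwarz_hnorm dot _ _) (ler_wpM2r (hnorm_ge0 dot y) (qB x)).
have h2 := le_trans (cauchy_schwarz_hnorm dot _ _) (ler_wpM2l (hnorm_ge0 dot x) (qB y)).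
apply: (le_trans (lerD h1 h2)).
have -> : e / K * hnorm dot x * hnorm dot y + hnorm dot x * (e / K * hnorm dot y) =
  e * (2 * hnorm dot x * hnorm dot y / K) by ring.
by rewrite ler_piMr ?(ltW e0)// ler_pdivrMr// mul1r lerDl.
Qed.

Lemma op_approx_ge0 f B x : op_approx f B -> (forall s, 0 <= s <= m -> 0 <= f s) ->
  0 <= complex.Re (dot (B x) x).
Proof.
move=> [lB fB] f0; apply/ler_addgt0Pl => e e0.
pose K := 2 * sqn dot x + 1.
have x0 := sqn_ge0 dot x.
have K0 : 0 < K by rewrite ltr_wpDl// mulr_ge0.
have d0 := divr_gt0 e0 K0.
have [q [qf qB]] := fB _ d0.
have qd s : 0 <= s <= m -> - (e / K) <= q.[s].
  move=> sm; have := qf s sm; rewrite ler_norml => /andP[+ _].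
  have := f0 s sm; lra.
have h1 := @op_poly_lower _ _ _ lA sA _ Am A0 q (- (e / K)) x.
have h2 : complex.Re (dot (op_poly q A x - B x) x) <= e / K * sqn dot x.
  apply: (le_trans (Re_le_cmod _)); apply: (le_trans (cauchy_schwarz_hnorm _ _ _)).
  apply: (le_trans (ler_wpM2r (hnorm_ge0 dot x) (qB x))).
  by rewrite -hnorm_sqr expr2 mulrA.
have h3 := h1 _ qd; move: h2; rewrite dotBl ReD ReN => h2.
have : e / K * sqn dot x * 2 <= e.
  have -> : e / K * sqn dot x * 2 = e * (2 * sqn dot x / K) by ring.
  by rewrite ler_piMr ?(ltW e0)// ler_pdivrMr// mul1r lerDl.
have : - (e / K) <= 0 by rewrite oppr_le0 ltW.
move=> /h3; lra.
Qed.

Lemma op_approx_bounded_op f B : op_approx f B -> bounded_op B.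
Proof.
move=> fB; apply/bounded_opP; split; first by case: fB.
by have [c c0 [_ h]] := op_approx_bounded fB; exists c.
Qed.

(** For polynomials q_n uniformly within 1/(n+1) of f, the vectors q_n(A) x form
    a Cauchy sequence for each x; B x is its limit. *)
Lemma op_approx_exists f :
  (forall e, 0 < e -> exists q : {poly R}, forall s, 0 <= s <= m -> `|q.[s] - f s| <= e) ->
  exists B (q : nat -> {poly R}), linear B /\ forall n,
    (forall s, 0 <= s <= m -> `|(q n).[s] - f s| <= n.+1%:R^-1) /\
    bounded_by dot dot (2 * n.+1%:R^-1) (fun x => op_poly (q n) A x - B x).
Proof.
move=> hf.
have /choice[q hq] : forall n : nat, exists q : {poly R},
   forall s, 0 <= s <= m -> `|q.[s] - f s| <= n.+1%:R^-1.
  by move=> n; apply: hf; rewrite invr_gt0.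
have cq n k x : hnorm dot (op_poly (q n) A x - op_poly (q k) A x) <=
    (n.+1%:R^-1 + k.+1%:R^-1) * hnorm dot x.
  have -> : op_poly (q n) A x - op_poly (q k) A x = op_poly (q n + (-1) *: q k) A x.
    by rewrite op_polyD op_polyZ rmorphN1 scaleN1r.
  apply: (op_poly_bound lA sA Am A0).
    by rewrite addr_ge0 ?invr_ge0.
  move=> s sm; rewrite hornerD hornerZ mulN1r.
  have -> : (q n).[s] - (q k).[s] = ((q n).[s] - f s) - ((q k).[s] - f s) by ring.
  by rewrite (le_trans (ler_normB _ _))// lerD ?hq.
have /choice[B hB] : forall x, exists l, forall e : R, 0 < e -> exists N,
    forall n, (N <= n)%N -> hnorm dot (op_poly (q n) A x - l) <= e.
  move=> x; apply: hilbert_complete => e e0.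
  have x1 : 0 < 2 * (hnorm dot x + 1) by rewrite mulr_gt0// ltr_wpDl ?hnorm_ge0.
  have [N hN] := small_inv (divr_gt0 e0 x1).
  exists N => k n Nk Nn; apply: (le_trans (cq _ _ _)).
  have h := lerD (hN _ Nk) (hN _ Nn).
  apply: (le_trans (ler_wpM2r (hnorm_ge0 dot x) h)).
  have -> : (e / (2 * (hnorm dot x + 1)) + e / (2 * (hnorm dot x + 1))) * hnorm dot x =
    e * (hnorm dot x / (hnorm dot x + 1)).
    by field; rewrite gt_eqF// ltr_wpDl ?hnorm_ge0.
  by rewrite ler_piMr ?(ltW e0)// ler_pdivrMr ?mul1r ?lerDl// ltr_wpDl ?hnorm_ge0.
have Bq n x : hnorm dot (op_poly (q n) A x - B x) <= 2 * n.+1%:R^-1 * hnorm dot x.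
  apply/ler_addgt0Pr => e e0.
  have [N hN] := hB x e e0.
  pose k := maxn N n.
  have -> : op_poly (q n) A x - B x = (op_poly (q n) A x - op_poly (q k) A x) +
    (op_poly (q k) A x - B x) by rewrite addrA subrK.
  apply: (le_trans (hnormD _ _ _)); apply: lerD; last by apply: hN; rewrite leq_maxl.
  apply: (le_trans (cq _ _ _)); rewrite ler_wpM2r ?hnorm_ge0// mulr_natl mulr2n lerD2l.
  by rewrite lef_pV2 ?posrE// ler_nat ltnS leq_maxr.
exists B, q; split=> [|n]; last by split=> //; exact: hq.
move=> a x y; apply/eqP; rewrite -subr_eq0; apply/eqP/(@hnorm_eq0 _ _ dot).
apply/eqP; rewrite eq_le hnorm_ge0 andbT; apply/ler_addgt0Pr => e e0; rewrite add0r.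
pose K := 2 * (hnorm dot (a *: x + y) + cmod a * hnorm dot x + hnorm dot y) + 1.
have s0 : 0 <= 2 * (hnorm dot (a *: x + y) + cmod a * hnorm dot x + hnorm dot y).
  by rewrite mulr_ge0 ?addr_ge0 ?mulr_ge0 ?cmod_ge0 ?hnorm_ge0.
have K0 : 0 < K by rewrite ltr_wpDl.
have [N hN] := small_inv (divr_gt0 e0 K0).
have -> : B (a *: x + y) - (a *: B x + B y) =
   - (op_poly (q N) A (a *: x + y) - B (a *: x + y)) +
   (a *: (op_poly (q N) A x - B x) + (op_poly (q N) A y - B y)).
  rewrite (op_poly_linear lA) scalerBr.
  set u := a *: op_poly _ _ _; set v := op_poly _ _ _.
  by rewrite opprB (addrACA u) -opprD subrKA.
apply: (le_trans (hnormD _ _ _)); rewrite hnormN.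
have h1 := Bq N (a *: x + y).
have h2 := le_trans (hnormD dot (a *: (op_poly (q N) A x - B x)) (op_poly (q N) A y - B y))
  (lerD (lexx _) (Bq N y)).
rewrite hnormZ in h2.
have h3 := ler_wpM2l (cmod_ge0 a) (Bq N x).
have : N.+1%:R^-1 * K <= e by rewrite -ler_pdivlMr//; exact: hN.
have : 0 <= N.+1%:R^-1 :> R by rewrite invr_ge0.
rewrite /K; move: h1 h2 h3; move: (N.+1%:R^-1) => i h1 h2 h3 i0 h4.
lra.
Qed.

(** [op_calc] chooses some operator in a set; [op_approx_exists] shows that the
    set is inhabited, and every member of it satisfies [op_approx]. *)
Lemma op_calcP f :
  (forall e, 0 < e -> exists q : {poly R}, forall s, 0 <= s <= m -> `|q.[s] - f s| <= e) ->
  op_approx f (op_calc f A).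
Proof.
move=> hf; rewrite /op_calc; set P := [set B | _].
have PP B : P B -> op_approx f B.
  move=> [bB [q [qf qB]]]; have lB : linear B by case: bB.
  split=> // e e0.
  have [N1 h1] := (uniform_cvgP _ _ _).1 qf e e0.
  move/cvgrPdist_le : qB => /(_ _ e0)[N2 _ h2].
  pose n := maxn N1 N2; exists (q n); split; first by apply: h1; rewrite leq_maxl.
  have := h2 n (leq_maxr _ _); rewrite /= sub0r normrN => h3 x.
  have lD : linear (op_poly (q n) A - B).
    move=> a u v; rewrite /= (_ : forall z, (op_poly (q n) A - B) z = op_poly (q n) A z - B z)//.
    by rewrite (op_poly_linear lA) lB opprD scalerBr addrACA.
  have [c0 c0' [_ hc0]] := op_approx_bounded (op_approx_poly (q n)).
  have [_ [c c0'' hc]] := (bounded_opP B).1 bB.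
  have hD : bounded_by dot dot (c0 + c) (op_poly (q n) A - B).
    move=> y; apply: (le_trans (hnormD _ _ _)); rewrite hnormN mulrDl.
    by rewrite lerD.
  have [h4 /andP[h5 _]] := bounded_by_op_norm (addr_ge0 c0' c0'') hD lD.
  apply: (le_trans (h4 x)); rewrite ler_wpM2r ?hnorm_ge0//.
  by rewrite ger0_norm in h3.
apply: PP; apply: xgetPex.
have [B [q [lB hq]]] := op_approx_exists hf.
have Bf : op_approx f B.
  split=> // e e0; have [N hN] := small_inv (divr_gt0 e0 (ltr0Sn R 1)).
  have k1 := hN _ (leqnn N).
  exists (q N); split=> [s sm|x].
    by apply: (le_trans ((hq N).1 s sm)); move: k1 e0; move: (N.+1%:R^-1) => i; lra.
  by apply: (le_trans ((hq N).2 x)); rewrite ler_wpM2r ?hnorm_ge0//; move: k1; move: (N.+1%:R^-1) => i; lra.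
exists B; split; first exact: op_approx_bounded_op Bf.
exists q; split.
  apply/uniform_cvgP => e e0; have [N hN] := small_inv e0.
  exists N => n Nn s sm; apply: le_trans (hN n Nn); exact: (hq n).1.
apply/cvgrPdist_le => e e0; have [N hN] := small_inv (divr_gt0 e0 (ltr0Sn R 1)).
exists N => // n /= Nn; rewrite sub0r normrN.
have lD : linear (op_poly (q n) A - B).
  move=> a u v; rewrite /= (_ : forall z, (op_poly (q n) A - B) z = op_poly (q n) A z - B z)//.
  by rewrite (op_poly_linear lA) lB opprD scalerBr addrACA.
have i0 : 0 <= 2 * (n.+1%:R)^-1 :> R by rewrite mulr_ge0 ?invr_ge0.
have [_ /andP[h5 h6]] := bounded_by_op_norm i0 (hq n).2 lD.
rewrite ger0_norm//; apply: (le_trans h6); have := hN n Nn; move: (n.+1%:R^-1) => i; lra.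
Qed.

End PositiveOperator.

(** * Powers, adjoints and square roots *)

Section Powers.
Context {R : realType} {H : hilbertType R}.
Local Notation dot := (@dotH R H).
Context (A : H -> H) (PA : positive_op A).
Let m := op_norm A.
Let m0 : 0 <= m. Proof. exact: (op_norm_bounded PA.1).2. Qed.
Let m1 : 0 < m + 1. Proof. by rewrite ltr_wpDl. Qed.
Let mle s : 0 <= s <= m -> 0 <= s <= m + 1.
Proof. by move=> /andP[-> h]; rewrite (le_trans h)// lerDl. Qed.

Lemma op_pow_approx t : 0 <= t -> op_approx A (fun s => s `^ t) (op_pow A t).
Proof.
move=> t0; apply: op_calcP => // e e0.
have [q hq] := bernstein_approx m1 (powR_unif_continuous t0 m1)
  (ex_intro _ _ (powR_bounded t0)) e0.
by exists q => s sm; apply: hq; exact: mle.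
Qed.

Lemma op_pow_bounded t : 0 <= t -> bounded_op (op_pow A t).
Proof. by move=> t0; exact: op_approx_bounded_op (op_pow_approx t0). Qed.

Lemma op_pow_linear t : 0 <= t -> linear (op_pow A t).
Proof. by move=> /op_pow_bounded[]. Qed.

Lemma op_pow_selfadjoint t : 0 <= t -> selfadjoint dot (op_pow A t).
Proof. by move=> t0; exact: op_approx_selfadjoint (op_pow_approx t0). Qed.

Lemma op_pow0 : op_pow A 0 = id.
Proof.
have := op_approx_poly PA 1%:P; rewrite (_ : op_poly _ _ = id); last first.
  by apply/funext => x; rewrite op_polyC scale1r.
move=> h; apply: (op_approx_uniq PA (op_pow_approx (lexx 0)) h) => s _.
by rewrite hornerC powRr0.
Qed.

Lemma op_pow1 : op_pow A 1 = A.
Proof.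
have := op_approx_poly PA 'X; rewrite (_ : op_poly _ _ = A); last first.
  by apply/funext => x; rewrite op_polyX//; case: PA => [[]].
move=> h; apply: (op_approx_uniq PA (op_pow_approx ler01) h) => s /andP[s0 _].
by rewrite hornerX powRr1.
Qed.

Lemma op_powD a b : 0 <= a -> 0 <= b -> op_pow A (a + b) = op_pow A a \o op_pow A b.
Proof.
move=> a0 b0; have ab := op_approx_mul PA (op_pow_approx a0) (op_pow_approx b0).
apply: (op_approx_uniq PA (op_pow_approx (addr_ge0 a0 b0)) ab) => s /andP[s0 _].
have [->|bn] := eqVneq b 0; first by rewrite addr0 powRr0 mulr1.
by rewrite powRD// gt_eqF// ltr_wpDl// lt_def bn.
Qed.

Lemma op_pow_comp a b c x : 0 <= a -> 0 <= b -> a + b = c ->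
  op_pow A a (op_pow A b x) = op_pow A c x.
Proof. by move=> a0 b0 <-; rewrite op_powD. Qed.

Lemma op_pow_positive t : 0 <= t -> positive_op (op_pow A t).
Proof.
move=> t0; split; first exact: op_pow_bounded.
move=> x; have h := op_approx_ge0 PA x (op_pow_approx t0) (fun s _ => powR_ge0 s t).
rewrite lecE /= h andbT.
have := op_pow_selfadjoint t0 x x; rewrite (dotC _ x) => e.
have : dot (op_pow A t x) x = Num.conj (dot (op_pow A t x) x) by rewrite {1}e.
case: (dot _ x) => a b [] hb; apply/eqP => /=; lra.
Qed.

(** The inverse of 1 + A^(2t) is g(A) with g(s) = 1 / (1 + s^(2t)), which is as
    uniformly continuous as s^t because 1 / (1 + a^2) is 1-Lipschitz in a. *)
Lemma op_pow_resolvent t : 0 <= t -> exists2 c, 0 <= c &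
  exists S, resolvent_pair dot c (op_pow A t) S.
Proof.
move=> t0; have tA := op_pow_approx t0.
have [c c0 [_ bQ]] := op_approx_bounded PA tA.
exists c => //.
pose g (s : R) := (1 + s `^ t * s `^ t)^-1.
have d1 s : 1 <= 1 + s `^ t * s `^ t by rewrite lerDl mulr_ge0 ?powR_ge0.
have d0 s : 0 < 1 + s `^ t * s `^ t by exact: lt_le_trans (d1 s).
have gS : op_approx A g (op_calc g A).
  apply: op_calcP => // e e0.
  have [||q hq] := @bernstein_approx R g (m + 1) m1 _ _ e e0.
  - move=> e' e'0; have [d dp hd] := powR_unif_continuous t0 m1 e'0.
    exists d => // x y hx hy xy; apply: le_trans (hd x y hx hy xy).
    rewrite /g; set a := x `^ t; set b := y `^ t.
    have a0 : 0 <= a by exact: powR_ge0.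
    have b0 : 0 <= b by exact: powR_ge0.
    have pa := d0 x; have pb := d0 y; rewrite -/a -/b in pa pb.
    have -> : (1 + a * a)^-1 - (1 + b * b)^-1 =
        (b - a) * ((a + b) / ((1 + a * a) * (1 + b * b))).
      by field; rewrite !gt_eqF.
    rewrite normrM distrC ler_piMr// ger0_norm ?divr_ge0 ?addr_ge0 ?mulr_ge0 ?(ltW pa) ?(ltW pb)//.
    rewrite ler_pdivrMr ?mulr_gt0// mul1r.
    have := mulr_ge0 (sqr_ge0 a) (sqr_ge0 b).
    have := sqr_ge0 (a - 1 / 2); have := sqr_ge0 (b - 1 / 2).
    rewrite !expr2; lra.
  - exists 1 => x _; rewrite /g ger0_norm ?invr_ge0 ?(ltW (d0 x))//.
    by rewrite invf_le1.
  by exists q => s sm; apply: hq; exact: mle.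
exists (op_calc g A); split.
- exact: op_pow_linear.
- by case: gS.
- exact: op_pow_selfadjoint.
- exact: op_approx_selfadjoint gS.
- split=> // x.
  + have h1 := op_approx_mul PA tA gS; have h2 := op_approx_mul PA gS tA.
    exact: (congr1 (fun F => F x) (op_approx_uniq PA h1 h2 (fun s _ => mulrC _ _))).
  + have h := op_approx_comb 1 gS (op_approx_mul PA tA (op_approx_mul PA tA gS)).
    have h0 := op_pow_approx (lexx 0).
    have hu : (fun x => op_calc g A x + 1%:C%C *:
        (op_pow A t \o (op_pow A t \o op_calc g A)) x) = op_pow A 0.
      apply: (op_approx_uniq PA h h0) => s _; rewrite /g mul1r powRr0 mulrA -{1}[_^-1]mul1r -mulrDl divff// gt_eqF//.
    by move/(congr1 (fun F => F x)): hu; rewrite op_pow0 /= scale1r.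
Qed.

(** The tangent inequality at c = <Au, u> holds between functions on the
    spectrum, hence between operators; evaluate it at u. *)
Lemma op_pow_jensen p u : 1 <= p -> sqn dot u <= 1 ->
  (complex.Re (dot (A u) u)) `^ p <= complex.Re (dot (op_pow A p u) u).
Proof.
move=> p1 u1; have p0 := le_trans ler01 p1.
pose c := complex.Re (dot (A u) u).
have c0 : 0 <= c by exact: positive_Re_ge0.
have h1 := op_approx_comb (- (p * c `^ (p - 1))) (op_pow_approx p0) (op_pow_approx ler01).
have h2 := op_approx_comb ((p - 1) * c `^ p) h1 (op_pow_approx (lexx 0)).
have := op_approx_ge0 PA u h2; rewrite op_pow0 op_pow1 => /(_ _)/wrap[].
  move=> s /andP[s0 _]; rewrite powRr0 mulr1 powRr1//.
  have := powR_tangent p1 s0 c0; lra.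
rewrite !dotDl !dotZl !ReD !Re_real_mul -/c -/(sqn dot u) => h.
have h3 : c * c `^ (p - 1) = c `^ p by rewrite mulr_powRB1// (lt_le_trans ltr01).
have h4 : (p - 1) * c `^ p * sqn dot u <= (p - 1) * c `^ p.
  by rewrite ler_piMr// mulr_ge0 ?subr_ge0 ?powR_ge0.
have h5 : p * c `^ (p - 1) * c = p * c `^ p by rewrite -h3; ring.
lra.
Qed.

End Powers.

Section Adjoint.
Context {R : realType} {H : hilbertType R}.
Local Notation dot := (@dotH R H).

(** [op_sqrt] chooses among the positive square roots of B, and B^(1/2) is
    one. *)
Lemma op_sqrtP (B : H -> H) : positive_op B ->
  positive_op (op_sqrt B) /\ op_sqrt B \o op_sqrt B = B.
Proof.
move=> PB; rewrite /op_sqrt; set P := [set C | _]; suff : P (xget 0 P) by [].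
apply: xgetPex; exists (op_pow B 2^-1).
have h : 0 <= (2^-1 : R) by rewrite invr_ge0.
split; first exact: op_pow_positive.
by rewrite -op_powD// -[in RHS](op_pow1 PB); congr (op_pow B _); field.
Qed.

(** In this form the identity shows that nearly nearest points a and b to x are
    close to each other when their midpoint is not much nearer. *)
Lemma parallelogram (x a b : H) :
  sqn dot (a - b) = 2 * sqn dot (x - a) + 2 * sqn dot (x - b)
    - 4 * sqn dot (x - (2^-1)%:C%C *: (a + b)).
Proof.
have -> : x - (2^-1)%:C%C *: (a + b) = (2^-1)%:C%C *: ((x - a) + (x - b)).
  have {1}-> : x = (2^-1)%:C%C *: (x + x).
    rewrite scalerDr -scalerDl -rmorphD /= (_ : 2^-1 + 2^-1 = 1) ?scale1r//.
    by field.
  by rewrite -scalerBr opprD addrACA.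
have -> : a - b = (x - b) - (x - a) by rewrite opprB [RHS]addrC subrKA.
rewrite sqnZ cmod_real ger0_norm ?invr_ge0// sqnB (sqnD _ (x - a)).
by rewrite (dotC _ (x - b)) Re_conj; field.
Qed.

(** A minimizing sequence is Cauchy by the parallelogram identity. As C will be
    the span of an orthonormal basis, or an affine hyperplane, C is not required
    to be closed, and z is a point of its closure. *)
Lemma nearest_point (C : set H) x : (C !=set0)%classic ->
  (forall a b, C a -> C b -> C ((2^-1)%:C%C *: (a + b))) ->
  exists z, (forall e, 0 < e -> exists2 c, C c & hnorm dot (c - z) <= e) /\
    forall c, C c -> hnorm dot (x - z) <= hnorm dot (x - c).
Proof.
move=> [c0 Cc0] mid.
pose V := [set sqn dot (x - c) | c in C]%classic.
have Vlb : lbound V 0 by move=> _ [c _ <-]; exact: sqn_ge0.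
have Vinf : has_inf V by split; [exists (sqn dot (x - c0)), c0 | exists 0].
have dle c : C c -> inf V <= sqn dot (x - c).
  by move=> Cc; apply: ge_inf; [exists 0 | exists c].
have /choice[u hu] : forall n : nat, exists c, C c /\ sqn dot (x - c) <= inf V + n.+1%:R^-1.
  move=> n; have [|_ [c Cc <-] h] := @inf_adherent _ V n.+1%:R^-1 _ Vinf.
    by rewrite invr_gt0.
  by exists c; split=> //; exact: ltW.
have cu m n : sqn dot (u m - u n) <= 2 * (m.+1%:R^-1 + n.+1%:R^-1).
  rewrite (parallelogram x).
  have := dle _ (mid _ _ (hu m).1 (hu n).1); have := (hu m).2; have := (hu n).2.
  move: (m.+1%:R^-1) (n.+1%:R^-1) => i j; lra.
have [e e0|z hz] := hilbert_complete (u := u).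
  have [N hN] := small_inv (divr_gt0 (exprn_gt0 2 e0) (ltr0Sn R 3)).
  exists N => k n Nk Nn.
  rewrite -(@ler_pXn2r _ 2)// ?nnegrE ?hnorm_ge0 ?(ltW e0)// hnorm_sqr.
  apply: (le_trans (cu k n)); have := hN _ Nk; have := hN _ Nn.
  move: (k.+1%:R^-1) (n.+1%:R^-1) => i j; lra.
exists z; split=> [e e0|c Cc].
  by have [N hN] := hz e e0; exists (u N); [exact: (hu N).1 | exact: hN].
apply/ler_addgt0Pr => e e0; have e2 : 0 < e / 2 by rewrite divr_gt0.
have [N1 h1] := hz _ e2; have [N2 h2] := small_inv (exprn_gt0 2 e2).
pose n := maxn N1 N2.
have -> : x - z = (x - u n) + (u n - z) by rewrite addrA subrK.
apply: (le_trans (hnormD _ _ _)).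
have k1 := h1 n (leq_maxl _ _); have k2 := h2 n (leq_maxr _ _).
suff : hnorm dot (x - u n) <= hnorm dot (x - c) + e / 2 by lra.
have e3 := ltW e2.
rewrite -(@ler_pXn2r _ 2)// ?nnegrE ?addr_ge0 ?hnorm_ge0//.
rewrite hnorm_sqr sqrrD hnorm_sqr.
have := (hu n).2; have := dle _ Cc; move: k2; move: (n.+1%:R^-1) => i.
have : 0 <= hnorm dot (x - c) * (e / 2) by rewrite mulr_ge0 ?hnorm_ge0.
rewrite -mulr_natl; lra.
Qed.

Lemma minimal_orthogonal (w k : H) :
  (forall t : R[i], hnorm dot w <= hnorm dot (w - t *: k)) -> dot w k = 0.
Proof.
move=> wk; have [k0|kn0] := eqVneq (sqn dot k) 0.
  by rewrite (sqn_eq0 k0) dot0r.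
have k0 : 0 < sqn dot k by rewrite lt_def kn0 sqn_ge0.
have := wk (dot w k * (sqn dot k)^-1%:C%C); rewrite -sqn_le_hnorm.
rewrite sqnB sqnZ dotZr.
have -> : Num.conj (dot w k * (sqn dot k)^-1%:C%C) * dot w k =
    (cmod (dot w k) ^+ 2 / sqn dot k)%:C%C.
  rewrite rmorphM /= conj_real [RHS]rmorphM /= cmod_sqr; ring.
rewrite cmodM cmod_real ger0_norm ?invr_ge0 ?sqn_ge0// [complex.Re _%:C%C]/=.
have -> : (cmod (dot w k) / sqn dot k) ^+ 2 * sqn dot k = cmod (dot w k) ^+ 2 / sqn dot k.
  by field.
set a := _ / _ => h; have a0 : a <= 0 by lra.
apply: cmod_eq0; apply/eqP; rewrite -[_ == 0](@sqrf_eq0 R) eq_le sqr_ge0 andbT.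
by move: a0; rewrite /a ler_pdivrMr// mul0r.
Qed.

(** The point z of smallest norm on the hyperplane f = 1 is orthogonal to the
    kernel of f, so that x - f(x) z is orthogonal to z. *)
Lemma riesz_representation (f : H -> R[i]) (M : R) : 0 <= M ->
  (forall a x y, f (a *: x + y) = a * f x + f y) ->
  (forall x, cmod (f x) <= M * hnorm dot x) ->
  exists y, forall x, f x = dot x y.
Proof.
move=> M0 lf fM.
have f0 : f 0 = 0 by have := lf (-1) 0 0; rewrite scaler0 addr0 mulN1r addNr.
have fZ a x : f (a *: x) = a * f x by have := lf a x 0; rewrite !addr0 f0 addr0.
have fD x y : f (x + y) = f x + f y by have := lf 1 x y; rewrite scale1r mul1r.
have fN x : f (- x) = - f x by rewrite -scaleN1r fZ mulN1r.
have [[x0 fx0]|nf] := pselect (exists x, f x != 0); last first.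
  exists 0 => x; rewrite dot0r; apply/eqP/negPn/negP => fx; apply: nf; by exists x.
pose C := [set x | f x = 1]%classic.
have C0 : (C !=set0)%classic by exists ((f x0)^-1 *: x0); rewrite /C /= fZ mulVf.
have mid a b : C a -> C b -> C ((2^-1)%:C%C *: (a + b)).
  rewrite /C /= fZ fD => -> ->; rewrite fmorphV (rmorph_nat (real_complex R)).
  by rewrite -(natrD _ 1 1) mulVf// pnatr_eq0.
have [z [zC zmin]] := nearest_point 0 C0 mid.
have fz : f z = 1.
  apply/eqP; rewrite -subr_eq0; apply/eqP/cmod_eq0/eqP.
  rewrite eq_le cmod_ge0 andbT; apply/ler_addgt0Pr => e e0; rewrite add0r.
  have M1 : 0 < M + 1 by rewrite ltr_wpDl.
  have [c cC hc] := zC _ (divr_gt0 e0 M1).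
  rewrite -cC -fN -fD; apply: (le_trans (fM _)).
  rewrite -hnormN opprB.
  apply: (@le_trans _ _ ((M + 1) * (e / (M + 1)))); last first.
    by rewrite mulrCA divff ?mulr1// gt_eqF.
  by apply: ler_pM; rewrite ?hnorm_ge0// lerDl.
have zk k : f k = 0 -> dot z k = 0.
  move=> fk; apply: minimal_orthogonal => t.
  have := zmin (z - t *: k); rewrite !sub0r !hnormN; apply.
  by rewrite /C /= fD fN fZ fk mulr0 oppr0 addr0.
have z0 : sqn dot z != 0.
  apply/eqP => /sqn_eq0 z0; move: fz; rewrite z0 f0 => /eqP.
  by rewrite eq_sym oner_eq0.
exists ((sqn dot z)^-1%:C%C *: z) => x.
have := zk (x - f x *: z); rewrite fD fN fZ fz mulr1 subrr => /(_ erefl).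
rewrite dotBr dotZr => /eqP; rewrite subr_eq0 => /eqP zx.
rewrite dotZr conj_real dotC zx sqnE (rmorphM (@Num.conj R[i])) /= conjCK. rewrite conj_real.
by rewrite mulrCA -rmorphM mulVf// rmorph1 mulr1.
Qed.

(** [adj] chooses among the bounded adjoints of A; the Riesz representation of
    the functionals x |-> <Ax, y> shows that there is one. *)
Lemma adjP (A : H -> H) : bounded_op A ->
  bounded_op (adj A) /\ forall x y, dot (A x) y = dot x (adj A y).
Proof.
move=> bA; rewrite /adj; set P := [set B | _]; suff : P (xget 0 P) by [].
apply: xgetPex; have [lA [M M0 AM]] := (bounded_opP A).1 bA.
have /choice[B AB] : forall y, exists z, forall x, dot (A x) y = dot x z.
  move=> y; apply: (@riesz_representation _ (M * hnorm dot y)).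
  - by rewrite mulr_ge0 ?hnorm_ge0.
  - by move=> a x x'; rewrite lA dotDl dotZl.
  - move=> x; apply: (le_trans (cauchy_schwarz_hnorm _ _ _)).
    by rewrite mulrAC ler_wpM2r ?hnorm_ge0.
have nondeg u v : (forall x, dot x u = dot x v) -> u = v.
  move=> h; apply/eqP; rewrite -subr_eq0; apply/eqP/(@sqn_eq0 _ _ dot).
  by rewrite /sqn dotBr h subrr.
exists B; split; last by move=> x y; exact: AB.
apply/bounded_opP; split.
  move=> a x y; apply: nondeg => z.
  by rewrite -AB !dotDr !dotZr !AB.
exists M => // y; have [B0|Bn0] := eqVneq (B y) 0.
  by rewrite B0 hnorm0 mulr_ge0 ?hnorm_ge0.
have B0 : 0 < hnorm dot (B y).
  by rewrite lt_def hnorm_ge0 andbT; apply: contra_neq Bn0 => /hnorm_eq0.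
rewrite -(ler_pM2l B0) -expr2 hnorm_sqr /sqn -AB.
apply: (le_trans (Re_le_cmod _)); apply: (le_trans (cauchy_schwarz_hnorm _ _ _)).
rewrite mulrA ler_wpM2r ?hnorm_ge0// mulrC; exact: AM.
Qed.

End Adjoint.

(** * Orthonormal bases and the trace *)

Section OrthonormalBasis.
Context {R : realType} {H : hilbertType R}.
Local Notation dot := (@dotH R H).
Implicit Types (S : set H) (x y : H).

(** A maximal orthonormal set, by Zorn's lemma, is a basis: a nonzero vector
    orthogonal to it could be normalized and added. *)
Lemma some_onbP : orthonormal_basis (@some_onb R H).
Proof.
apply: xgetPex.
pose P S := forall x y : H, S x -> S y -> dot x y = (x == y)%:R.
have [F FP totF|S [PS Smax]] := @Zorn_bigcup H P.
  move=> x y [X FX Xx] [Y FY Yy].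
  by have [XY|YX] := totF _ _ FX FY;
    [apply: (FP Y) => //; exact: XY | apply: (FP X) => //; exact: YX].
exists S; split=> // x xS; apply: contrapT => /eqP x0.
pose v := normalized dot x.
have vv : dot v v = 1 by rewrite sqnE -hnorm_sqr hnorm_normalized// expr1n.
have vS e : S e -> dot v e = 0 by move=> Se; rewrite dotZl xS// mulr0.
have nSv : ~ S v.
  by move=> Sv; have := vS _ Sv; rewrite vv => /eqP; rewrite oner_eq0.
apply: (Smax (S `|` [set v])).
  split; first by move=> y Sy; left.
  by move=> Sv; apply: nSv; apply: Sv; right.
have ne y : S y -> (v == y) = false.
  by move=> Sy; apply/eqP => vy; apply: nSv; rewrite vy.
move=> y z [Sy|->] [Sz|->].
- exact: PS.
- by rewrite dotC vS// rmorph0 eq_sym ne.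
- by rewrite vS// ne.
- by rewrite vv eqxx.
Qed.

Definition finite_span S : set H := [set c | exists2 r : seq (R[i] * H),
  (forall k, k \in r -> S k.2) & c = \sum_(k <- r) k.1 *: k.2].

(** The point of the closed span nearest to x differs from x by a vector that is
    orthogonal to the basis, hence zero. *)
Lemma finite_span_dense S x : orthonormal_basis S ->
  forall e, 0 < e -> exists2 c, finite_span S c & hnorm dot (x - c) <= e.
Proof.
move=> [_ Sx].
have C0 : (finite_span S !=set0)%classic by exists 0, [::]; rewrite ?big_nil.
have mid a b : finite_span S a -> finite_span S b ->
    finite_span S ((2^-1)%:C%C *: (a + b)).
  move=> [r rS ->] [r' rS' ->].
  exists [seq ((2^-1)%:C%C * k.1, k.2) | k <- r ++ r'].
    move=> _ /mapP[k + ->] /=; rewrite mem_cat => /orP[|]; [exact: rS|exact: rS'].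
  rewrite big_map big_cat /= scalerDr !scaler_sumr.
  by congr (_ + _); apply: eq_bigr => k _; rewrite scalerA.
have [z [zC zmin]] := nearest_point x C0 mid.
suff xz : x = z.
  by move=> e /zC[c Cc h]; exists c => //; rewrite xz -hnormN opprB.
apply/eqP; rewrite -subr_eq0; apply/eqP; apply: Sx => v Sv.
apply: minimal_orthogonal => t; apply/ler_addgt0Pr => e /zC[c [r rS cE] ce].
have /zmin : finite_span S (c + t *: v).
  exists ((t, v) :: r); last by rewrite big_cons cE addrC.
  by move=> k; rewrite inE => /orP[/eqP -> //|/rS].
move=> /le_trans; apply.
have -> : x - (c + t *: v) = (x - z - t *: v) - (c - z).
  by rewrite opprB (addrAC x) subrKA opprD addrA addrAC.
by apply: (le_trans (hnormD _ _ _)); rewrite hnormN lerD2l.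
Qed.

(** Take c within sqrt e of x in the span of finitely many basis vectors: the
    projection of x onto that span is at least as close to x as c is. *)
Lemma parseval_le S x : orthonormal_basis S ->
  ((sqn dot x)%:E <= \esum_(e in S) ((cmod (dot x e)) ^+ 2)%:E)%E.
Proof.
move=> oS; apply/lee_addgt0Pr => e e0.
have s0 : 0 < Num.sqrt e by rewrite sqrtr_gt0.
have [c [r rS cE] xc] := finite_span_dense x oS s0.
pose w := undup [seq k.2 | k <- r].
pose u (k : 'I_(size w)) := tnth (in_tuple w) k.
have wS v : v \in w -> S v by rewrite mem_undup => /mapP[k kr ->]; exact: rS.
have uw k : u k \in w by exact: mem_tnth.
have ou : orthonormal_fam dot u.
  move=> k l; rewrite oS.1; [|exact: wS|exact: wS].
  by rewrite /u !(tnth_nth 0) /= nth_uniq ?undup_uniq.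
have cu : fam_spans dot u c.
  have spu a v : v \in w -> fam_spans dot u (a *: v).
    move=> vw; have vi : (index v w < size w)%N by rewrite index_mem.
    have -> : v = u (Ordinal vi) by rewrite /u (tnth_nth 0) /= nth_index.
    rewrite /fam_spans (bigD1 (Ordinal vi))//= dotZl ou eqxx mulr1 big1 ?addr0//.
    by move=> l /negbTE kl; rewrite dotZl ou eq_sym kl mulr0 scale0r.
  rewrite cE big_seq; elim/big_ind: _ => [|a b ua ub|k kr].
  - by rewrite /fam_spans big1// => k _; rewrite dot0l scale0r.
  - rewrite /fam_spans {1}ua {1}ub -big_split /=; apply: eq_bigr => k _.
    by rewrite dotDl scalerDl.
  - by apply: spu; rewrite mem_undup; apply/mapP; exists k.
have le : sqn dot x - \sum_k (cmod (dot x (u k))) ^+ 2 <= sqn dot (x - c).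
  have -> : x - c = (x - \sum_k dot x (u k) *: u k) +
      \sum_k (dot x (u k) - dot c (u k)) *: u k.
    have -> : \sum_k (dot x (u k) - dot c (u k)) *: u k =
        \sum_k dot x (u k) *: u k - c.
      by rewrite {2}cu -sumrB; apply: eq_bigr => k _; rewrite scalerBl.
    by rewrite addrA subrK.
  rewrite sqnD; have -> : dot (x - \sum_k dot x (u k) *: u k)
      (\sum_k (dot x (u k) - dot c (u k)) *: u k) = 0.
    rewrite dot_sumr big1// => k _.
    by rewrite dotZr dotBl dot_fam_sum// subrr mulr0.
  rewrite sqn_residual//.
  by rewrite [complex.Re 0]/= mulr0 addr0 lerDl sqn_ge0.
have xc2 : sqn dot (x - c) <= e.
  rewrite -hnorm_sqr -[leRHS]sqr_sqrtr ?(ltW e0)//.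
  by rewrite ler_pXn2r ?nnegrE ?hnorm_ge0 ?sqrtr_ge0.
apply: (@le_trans _ _ ((\sum_k (cmod (dot x (u k))) ^+ 2)%:E + e%:E)%E).
  by rewrite -EFinD lee_fin; lra.
apply: leeD => //; apply: esum_ge; exists [set` w].
  by split; [exact: finite_seq | move=> v /wS].
rewrite -fsbig_seq ?undup_uniq// (big_tnth _ _ w) sumEFin lee_fin.
exact: lexx.
Qed.

(** For Q = Q2^2 both sides are double sums of the |<Q2 u_k, e>|^2: Parseval's
    inequality for Q2 u_k in the basis, and Bessel's inequality for Q2 e in
    the family u. *)
Lemma le_op_trace (Q Q2 : H -> H) (I : finType) (u : I -> H) :
  selfadjoint dot Q2 -> Q = Q2 \o Q2 -> suborthonormal_fam dot u ->
  ((\sum_k complex.Re (dot (Q (u k)) (u k)))%:E <= op_trace Q)%E.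
Proof.
move=> sQ -> ou; rewrite /op_trace.
have QE e : complex.Re (dot ((Q2 \o Q2) e) e) = sqn dot (Q2 e) by rewrite /= sQ.
under eq_bigr => k _ do rewrite QE.
under eq_esum => e _ do rewrite QE.
apply: (@le_trans _ _ (\sum_k \esum_(e in @some_onb R H)
    ((cmod (dot (Q2 (u k)) e)) ^+ 2)%:E)%E).
  rewrite -sumEFin; apply: lee_sum => k _; exact: parseval_le some_onbP.
rewrite -esum_sum; last by move=> *; rewrite lee_fin sqr_ge0.
apply: le_esum => e _; rewrite sumEFin lee_fin.
under eq_bigr => k _ do rewrite sQ cmod_dotC.
exact: bessel.
Qed.

End OrthonormalBasis.

(** * Test norms and the trace of the modulus *)

Section ColumnSpace.
Context {R : realType} {H : hilbertType R} {d : nat}.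
Local Notation dot := (@dotH R H).
Local Notation K := ('I_d -> H).

Definition column_dot (x y : K) : R[i] := \sum_i dot (x i) (y i).

Lemma column_dot_bilinear : bilinear_for
  (GRing.Scale.Law.clone _ _ ( *%R ) _)
  (GRing.Scale.Law.clone _ _ (Num.conj \; *%R) _) column_dot.
Proof.
split=> y a u v; rewrite /column_dot /= mulr_sumr -big_split /=; apply: eq_bigr => i _.
- by rewrite -dotZl -dotDl.
- by rewrite -dotZr -dotDr.
Qed.

HB.instance Definition _ := bilinear_isBilinear.Build R[i] K K R[i] _ _ column_dot
  column_dot_bilinear.

Lemma column_dot_hermitian (x y : K) : column_dot x y = (-1) ^+ false * Num.conj (column_dot y x).
Proof.
rewrite expr0 mul1r /column_dot rmorph_sum; apply: eq_bigr => i _; exact: dotC.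
Qed.

HB.instance Definition _ := isHermitianSesquilinear.Build R[i] K false
  (@Num.conj R[i]) column_dot column_dot_hermitian.

Lemma column_dot_gt0 (x : K) : x != 0 -> 0 < column_dot x x.
Proof.
move=> x0; have [i xi] : exists i, x i != 0.
  apply: contrapT => /forallNP h; move/eqP: x0; apply.
  by apply/funext => i; apply/eqP/negPn/negP/h.
rewrite /column_dot (bigD1 i)//= ltr_pwDl ?dnorm_gt0//.
by apply: sumr_ge0 => j _; exact: dnorm_ge0.
Qed.

HB.instance Definition _ := isDotProduct.Build R[i] K column_dot column_dot_gt0.

(** The inner product of the d-fold Hilbert sum of H, as a bundled structure so
    that the results for inner product spaces apply to it. *)
Definition dotK : {dot K for @Num.conj R[i]} := column_dot.

Lemma dotKE x y : dotK x y = \sum_i dot (x i) (y i).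
Proof. by []. Qed.

End ColumnSpace.

Section Columns.
Context {R : realType} {H : hilbertType R} {d : nat}.
Local Notation dot := (@dotH R H).
Local Notation dotK := (@dotK R H d).
Implicit Types (T : 'I_d -> H -> H).

Definition column T (x : H) : 'I_d -> H := fun i => T i x.

Lemma sqn_dotK (x : 'I_d -> H) : sqn dotK x = \sum_i sqn dot (x i).
Proof. by rewrite /sqn dotKE Re_sum. Qed.

Lemma column_linear T : (forall i, linear (T i)) -> linear (column T).
Proof. by move=> lT a x y; apply/funext => i; exact: lT. Qed.

Lemma column_bounded T : (forall i, bounded_op (T i)) ->
  linear (column T) /\ exists2 M, 0 <= M & bounded_by dot dotK M (column T).
Proof.
move=> bT; have lT i : linear (T i) by case: (bT i).
split; first exact: column_linear.
have /choice[M hM] : forall i, exists M, 0 <= M /\ bounded_by dot dot M (T i).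
  by move=> i; have [_ [M M0 h]] := (bounded_opP _).1 (bT i); exists M.
exists (Num.sqrt (\sum_i M i ^+ 2)); first exact: sqrtr_ge0.
move=> x; rewrite -(@ler_pXn2r _ 2)// ?nnegrE ?mulr_ge0 ?hnorm_ge0 ?sqrtr_ge0//.
rewrite exprMn !hnorm_sqr sqr_sqrtr ?sumr_ge0//; last by move=> i _; exact: sqr_ge0.
rewrite sqn_dotK mulr_suml; apply: ler_sum => i _; have [M0 h] := hM i.
rewrite -!hnorm_sqr -exprMn ler_pXn2r ?nnegrE ?mulr_ge0 ?hnorm_ge0//; exact: h.
Qed.

Lemma sum_adjE T : (forall i, bounded_op (T i)) -> forall x y,
  dot ((\sum_(i < d) (adj (T i) \o T i)) x) y = dotK (column T x) (column T y).
Proof.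
move=> bT x y; rewrite fct_sumE dot_suml dotKE; apply: eq_bigr => i _ /=.
have [_ h] := adjP (bT i).
by rewrite dotC -h -dotC.
Qed.

Lemma sph_modP T : (forall i, bounded_op (T i)) ->
  positive_op (sph_mod T) /\
  forall x y, dot (sph_mod T (sph_mod T x)) y = dotK (column T x) (column T y).
Proof.
move=> bT; pose B := \sum_(i < d) (adj (T i) \o T i).
have PB : positive_op B.
  split; last by move=> x; rewrite sum_adjE// dnorm_ge0.
  apply/bounded_opP; split.
    move=> a x y; rewrite /B !fct_sumE scaler_sumr -big_split /=.
    apply: eq_bigr => i _; have [lT _] := bT i; have [[lA _] _] := adjP (bT i).
    by rewrite /= lT lA.
  have [lc [M M0 cM]] := column_bounded bT.
  exists (M ^+ 2); first exact: sqr_ge0.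
  move=> x; have [B0|Bn0] := eqVneq (B x) 0.
    by rewrite B0 hnorm0 mulr_ge0 ?sqr_ge0 ?hnorm_ge0.
  have h0 : 0 < hnorm dot (B x).
    by rewrite lt_def hnorm_ge0 andbT; apply: contra_neq Bn0 => /hnorm_eq0.
  rewrite -(ler_pM2r h0) -expr2 hnorm_sqr /sqn sum_adjE//.
  apply: (le_trans (Re_le_cmod _)); apply: (le_trans (cauchy_schwarz_hnorm _ _ _)).
  rewrite expr2; have := ler_pM (hnorm_ge0 _ _) (hnorm_ge0 _ _) (cM x) (cM (B x)).
  by move/le_trans; apply; rewrite mulrACA mulrA.
have [h1 h2] := op_sqrtP PB; split=> // x y.
by rewrite -sum_adjE// -/B -[in RHS]h2.
Qed.

End Columns.

Section TraceNorm.
Context {R : realType} {H : hilbertType R} {d : nat} (p : R) (p1 : 1 <= p).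
Local Notation dot := (@dotH R H).
Local Notation dotK := (@dotK R H d).
Let p0 : 0 < p. Proof. exact: lt_le_trans p1. Qed.
Implicit Types (T : 'I_d -> H -> H).

(** P^p will be approximated by polynomials in P^2, because
    <P^2 x, y> = <X x, X y> for the column X of T. *)
Lemma op_poly_sqr (A : H -> H) q x : linear A ->
  op_poly (q \Po 'X^2) A x = op_poly q (A \o A) x.
Proof.
move=> lA; have lA2 : linear (A \o A) by move=> a u v /=; rewrite !lA.
elim/poly_ind: q => [|q c IH]; first by rewrite comp_poly0 -polyC0 !op_polyC.
rewrite comp_polyD comp_polyM comp_polyX comp_polyC !op_polyD !op_polyC.
by rewrite expr2 mulrA !op_polyMX// IH.
Qed.

(** The test data u_k and v_k, the normalized X u_k, pair to |X u_k|. *)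
Lemma singular_pairing_le (X : H -> 'I_d -> H) N (u : 'I_N -> H) c :
  (forall n, test_norm dot dotK p n X <= c) ->
  (exists2 M, 0 <= M & bounded_by dot dotK M X) ->
  orthonormal_fam dot u -> (forall k l, k != l -> dotK (X (u k)) (X (u l)) = 0) ->
  \sum_k (hnorm dotK (X (u k))) `^ p <= c `^ p.
Proof.
move=> Xc [M M0 XM] ou oX.
pose v k := normalized dotK (X (u k)).
have ov : suborthonormal_fam dotK v by exact: normalized_suborthonormal.
pose e (k : 'I_N) (_ : 'I_1) := u k; pose f (k : 'I_N) (_ : 'I_1) := v k.
have data (U : lmodType R[i]) (dU : {dot U for @Num.conj R[i]}) (w : 'I_N -> U) :
    suborthonormal_fam dU w -> bessel_data dU (fun k (_ : 'I_1) => w k).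
  move=> ow; split=> [x|j]; last by rewrite big_ord1; exact: ow.2.
  by under eq_bigr do rewrite big_ord1; exact: bessel.
have he := data _ dot u (orthonormal_famW ou); have hf := data _ dotK v ov.
have h := test_norm_ub p1 M0 XM he hf.
have c0 : 0 <= c := le_trans (test_norm_ge0 p1 N M0 XM) (Xc N).
have tc : test_norm dot dotK p N X `^ p <= c `^ p.
  have t0 := test_norm_ge0 p1 N M0 XM; have tN := Xc N.
  by apply: (ge0_ler_powR (ltW p0)); rewrite ?nnegrE.
apply: le_trans tc; apply: le_trans h; rewrite /test_sum; apply: ler_sum => k _.
by rewrite big_ord1 dot_normalized cmod_real ger0_norm ?hnorm_ge0.
Qed.

(** Over finitely many vectors w of the basis, approximate P^p by q(P^2), where q
    is close to s^(p/2), and diagonalize q(P^2) on these vectors: up to small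
    errors, the sum of the <P^p w, w> is the sum over j of l_j^(p/2) times the
    sum of the |<u_j, w>|^2, hence at most the sum of the l_j^(p/2) = |X u_j|^p,
    where X is the column of T. *)
Lemma op_trace_le_test T c : (forall i, bounded_op (T i)) -> 0 <= c ->
  (forall n, test_norm dot dotK p n (column T) <= c) ->
  (op_trace (op_pow (sph_mod T) p) <= (c `^ p)%:E)%E.
Proof.
move=> bT c0 Tc; have [PA AT] := sph_modP bT; set A := sph_mod T in PA AT *.
have [[lA _] _] := PA; have [Am m0] := op_norm_bounded PA.1.
set m := op_norm A in Am m0.
pose B := A \o A.
have lB : linear B by move=> a x y; rewrite /B /= !lA.
have sA := positive_selfadjoint PA.
have sB : selfadjoint dot B by move=> x y; rewrite /B /= !sA.
have B0 x : 0 <= complex.Re (dot (B x) x) by rewrite /B /= AT -/(sqn dotK _) sqn_ge0.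
have M0 : 0 < m ^+ 2 + 1 by rewrite ltr_wpDl ?sqr_ge0.
have BM : bounded_by dot dot (m ^+ 2 + 1) B.
  move=> x; apply: (le_trans (Am _)); apply: (le_trans (ler_wpM2l m0 (Am x))).
  by rewrite mulrA -expr2 ler_wpM2r ?hnorm_ge0// lerDl.
have p20 : 0 <= p / 2 by rewrite divr_ge0// ltW.
apply: ge_ereal_sup => _ [F [/finite_seqP[r0 ->] FS]] <-.
pose r := undup r0; have -> : [set` r0] = [set` r].
  by apply/seteqP; split=> e /=; rewrite mem_undup.
rewrite -fsbig_seq ?undup_uniq//= sumEFin lee_fin.
have rS (e : H) : e \in r -> @some_onb R H e by rewrite mem_undup; exact: FS.
pose w (k : 'I_(size r)) := tnth (in_tuple r) k.
have ow : orthonormal_fam dot w.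
  move=> k l; rewrite some_onbP.1; [|exact/rS/mem_tnth|exact/rS/mem_tnth].
  by rewrite /w !(tnth_nth 0) /= nth_uniq ?undup_uniq.
rewrite (big_tnth _ _ r) /=.
apply/ler_addgt0Pr => e e0.
pose delta := e / (2 * ((size r)%:R + 1)).
have D0 : 0 < 2 * ((size r)%:R + 1) :> R by rewrite mulr_gt0// ltr_wpDl.
have delta0 : 0 < delta by rewrite divr_gt0.
have [q hq] := bernstein_approx M0 (powR_unif_continuous p20 M0)
  (ex_intro _ _ (powR_bounded p20)) delta0.
have sm s : 0 <= s <= m -> 0 <= s ^+ 2 <= m ^+ 2 + 1.
  move=> /andP[s0 s1]; rewrite sqr_ge0 (le_trans (_ : _ <= m ^+ 2)) ?lerDl//.
  by rewrite ler_pXn2r.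
have qA x : hnorm dot (op_poly q B x - op_pow A p x) <= delta * hnorm dot x.
  have h := op_approx_comb (-1) (op_approx_poly PA (q \Po 'X^2)) (op_pow_approx PA (ltW p0)).
  have := op_approx_norm PA (ltW delta0) h _ x; rewrite op_poly_sqr// rmorphN1 scaleN1r.
  apply=> s sm'; have s2 := sm s sm'.
  rewrite horner_comp hornerXn mulN1r.
  have -> : s `^ p = (s ^+ 2) `^ (p / 2).
    by move/andP: sm' => [s0 _]; rewrite -powR_mulrn// -powRrM; congr (_ `^ _); field.
  exact: hq.
have [N [u [l [ou lM lE oB us]]]] := op_poly_spectral lB sB BM B0 r (size q).
have lX k : l k = sqn dotK (column T (u k)) by rewrite -lE /B /= AT.
have oX k k' : k != k' -> dotK (column T (u k)) (column T (u k')) = 0.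
  by move=> kk; rewrite -AT; exact: oB.
have main := singular_pairing_le Tc (column_bounded bT).2 ou oX.
have lp k : (l k) `^ (p / 2) = (hnorm dotK (column T (u k))) `^ p.
  by rewrite lX -hnorm_sqr -powR_mulrn ?hnorm_ge0// -powRrM; congr (_ `^ _); field.
have w1 k : sqn dot (w k) = 1 by rewrite /sqn ow eqxx.
have est k : complex.Re (dot (op_pow A p (w k)) (w k)) <=
    \sum_j (l j) `^ (p / 2) * cmod (dot (u j) (w k)) ^+ 2 + 2 * delta.
  have h1 : complex.Re (dot (op_pow A p (w k) - op_poly q B (w k)) (w k)) <= delta.
    apply: (le_trans (Re_le_cmod _)); apply: (le_trans (cauchy_schwarz_hnorm _ _ _)).
    rewrite -hnormN opprB; apply: (le_trans (ler_wpM2r (hnorm_ge0 _ _) (qA _))).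
    by rewrite -mulrA -expr2 hnorm_sqr w1 mulr1.
  have h2 : complex.Re (dot (op_poly q B (w k)) (w k)) <=
      \sum_j (l j) `^ (p / 2) * cmod (dot (u j) (w k)) ^+ 2 + delta.
    rewrite (us (w k) q) ?mem_tnth// dot_suml Re_sum.
    apply: (@le_trans _ _ (\sum_j ((l j) `^ (p / 2) + delta) *
        cmod (dot (u j) (w k)) ^+ 2)).
      apply: ler_sum => j _; rewrite !dotZl Re_real_mul (dotC dot (w k)) mulrC.
      rewrite mulrC (mulrC (Num.conj _)) -cmod_sqr /= ler_wpM2r ?sqr_ge0//.
      have := hq _ (lM j); rewrite ler_norml => /andP[_]; rewrite lerBlDl; exact: id.
    under eq_bigr => j _ do rewrite mulrDl.
    rewrite big_split /= lerD2l -mulr_sumr ler_piMr ?(ltW delta0)//.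
    under eq_bigr => j _ do rewrite cmod_dotC.
    by rewrite -(w1 k); apply: bessel; exact: orthonormal_famW.
  move: h1; rewrite dotBl ReD ReN; lra.
apply: (le_trans (ler_sum _ (fun k _ => est k))).
rewrite big_split /= sumr_const card_ord; apply: lerD.
  rewrite exchange_big /=; apply: le_trans main.
  apply: ler_sum => j _; rewrite -mulr_sumr lp ler_piMr ?powR_ge0//.
  apply: le_trans (_ : sqn dot (u j) <= 1); last by rewrite /sqn ou eqxx.
  by apply: bessel; exact: orthonormal_famW.
rewrite -[_ *+ size r]mulr_natr /delta.
have -> : 2 * (e / (2 * ((size r)%:R + 1))) * (size r)%:R =
   e * ((size r)%:R / ((size r)%:R + 1)).
  by field; rewrite gt_eqF// ltr_wpDl.
by rewrite ler_piMr ?(ltW e0)// ler_pdivrMr ?mul1r ?lerDl// ltr_wpDl.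
Qed.

(** By [test_sum_svd] it is enough to bound the sum of the |X u_k|^p for an
    orthonormal family u whose images are orthogonal. Let P be the modulus of X
    and w_k the normalized P u_k. Then |X u_k| = <P u_k, w_k> is at most the mean
    of <P u_k, u_k> and <P w_k, w_k>; take p-th powers by convexity, use
    <P u, u>^p <= <P^p u, u>, and sum up each of the two families against the
    trace of P^p. *)
Lemma test_norm_le_trace T t n : (forall i, bounded_op (T i)) -> 0 <= t ->
  (op_trace (op_pow (sph_mod T) p) <= t%:E)%E ->
  test_norm dot dotK p n (column T) <= t `^ p^-1.
Proof.
move=> bT t0 trt; have [PA AT] := sph_modP bT; set A := sph_mod T in PA AT trt *.
apply: (test_norm_le p1); first exact: powR_ge0.
move=> I e f he hf; rewrite -powRrM mulVf ?gt_eqF// powRr1//.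
have lA : linear A by case: PA => [[]].
have lA2 : linear (A \o A) by move=> a x y /=; rewrite !lA.
have [N [u [ou oX le]]] := test_sum_svd p1 (column_bounded bT).1 lA2 AT he hf.
apply: (le_trans le) => {le}.
have sA := positive_selfadjoint PA.
have hA k : hnorm dotK (column T (u k)) = hnorm dot (A (u k)).
  by rewrite /hnorm /sqn -AT (sA (A (u k))).
pose s k := hnorm dot (A (u k)); pose w k := normalized dot (A (u k)).
have ow : suborthonormal_fam dot w.
  by apply: normalized_suborthonormal => k l kl; rewrite -sA AT oX.
have p0' := ltW p0; have p20 : 0 <= p / 2 by rewrite divr_ge0.
have Apos x : 0 <= complex.Re (dot (A x) x) by exact: positive_Re_ge0.
have tr (v : 'I_N -> H) : suborthonormal_fam dot v ->
    \sum_k complex.Re (dot (op_pow A p (v k)) (v k)) <= t.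
  move=> ov; rewrite -lee_fin; apply: le_trans trt.
  apply: (le_op_trace (op_pow_selfadjoint PA p20)) => //.
  by rewrite -op_powD//; congr (op_pow A _); field.
apply: (@le_trans _ _ (\sum_k 2^-1 * (complex.Re (dot (op_pow A p (u k)) (u k)) +
    complex.Re (dot (op_pow A p (w k)) (w k))))); last first.
  rewrite -mulr_sumr big_split /=.
  have := tr _ (orthonormal_famW ou); have := tr _ ow; lra.
apply: ler_sum => k _; rewrite hA -/(s k).
have uA := op_pow_jensen PA p1 ((orthonormal_famW ou).2 k).
have wA := op_pow_jensen PA p1 (ow.2 k).
pose a (b : bool) := complex.Re (if b then dot (A (u k)) (u k) else dot (A (w k)) (w k)).
have sk : s k = complex.Re (dot (A (u k)) (w k)).
  by rewrite dot_normalized.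
have := @jensen_powR _ p p1 _ (fun=> 2^-1) a (s k); rewrite !big_bool /=.
move=> /(_ _ _ _ _ _)/wrap[] => //.
- by case; exact: Apos.
- by rewrite -[leRHS](_ : 2^-1 + 2^-1 = 1)//; field.
- exact: hnorm_ge0.
(* <P (u - w), u - w> >= 0 *)
- have := Apos (u k - w k); rewrite /a (linB lA) dotBl !dotBr !ReD !ReN -sk.
  rewrite (sA (w k) (u k)) (dotC dot (w k) (A (u k))).
  rewrite ReD ReN Re_conj -sk; lra.
- move=> h; apply: (le_trans h); rewrite /a; lra.
Qed.

End TraceNorm.

(** * Convexity of the Heinz interpolation *)

(** The difference h of g and its chord vanishes at 0 and 1/2 and is bounded. If
    s is its supremum, then h(t) <= s/2 for every t, because t is the midpoint of
    an interval in [0, 1/2] one of whose ends is 0 or 1/2. So s <= s/2. No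
    continuity of g is involved. *)
Lemma midpoint_convex_chord (R : realType) (g : R -> R) (C : R) :
  (forall t, 0 <= t <= 2^-1 -> g t <= C) ->
  (forall s t, 0 <= s -> s <= t -> s + t <= 2^-1 ->
     g t <= (g (t - s) + g (t + s)) / 2) ->
  forall t, 0 <= t <= 2^-1 -> g t <= 2 * t * g 2^-1 + (1 - 2 * t) * g 0.
Proof.
move=> gC mid.
pose h t := g t - (2 * t * g 2^-1 + (1 - 2 * t) * g 0).
pose E := [set h t | t in [set t | 0 <= t <= 2^-1]]%classic.
have h0 : h 0 = 0 by rewrite /h; ring.
have h2 : h 2^-1 = 0 by rewrite /h; field.
have hub : ubound E (C + `|g 2^-1| + `|g 0|).
  move=> _ [t /= t01 <-]; have := gC t t01; move/andP: t01 => [t0 t1] gt.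
  have a1 : - (2 * t * g 2^-1) <= `|g 2^-1|.
    apply: (le_trans (ler_norm _)); rewrite normrN normrM ler_piMl//.
    by rewrite ger0_norm ?mulr_ge0//; lra.
  have a2 : - ((1 - 2 * t) * g 0) <= `|g 0|.
    apply: (le_trans (ler_norm _)); rewrite normrN normrM ler_piMl//.
    by rewrite ger0_norm; lra.
  rewrite /h; lra.
have Esup : has_sup E.
  split; last by exists (C + `|g 2^-1| + `|g 0|).
  by exists (h 0), 0 => //=; rewrite lexx invr_ge0 ler0n.
have hs t : 0 <= t <= 2^-1 -> h t <= sup E.
  by move=> t01; apply: ub_le_sup; [exact: Esup.2 | exists t].
have hmid s t : 0 <= s -> s <= t -> s + t <= 2^-1 -> h t <= (h (t - s) + h (t + s)) / 2.
  move=> s0 st st1; have := mid s t s0 st st1; rewrite /h; lra.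
have half t : 0 <= t <= 2^-1 -> h t <= sup E / 2.
  move=> /andP[t0 t1]; have [t4|/ltW t4] := leP t (2^-1 / 2).
    have := hmid t t t0 (lexx t); rewrite subrr h0 => /(_ _)/wrap[]; first lra.
    have := hs (t + t); move=> /(_ _)/wrap[]; first lra.
    lra.
  have e : t + (2^-1 - t) = 2^-1 by ring.
  have := hmid (2^-1 - t) t; rewrite e h2 => /(_ _ _ _)/wrap[]; [lra|lra|lra|].
  have := hs (t - (2^-1 - t)); move=> /(_ _)/wrap[]; first lra.
  lra.
have s0 : sup E <= 0.
  have : sup E <= sup E / 2.
    by apply: ge_sup; [exact: Esup.1 | move=> _ [t t01 <-]; exact: half].
  lra.
move=> t t01; have := hs t t01; rewrite /h; lra.
Qed.

Section SphericalPolar.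
Context {R : realType} {H : hilbertType R} {d : nat} (p : R) (p1 : 1 <= p).
Local Notation dot := (@dotH R H).
Local Notation dotK := (@dotK R H d).
Context (T V : 'I_d -> H -> H) (bT : forall i, bounded_op (T i)) (TV : sph_polar T V).
Let P := sph_mod T.
Let PP : positive_op P. Proof. by case: (sph_modP bT). Qed.
Let bV i : bounded_op (V i). Proof. by case: TV. Qed.
Let lV i : linear (V i). Proof. by case: (bV i). Qed.
Let TE i : T i = V i \o P. Proof. by case: TV. Qed.
Let p0 : 0 < p. Proof. exact: lt_le_trans p1. Qed.

(** V^* V = E is an orthogonal projection: |Vx|^2 = <Ex, x> = |Ex|^2. *)
Lemma sqn_column_V x : sqn dotK (column V x) <= sqn dot x.
Proof.
have [_ _ EP] := TV; have [S1 S2] := EP x.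
set E := \sum_(i < d) (adj (V i) \o V i) in EP S1 S2.
have := S2 _ S1; rewrite dotBl => /eqP; rewrite subr_eq0 => /eqP xE.
have -> : sqn dotK (column V x) = sqn dot (E x).
  by rewrite /sqn -(sum_adjE bV) -/E -xE (dotC dot x) Re_conj.
rewrite -[x in leRHS](subrK (E x)) sqnD.
have -> : dot (x - E x) (E x) = 0 by rewrite dotBl xE subrr.
have := sqn_ge0 dot (x - E x); rewrite [complex.Re 0]/=; lra.
Qed.

Definition diag (Q : H -> H) (y : 'I_d -> H) : 'I_d -> H := fun i => Q (y i).

Lemma diag_bounded c Q : 0 <= c -> bounded_by dot dot c Q -> bounded_by dotK dotK c (diag Q).
Proof.
move=> c0 Qc y; rewrite -(@ler_pXn2r _ 2)// ?nnegrE ?mulr_ge0 ?hnorm_ge0//.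
rewrite exprMn !hnorm_sqr !sqn_dotK mulr_sumr; apply: ler_sum => i _.
rewrite -!hnorm_sqr -exprMn ler_pXn2r ?nnegrE ?mulr_ge0 ?hnorm_ge0//; exact: Qc.
Qed.

Lemma diag_resolvent c Q S : 0 <= c -> resolvent_pair dot c Q S ->
  resolvent_pair dotK c (diag Q) (diag S).
Proof.
move=> c0 [lQ lS sQ sS [bQ cQS SE]]; split.
- by move=> a x y; apply/funext => i; exact: lQ.
- by move=> a x y; apply/funext => i; exact: lS.
- by move=> x y; rewrite !dotKE; apply: eq_bigr => i _; exact: sQ.
- by move=> x y; rewrite !dotKE; apply: eq_bigr => i _; exact: sS.
split; first exact: diag_bounded.
- by move=> x; apply/funext => i; exact: cQS.
- by move=> x; apply/funext => i; exact: SE.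
Qed.

(** The operator (P^a V P^b + P^b V P^a) / 2, with P acting diagonally on the
    column space. For (t, 1 - t) it is the column of the Heinz transform. *)
Definition interpolant a b (x : H) : 'I_d -> H :=
  fun i => (2^-1 : R[i]) *: (op_pow P a (V i (op_pow P b x)) +
                             op_pow P b (V i (op_pow P a x))).

Lemma column_heinz t : column (heinz t T V) = interpolant t (1 - t).
Proof.
apply/funext => x; apply/funext => i.
by rewrite /column /heinz /gen_aluthge /interpolant /= subKr.
Qed.

Lemma interpolantC a b : interpolant a b = interpolant b a.
Proof. by apply/funext => x; apply/funext => i; rewrite /interpolant addrC. Qed.

Lemma interpolant_linear a b : 0 <= a -> 0 <= b -> linear (interpolant a b).
Proof.
move=> a0 b0 c x y; apply/funext => i.
have la := op_pow_linear PP a0; have lb := op_pow_linear PP b0.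
rewrite -[RHS]/(c *: interpolant a b x i + interpolant a b y i) /interpolant.
have gen (h : R[i]) (A A' B B' : H) : h *: (c *: A + A' + (c *: B + B')) =
    c *: (h *: (A + B)) + h *: (A' + B').
  by rewrite addrACA -[in LHS]scalerDr [LHS]scalerDr !scalerA [c * _]mulrC.
by rewrite !(la, lb, lV i) gen.
Qed.

(** For 0 <= a <= 1 and s <= |P|, s^a <= |P| + 1. *)
Lemma op_pow_uniform_bound : exists2 M, 0 <= M &
  forall a, 0 <= a <= 1 -> bounded_by dot dot M (op_pow P a).
Proof.
have m0 := (op_norm_bounded PP.1).2.
exists (op_norm P + 1); first by rewrite addr_ge0.
move=> a /andP[a0 a1]; apply: (op_approx_norm PP _ (op_pow_approx PP a0)).
  by rewrite addr_ge0.
move=> s /andP[s0 sm]; rewrite ger0_norm ?powR_ge0//.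
apply: (@le_trans _ _ ((op_norm P + 1) `^ a)).
  apply: ge0_ler_powR; rewrite ?nnegrE ?addr_ge0//.
  by apply: (le_trans sm); rewrite lerDl.
rewrite -[leRHS]powRr1 ?addr_ge0// ler_powR//.
by rewrite lerDr.
Qed.

Lemma interpolant_bounded : exists2 M, 0 <= M &
  forall a b, 0 <= a <= 1 -> 0 <= b <= 1 -> bounded_by dot dotK M (interpolant a b).
Proof.
have [M M0 PM] := op_pow_uniform_bound; exists (M * M); first by rewrite mulr_ge0.
move=> a b a01 b01 x.
have h c e : 0 <= c <= 1 -> 0 <= e <= 1 ->
    hnorm dotK (diag (op_pow P c) (column V (op_pow P e x))) <= M * M * hnorm dot x.
  move=> c01 e01; apply: (le_trans (diag_bounded M0 (PM c c01) _)).
  rewrite -mulrA ler_wpM2l//; apply: le_trans (PM e e01 x).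
  rewrite -(@ler_pXn2r _ 2)// ?nnegrE ?hnorm_ge0// !hnorm_sqr.
  exact: sqn_column_V.
have -> : interpolant a b x = (2^-1 : R[i]) *:
   (diag (op_pow P a) (column V (op_pow P b x)) +
    diag (op_pow P b) (column V (op_pow P a x))) by [].
rewrite hnormZ cmod_half.
have := hnormD dotK (diag (op_pow P a) (column V (op_pow P b x)))
  (diag (op_pow P b) (column V (op_pow P a x))).
have := h _ _ a01 b01; have := h _ _ b01 a01; lra.
Qed.

Local Notation N n a b := (test_norm dot dotK p n (interpolant a b)).

(** Apply the arithmetic-geometric mean inequality to Q = P^s and to the
    interpolant X of exponents t - s and 1 - t - s. Then QXQ has exponents t and
    1 - t, while (Q^2 X + X Q^2) / 2 is the mean of the interpolants for t - s
    and t + s. *)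
Lemma heinz_midpoint n s t : 0 <= s -> s <= t -> s + t <= 1 ->
  N n t (1 - t) <= (N n (t - s) (1 - (t - s)) + N n (t + s) (1 - (t + s))) / 2.
Proof.
move=> s0 st st1.
have ts0 : 0 <= t - s by rewrite subr_ge0.
have ts1 : 0 <= 1 - t - s by lra.
have t0 : 0 <= t by exact: le_trans st.
have u0 : 0 <= 1 - t by lra.
have [c c0 [S QS]] := op_pow_resolvent PP s0.
have [M M0 IM] := interpolant_bounded.
have XM : bounded_by dot dotK M (interpolant (t - s) (1 - t - s)).
  by apply: IM; lra.
have lX := interpolant_linear ts0 ts1.
have := test_norm_agm p1 c0 QS (diag_resolvent c0 QS) M0 lX XM n.
set Q := op_pow P s; set X := interpolant _ _ in lX *.
have lQ : linear Q by exact: op_pow_linear.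
have QE a b e x : a + b = e -> 0 <= a -> 0 <= b -> op_pow P a (op_pow P b x) = op_pow P e x.
  by move=> <- a0 b0; rewrite (op_pow_comp PP _ a0 b0 erefl).
have X1 : (fun x => diag Q (X (Q x))) = interpolant t (1 - t).
  apply/funext => x; apply/funext => i.
  rewrite /diag /X /interpolant (linZ lQ) (linD lQ) /Q.
  rewrite (QE s (t - s) t) ?(QE s (1 - t - s) (1 - t)) ?(QE (t - s) s t)
    ?(QE (1 - t - s) s (1 - t))//; ring.
have qa y : Q (Q (op_pow P (t - s) y)) = op_pow P (t + s) y.
  by rewrite /Q (QE s (t - s) t) ?(QE s t (t + s))//; ring.
have qb y : Q (Q (op_pow P (1 - t - s) y)) = op_pow P (1 - (t - s)) y.
  by rewrite /Q (QE s (1 - t - s) (1 - t)) ?(QE s (1 - t) (1 - (t - s)))//; ring.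
have aq y : op_pow P (t - s) (Q (Q y)) = op_pow P (t + s) y.
  by rewrite /Q (QE (t - s) s t) ?(QE t s (t + s))//; ring.
have bq y : op_pow P (1 - t - s) (Q (Q y)) = op_pow P (1 - (t - s)) y.
  by rewrite /Q (QE (1 - t - s) s (1 - t)) ?(QE (1 - t) s (1 - (t - s)))//; ring.
have X2 : (fun x => (2^-1 : R[i]) *: (diag Q (diag Q (X x)) + X (Q (Q x)))) =
    (fun x => (2^-1 : R[i]) *: (interpolant (t - s) (1 - (t - s)) x +
       interpolant (t + s) (1 - (t + s)) x)).
  apply/funext => x; apply/funext => i.
  have e : 1 - (t + s) = 1 - t - s by ring.
  rewrite /diag /X /interpolant /= e; congr (_ *: _).
  change (Q (Q ((2^-1 : R[i]) *: (op_pow P (t - s) (V i (op_pow P (1 - t - s) x)) +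
     op_pow P (1 - t - s) (V i (op_pow P (t - s) x))))) +
     (2^-1 : R[i]) *: (op_pow P (t - s) (V i (op_pow P (1 - t - s) (Q (Q x)))) +
       op_pow P (1 - t - s) (V i (op_pow P (t - s) (Q (Q x))))) =
    (2^-1 : R[i]) *: (op_pow P (t - s) (V i (op_pow P (1 - (t - s)) x)) +
       op_pow P (1 - (t - s)) (V i (op_pow P (t - s) x))) +
    (2^-1 : R[i]) *: (op_pow P (t + s) (V i (op_pow P (1 - t - s) x)) +
       op_pow P (1 - t - s) (V i (op_pow P (t + s) x)))).
  rewrite !(linZ lQ) !(linD lQ) qa qb aq bq -!scalerDr; congr (_ *: _).
  by rewrite addrACA [in RHS]addrACA; congr (_ + _); exact: addrC.
rewrite X1 X2 => /le_trans; apply.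
have b1 : bounded_by dot dotK M (interpolant (t - s) (1 - (t - s))) by apply: IM; lra.
have b2 : bounded_by dot dotK M (interpolant (t + s) (1 - (t + s))) by apply: IM; lra.
exact: (test_norm_half p1 n M0 b1 b2 (fun=> erefl)).
Qed.

(** The interpolant is symmetric in its exponents, so t <= 1/2 may be assumed.
    The test norms are bounded in t because n is fixed. *)
Lemma heinz_chord n t : 0 <= t <= 1 ->
  N n t (1 - t) <= 2 * Num.min t (1 - t) * N n 2^-1 (1 - 2^-1)
    + (1 - 2 * Num.min t (1 - t)) * N n 0 1.
Proof.
move=> t01.
have [M M0 IM] := interpolant_bounded.
suff chord u : 0 <= u <= 2^-1 ->
    N n u (1 - u) <= 2 * u * N n 2^-1 (1 - 2^-1) + (1 - 2 * u) * N n 0 1.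
  case: (leP t (1 - t)) => ht; first by apply: chord; lra.
  rewrite interpolantC; have := chord (1 - t); rewrite subKr; apply; lra.
move=> u2.
have := @midpoint_convex_chord _ (fun u => N n u (1 - u)) ((n%:R * M `^ p) `^ p^-1) _ _ u u2.
rewrite subr0; apply.
  move=> v v2; apply: (test_norm_le p1); first exact: powR_ge0.
  move=> I e f he hf; rewrite -powRrM mulVf ?gt_eqF// powRr1; last first.
    by rewrite mulr_ge0 ?powR_ge0.
  have bI : bounded_by dot dotK M (interpolant v (1 - v)) by apply: IM; lra.
  exact: (test_sum_bound p1 M0 bI he hf).
move=> s v s0 sv sv1; apply: heinz_midpoint => //; lra.
Qed.

(** The midpoint inequality for the interval [0, 1], whose ends give the same
    operator by symmetry. *)
Lemma heinz_half_le n : N n 2^-1 (1 - 2^-1) <= N n 0 1.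
Proof.
have := @heinz_midpoint n 2^-1 2^-1; rewrite subrr subr0.
have -> : (2^-1 + 2^-1 : R) = 1 by field.
rewrite subrr (interpolantC 1 0) => /(_ _ _ _)/wrap[]; [lra|lra|lra|].
move/le_trans; apply; lra.
Qed.

(** The pairings of y with the vectors V e_ji are those of V^* y with the e_ji,
    and both V and V^* are contractions. *)
Lemma column_V_bessel n (I : finType) (e : 'I_n -> I -> H) :
  bessel_data dot e -> bessel_data dotK (fun j i => column V (e j i)).
Proof.
move=> [eB e1]; split=> [y|j].
  (* Vy is V^* y. *)
  pose Vy := \sum_i adj (V i) (y i).
  have VyE x : dotK y (column V x) = dot Vy x.
    rewrite dotKE dot_suml; apply: eq_bigr => i _.
    by have [_ h] := adjP (bV i); rewrite /column [LHS]dotC h -dotC.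
  under eq_bigr => j _ do under eq_bigr => i _ do rewrite VyE.
  apply: (le_trans (eB Vy)).
  have [V0|Vn0] := eqVneq (sqn dot Vy) 0; first by rewrite V0 sqn_ge0.
  have V0 : 0 < sqn dot Vy by rewrite lt_def Vn0 sqn_ge0.
  rewrite -(ler_pM2r V0).
  have -> : sqn dot Vy * sqn dot Vy = cmod (dotK y (column V Vy)) ^+ 2.
    by rewrite VyE sqnE cmod_real ger0_norm ?sqn_ge0// expr2.
  apply: (le_trans (cauchy_schwarz _ _ _)); rewrite ler_wpM2l ?sqn_ge0//.
  exact: sqn_column_V.
by apply: le_trans (e1 j); apply: ler_sum => i _; exact: sqn_column_V.
Qed.

(** The Duggal transform is V followed by P acting diagonally. V sends test data
    to test data, and the diagonal operator has each singular value of P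
    repeated d times, which accounts for the factor d. *)
Lemma duggal_test_sum t n (I : finType) (e : 'I_n -> I -> H)
    (f : 'I_n -> I -> 'I_d -> H) :
  (op_trace (op_pow P p) <= t%:E)%E -> bessel_data dot e -> bessel_data dotK f ->
  test_sum dotK p (column (duggal T V)) e f <= d%:R * t.
Proof.
move=> trt he hf.
have [lP [M M0 PM]] := (bounded_opP P).1 PP.1.
have sP := positive_selfadjoint PP.
have P0 x : 0 <= complex.Re (dot (P x) x) by exact: positive_Re_ge0.
pose r := [seq V x.2 (e x.1.1 x.1.2) | x <- enum {: 'I_n * I * 'I_d}].
have er j i k : V k (e j i) \in r.
  by apply/mapP; exists ((j, i), k) => //; rewrite mem_enum.
have [K [u [l [ou lM lE _ us]]]] := op_poly_spectral lP sP PM P0 r 1.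
have PVE j i k : P (V k (e j i)) =
    \sum_q (l q)%:C%C *: (dot (V k (e j i)) (u q) *: u q).
  rewrite -(op_polyX lP) (us _ 'X (er _ _ _)) ?size_polyX//.
  by under eq_bigr do rewrite hornerX.
pose U (qk : 'I_K * 'I_d) : 'I_d -> H := fun k => if k == qk.2 then u qk.1 else 0.
have dotU y qk : dotK y (U qk) = dot (y qk.2) (u qk.1).
  rewrite dotKE (bigD1 qk.2)//= /U eqxx big1 ?addr0// => k /negbTE ->.
  by rewrite dot0r.
have oU : suborthonormal_fam dotK U.
  apply: orthonormal_famW => -[q k] [q' k']; rewrite dotU /U /= xpair_eqE.
  by case: (eqVneq k' k) => _; rewrite ?dot0l ?ou ?andbT ?andbF.
have main := @test_sum_schmidt _ _ _ dotK dotK p p1 _ U U (fun qk => l qk.1)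
  (diag P) n I (fun j i => column V (e j i)) f oU oU.
apply: (@le_trans _ _ (\sum_(qk : 'I_K * 'I_d) l qk.1 `^ p)).
  apply: main => //.
  - by move=> [q k]; have /andP[] := lM q.
  - exact: column_V_bessel.
  - move=> j i; rewrite dotKE.
    rewrite -(pair_big xpredT xpredT (fun q k => (l q)%:C%C *
      (dotK (column V (e j i)) (U (q, k)) * dotK (U (q, k)) (f j i)))) /=.
    rewrite exchange_big /=; apply: eq_bigr => k _.
    rewrite /diag /column PVE dot_suml; apply: eq_bigr => q _.
    by rewrite !dotZl dotU /= (dotC dotK (U (q, k))) dotU /= -dotC.
rewrite -(pair_big xpredT xpredT (fun q (k : 'I_d) => l q `^ p)) /=.
under eq_bigr do rewrite sumr_const card_ord -mulr_natl.
rewrite -mulr_sumr ler_wpM2l//.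
have p20 : 0 <= p / 2 by rewrite divr_ge0// ltW.
rewrite -lee_fin; apply: le_trans trt.
apply: le_trans (le_op_trace (op_pow_selfadjoint PP p20) _ (orthonormal_famW ou)); last first.
  by rewrite -op_powD//; congr (op_pow P _); field.
rewrite lee_fin; apply: ler_sum => q _; rewrite -lE.
by apply: op_pow_jensen => //; exact: (orthonormal_famW ou).2.
Qed.

Lemma column_sph_mean : column (sph_mean T V) = interpolant 0 1.
Proof.
apply/funext => x; apply/funext => i.
by rewrite /column /sph_mean /duggal /interpolant op_pow0// op_pow1// TE.
Qed.

Lemma column_aluthge : column (aluthge T V) = interpolant 2^-1 (1 - 2^-1).
Proof.
apply/funext => x; apply/funext => i.
rewrite /column /aluthge /gen_aluthge /interpolant /=.
have -> : (1 - 2^-1 : R) = 2^-1 by field.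
rewrite -/P; set y := op_pow P _ _.
rewrite scalerDr -scalerDl (_ : 2^-1 + 2^-1 = 1 :> R[i]) ?scale1r//.
by field.
Qed.

End SphericalPolar.

(** * The norm inequalities *)

Lemma bounded_op_comp (R : realType) (H : hilbertType R) (A B : H -> H) :
  bounded_op A -> bounded_op B -> bounded_op (A \o B).
Proof.
move=> [lA cA] [lB cB]; split; first by move=> a x y /=; rewrite lB lA.
by move=> x; apply: continuous_comp; [exact: cB | exact: cA].
Qed.

Lemma bounded_op_half (R : realType) (H : hilbertType R) (A B : H -> H) :
  bounded_op A -> bounded_op B -> bounded_op ((2^-1 : R[i]) *: (A + B)).
Proof.
move=> [lA cA] [lB cB]; split.
  move=> a x y; change ((2^-1 : R[i]) *: (A (a *: x + y) + B (a *: x + y)) =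
    a *: ((2^-1 : R[i]) *: (A x + B x)) + (2^-1 : R[i]) *: (A y + B y)).
  by rewrite lA lB addrACA -[in LHS]scalerDr [LHS]scalerDr !scalerA [a * _]mulrC.
move=> x; apply: cvgZr; apply: cvgD; [exact: cA | exact: cB].
Qed.

Section SphericalNorm.
Context {R : realType} {H : hilbertType R} {d : nat} (p : R) (p1 : 1 <= p).
Local Notation dot := (@dotH R H).
Local Notation dotK := (@dotK R H d).
Let p0 : 0 < p. Proof. exact: lt_le_trans p1. Qed.
Implicit Types (T : 'I_d -> H -> H).

Lemma op_trace_ge0 T : (forall i, bounded_op (T i)) ->
  (0 <= op_trace (op_pow (sph_mod T) p))%E.
Proof.
move=> bT; have [PA _] := sph_modP bT; apply: esum_ge0 => e _.
have [_ /(_ e)] := op_pow_positive PA (ltW p0).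
by rewrite lecE lee_fin => /andP[].
Qed.

(** Bounded test norms give membership in the Schatten class together with the
    bound on the norm. *)
Lemma sph_norm_of_test T c : (forall i, bounded_op (T i)) -> 0 <= c ->
  (forall n, test_norm dot dotK p n (column T) <= c) ->
  in_schatten p T /\ (sph_norm p T <= c%:E)%E.
Proof.
move=> bT c0 Tc; have tr := op_trace_le_test p1 bT c0 Tc.
split; first by split=> //; exact: le_lt_trans tr (ltry _).
rewrite /sph_norm; apply: (@le_trans _ _ ((c `^ p)%:E `^ p^-1)%E).
  apply: gt0_ler_poweR => //; rewrite ?in_itv/= ?leey ?andbT//.
  - by rewrite invr_ge0 ltW.
  - exact: op_trace_ge0.
  - by rewrite lee_fin powR_ge0.
by rewrite poweR_EFin -powRrM mulfV ?gt_eqF// powRr1.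
Qed.

Lemma sph_norm_fin T : in_schatten p T -> exists2 s, sph_norm p T = s%:E &
  [/\ 0 <= s, op_trace (op_pow (sph_mod T) p) = (s `^ p)%:E &
      forall n, test_norm dot dotK p n (column T) <= s].
Proof.
move=> [bT trT]; have tr0 := op_trace_ge0 bT; rewrite /sph_norm.
have le n t := @test_norm_le_trace _ _ _ p p1 T t n bT.
case: (op_trace _) trT tr0 le => [t _|//|//]; rewrite lee_fin => t0 le.
exists (t `^ p^-1) => //; split; first exact: powR_ge0.
  by rewrite -powRrM mulVf ?gt_eqF// powRr1.
by move=> n; exact: le.
Qed.

End SphericalNorm.

Theorem theorem3p4 (R : realType) (H : hilbertType R)
    (Hsep : separable_space H) (d : nat) (p : R) (p1 : 1 <= p)
    (T V : 'I_d -> H -> H) (Tp : in_schatten p T) (TV : sph_polar T V) :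
  (forall t : R, 0 <= t <= 1 ->
    let r0 := Num.min t (1 - t) in
    [/\ in_schatten p (heinz t T V),
        (sph_norm p (heinz t T V) <=
           (2 * r0)%:E * sph_norm p (aluthge T V)
           + (1 - 2 * r0)%:E * sph_norm p (sph_mean T V))%E,
        ((2 * r0)%:E * sph_norm p (aluthge T V)
           + (1 - 2 * r0)%:E * sph_norm p (sph_mean T V)
         <= sph_norm p (sph_mean T V))%E
      & (sph_norm p (sph_mean T V) <=
           ((1 + d%:R `^ p^-1) / 2)%:E * sph_norm p T)%E]) /\
  (sph_norm p (aluthge T V) <= sph_norm p (sph_mean T V))%E /\
  (sph_norm p (sph_mean T V) <=
     ((1 + d%:R `^ p^-1) / 2)%:E * sph_norm p T)%E.
Proof.
have bT := Tp.1; have p0 : 0 < p := lt_le_trans ltr01 p1.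
have [PP _] := sph_modP bT; set P := sph_mod T in PP.
have bV i : bounded_op (V i) by case: TV.
have gen_bounded t i : 0 <= t <= 1 -> bounded_op (gen_aluthge t T V i).
  move=> /andP[t0 t1]; apply: bounded_op_comp; last by apply: op_pow_bounded; rewrite ?subr_ge0.
  by apply: bounded_op_comp => //; exact: op_pow_bounded.
have heinz_bounded t i : 0 <= t <= 1 -> bounded_op (heinz t T V i).
  by move=> t01; apply: bounded_op_half; apply: gen_bounded; lra.
have mean_bounded i : bounded_op (sph_mean T V i).
  by apply: bounded_op_half => //; apply: bounded_op_comp => //; case: PP.
have al_bounded i : bounded_op (aluthge T V i) by apply: gen_bounded; lra.
have [tau tauE [tau0 trT Ttau]] := sph_norm_fin p1 Tp.
pose D := (d%:R : R) `^ p^-1; have D0 : 0 <= D by exact: powR_ge0.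
pose mu0 := (1 + D) / 2 * tau.
have mu00 : 0 <= mu0 by rewrite mulr_ge0 ?divr_ge0 ?addr_ge0.
have duggal_bounded i : bounded_op (duggal T V i) by apply: bounded_op_comp => //; case: PP.
(* The mean of T and of its Duggal transform: the triangle inequality for test
   norms, which are at most tau and d^(1/p) tau. *)
have mean_le n : test_norm dotH dotK p n (column (sph_mean T V)) <= mu0.
  have dle : test_norm dotH dotK p n (column (duggal T V)) <= D * tau.
    apply: (test_norm_le p1); first exact: mulr_ge0.
    move=> I e f he hf; rewrite powRM// -powRrM mulVf ?gt_eqF// powRr1//.
    by apply: (duggal_test_sum p1 bT TV) => //; rewrite trT.
  have [_ [M1 M10 b1]] := column_bounded bT.
  have [_ [M2 M20 b2]] := column_bounded duggal_bounded.
  have b1' : bounded_by dotH dotK (M1 + M2) (column T).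
    by move=> x; apply: (le_trans (b1 x)); rewrite ler_wpM2r ?hnorm_ge0// lerDl.
  have b2' : bounded_by dotH dotK (M1 + M2) (column (duggal T V)).
    by move=> x; apply: (le_trans (b2 x)); rewrite ler_wpM2r ?hnorm_ge0// lerDr.
  have := test_norm_half p1 n (addr_ge0 M10 M20) b1' b2' (Z := column (sph_mean T V))
    (fun=> erefl).
  move=> /le_trans; apply; rewrite /mu0.
  have := Ttau n; move: dle; move: (test_norm _ _ _ _ _) (test_norm _ _ _ _ _) => x y.
  lra.
have [mean_in _] := sph_norm_of_test p1 mean_bounded mu00 mean_le.
have [_ mean_mu] := sph_norm_of_test p1 mean_bounded mu00 mean_le.
have [mu muE [mu_0 _ mean_test]] := sph_norm_fin p1 mean_in.
have al_test n : test_norm dotH dotK p n (column (aluthge T V)) <= mu.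
  apply: le_trans (mean_test n).
  rewrite (column_aluthge T V) (column_sph_mean bT TV).
  exact: (heinz_half_le p1 bT TV n).
have [al_in al_mu] := sph_norm_of_test p1 al_bounded mu_0 al_test.
have [al alE [al_0 _ al_test']] := sph_norm_fin p1 al_in.
have last_le : (sph_norm p (sph_mean T V) <= ((1 + d%:R `^ p^-1) / 2)%:E * sph_norm p T)%E.
  by apply: (le_trans mean_mu); rewrite tauE -EFinM lexx.
split; last by split; [rewrite muE; exact: al_mu | exact: last_le].
move=> t t01 r0.
have [r00 r02] : 0 <= r0 /\ 2 * r0 <= 1.
  by rewrite /r0; case: (leP t (1 - t)) => ht; split; lra.
have al_le_mu : al <= mu by move: al_mu; rewrite alE lee_fin.
rewrite alE muE -!EFinM -EFinD in last_le *.
have c0 : 0 <= 2 * r0 * al + (1 - 2 * r0) * mu.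
  by rewrite addr_ge0 ?mulr_ge0//; lra.
(* The chord inequality for test norms, whose ends are the Aluthge transform and
   the mean transform. *)
have ht n : test_norm dotH dotK p n (column (heinz t T V)) <=
    2 * r0 * al + (1 - 2 * r0) * mu.
  rewrite (column_heinz T V t); apply: (le_trans (heinz_chord p1 bT TV n t01)).
  rewrite -/r0 -(column_aluthge T V) -(column_sph_mean bT TV).
  apply: lerD; rewrite ler_wpM2l//; [exact: mulr_ge0|lra].
have [h_in h_le] := sph_norm_of_test p1 (fun i => heinz_bounded t i t01) c0 ht.
split=> //; rewrite lee_fin.
have := ler_wpM2l (mulr_ge0 (ler0n R 2) r00) al_le_mu; lra.
Qed.
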